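(* Let $\zeta$ be an aperiodic primitive substitution of Salem type, i.e. such that its substitution matrix has an irreducible characteristic polynomial over $\mathbb{Q}$ and its Perron-Frobenius eigenvalue $\alpha$ is a Salem number. Then: (i) For almost every $f\in\mathrm{Cyl}(X_\zeta)$, $$\inf\bigl\{\underline{d}(\sigma_f,\omega):\ \omega\in\mathbb{Z}[\alpha]\cap(0,1)\bigr\}=0.$$ (ii) For almost every $f\in\mathrm{Cyl}(X_\zeta)$ of mean zero the following holds: for any $\vartheta>0$ and any $C>0$ there exists a sequence $N_i\to\infty$ such that $$\frac1{N_i}\sum_{k=0}^{N_i-1}\bigl|\langle U^kf,f\rangle\bigr|^2\ge C\,N_i^{-\vartheta}.$$
   Context: Alphabet and substitution: $\mathcal{A}=\{0,\dots,d-1\}$, $d\ge2$; $\mathcal{A}^+$ is the set of nonempty finite words. A substitution is a map $\zeta:\mathcal{A}\to\mathcal{A}^+$, extended to words and sequences by concatenation. The substitution space $X_\zeta$ is the set of $x\in\mathcal{A}^{\mathbb{Z}}$ such that every finite word in $x$ is a subword of $\zeta^n(a)$ for some $a\in\mathcal{A}$, $n\in\mathbb{N}$. $T$ is the left shift on $X_\zeta$. The substitution matrix $S_\zeta$ is the $d\times d$ matrix whose entry $S_\zeta(i,j)$ is the number of symbols $i$ in $\zeta(j)$. $\zeta$ is primitive if some power of $S_\zeta$ has all entries strictly positive; a primitive $\zeta$ is aperiodic (non-periodic) iff $X_\zeta$ is infinite. For primitive $\zeta$ the system is uniquely ergodic and $\mu$ denotes the unique $T$-invariant Borel probability measure. $Uf=f\circ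 T$ on $L^2(X_\zeta,\mu)$, with scalar product $\langle\cdot,\cdot\rangle$. A Salem number is a real algebraic integer greater than $1$ whose other conjugates all have modulus at most $1$, with at least one of modulus exactly $1$. $\mathrm{Cyl}(X_\zeta)$ is the $d$-dimensional complex vector space of cylindrical functions of level $0$: $f=\sum_{j=0}^{d-1}b_j\mathbf{1}_{[j]}$, where $[j]=\{x\in X_\zeta:x_0=j\}$. ''Almost every $f\in\mathrm{Cyl}(X_\zeta)$'' means for Lebesgue-a.e. $(b_0,\dots,b_{d-1})$; ''almost every $f$ of mean zero'' means almost every with respect to Lebesgue measure on the hyperplane $\{(b_j):\int f\,d\mu=0\}$. For $f\in L^2(X_\zeta,\mu)$ the spectral measure $\sigma_f$ is the finite positive measure on $\mathbb{R}/\mathbb{Z}\cong[0,1)$ determined by $\int_0^1 e^{2\pi i k\omega}\,d\sigma_f(\omega)=\langle f\circ T^k,f\rangle$, $k\in\mathbb{Z}$. The lower local dimension of a finite positive measure $\nu$ at $\omega$ is $\underline{d}(\nu,\omega)=\liminf_{r\to0}\frac{\log\nu(B_r(\omega))}{\log r}$, where $B_r(\omega)$ is the ball of radius $r$ centered at $\omega$. *)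

(* Defs.v *)
From HB Require Import structures.
From mathcomp Require Import all_boot all_order all_algebra.
From mathcomp Require Import all_classical all_reals all_analysis.
From mathcomp Require Import complex.

Set Implicit Arguments.
Unset Strict Implicit.
Unset Printing Implicit Defensive.

Import Order.TTheory GRing.Theory Num.Theory.
Import numFieldNormedType.Exports.

Local Open Scope classical_set_scope.
Local Open Scope ring_scope.
Local Open Scope complex_scope.

(** ** Substitutions *)

Section Substitution.
Variable d : nat.
Implicit Types (zeta : 'I_d -> seq 'I_d) (w : seq 'I_d) (a : 'I_d).

Definition nonerasing zeta : Prop := forall a, zeta a != [::].

Definition subst_word zeta w : seq 'I_d := flatten (map zeta w).

Definition subst_iter zeta (n : nat) a : seq 'I_d :=
  iter n (subst_word zeta) [:: a].

Definition factor (x : int -> 'I_d) (i : int) (n : nat) : seq 'I_d :=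
  mkseq (fun k => x (i + k%:Z)) n.

Definition subst_space zeta : set (int -> 'I_d) :=
  [set x | forall i n, exists a m, infix (factor x i n) (subst_iter zeta m a)].

Definition subst_mx (K : pzRingType) zeta : 'M[K]_d :=
  \matrix_(i, j) (count_mem i (zeta j))%:R.

Definition primitive_subst zeta : Prop :=
  exists n : nat, forall i j, 0 < (subst_mx int zeta ^+ n) i j.

(* For primitive substitutions, which are the only ones considered here,
   non-periodicity means that the substitution space is infinite. *)
Definition aperiodic_subst zeta : Prop := infinite_set (subst_space zeta).

End Substitution.

(** ** Salem numbers and Perron-Frobenius eigenvalues *)

Section Salem.
Variable R : realType.

(* [z] is a root of the minimal polynomial of [x] over the rationals; [x]
   itself is one of its conjugates. *)
Definition conjugate_of (x : R) (z : R[i]) : Prop :=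
  exists p : {poly rat}, [/\ p \is monic, irreducible_poly p,
    root (map_poly ratr p) x & root (map_poly ratr p) z].

Definition Salem_number (x : R) : Prop :=
  [/\ integralOver (intr : int -> R) x, 1 < x,
      forall z, conjugate_of x z -> z != x%:C -> Normc.normc z <= 1 &
      exists z, [/\ conjugate_of x z, z != x%:C & Normc.normc z = 1]].

(* The eigenvalue equal to the spectral radius. *)
Definition PF_eigenvalue d (A : 'M[R]_d) (x : R) : Prop :=
  eigenvalue A x /\
  forall z : R[i], eigenvalue (map_mx (real_complex R) A) z ->
    Normc.normc z <= x.

Definition Salem_type d (zeta : 'I_d -> seq 'I_d) (x : R) : Prop :=
  [/\ irreducible_poly (char_poly (subst_mx rat zeta)),
      PF_eigenvalue (subst_mx R zeta) x & Salem_number x].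

Definition Z_adjoin (x : R) : set R :=
  [set y | exists p : {poly int}, y = (map_poly intr p).[x]].

End Salem.

(** ** The two-sided full shift and its Borel sigma-algebra *)

(* The proof argument only serves to make the type nonempty, as the library
   requires of measurable types. *)
Definition biseq (d : nat) (hd : (1 < d)%N) : Type := int -> 'I_d.

HB.instance Definition _ d (hd : (1 < d)%N) :=
  Choice.copy (biseq hd) (int -> 'I_d).
HB.instance Definition _ d (hd : (1 < d)%N) :=
  isPointed.Build (biseq hd) (fun=> Ordinal (ltnW hd)).

Definition coord_sets d (hd : (1 < d)%N) : set (set (biseq hd)) :=
  [set A | exists (n : int) (a : 'I_d), A = [set x | x n = a]].

(* The product topology on sequences over a finite alphabet has a countable
   base of finite intersections of the sets [{x | x_n = a}], so these generate
   its Borel sigma-algebra. *)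
Definition full_shift d (hd : (1 < d)%N) := g_sigma_algebraType (@coord_sets d hd).

Section ShiftAndIntegrals.
Variables (R : realType) (d : nat) (hd : (1 < d)%N).
Implicit Types (zeta : 'I_d -> seq 'I_d) (mu : probability (full_shift hd) R).

Definition shift_pow (k : int) (x : full_shift hd) : full_shift hd :=
  fun n => x (n + k).

(* A Borel probability measure on the closed set [subst_space zeta] is the same
   thing as one on the full shift giving it full mass. *)
Definition invariant_probability zeta mu : Prop :=
  mu (subst_space zeta) = 1%E /\
  forall A : set (full_shift hd), measurable A ->
    mu (shift_pow 1 @^-1` A) = mu A.

Definition cylinder zeta (j : 'I_d) : set (full_shift hd) :=
  [set x | subst_space zeta x /\ x 0 = j].

Definition cyl_fun zeta (b : 'rV[R[i]]_d) (x : full_shift hd) : R[i] :=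
  \sum_(j < d) b 0 j * \1_(cylinder zeta j) x.

End ShiftAndIntegrals.
Arguments cylinder {d} hd zeta j.
Arguments cyl_fun {R d} hd zeta b x.

Definition cintegral (R : realType) disp (T : measurableType disp)
    (mu : {measure set T -> \bar R}) (D : set T) (f : T -> R[i]) : R[i] :=
  (\int[mu]_(x in D) complex.Re (f x)) +i* (\int[mu]_(x in D) complex.Im (f x)).

Section Spectral.
Variables (R : realType) (d : nat) (hd : (1 < d)%N).
Variable mu : probability (full_shift hd) R.
Implicit Types f g : full_shift hd -> R[i].

Definition dotL2 f g : R[i] := cintegral mu setT (fun x => f x * (g x)^*).

Definition autocorr f (k : int) : R[i] := dotL2 (f \o @shift_pow d hd k) f.

(* Measures on the circle are represented by measures on the line carried by
   the fundamental domain [[0, 1)]. *)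
Definition spectral_measure f
    (sigma : {finite_measure set (measurableTypeR R) -> \bar R}) : Prop :=
  sigma (~` `[0, 1[) = 0%E /\
  forall k : int,
    cintegral sigma `[0, 1[
      (fun w : R => cos (2 * pi * k%:~R * w) +i* sin (2 * pi * k%:~R * w))
    = autocorr f k.

End Spectral.

Section LocalDimension.
Variable R : realType.

(* The ball of the circle, pulled back to the line. *)
Definition circle_ball (w r : R) : set (measurableTypeR R) :=
  [set x : R | exists m : int, `|x - w - m%:~R| < r].

Definition lower_local_dim (nu : set (measurableTypeR R) -> \bar R) (w : R)
    : \bar R :=
  limf_einf (fun r : R => (lne (nu (circle_ball w r)) * ((ln r)^-1)%:E)%E) 0^'+.

End LocalDimension.

(** ** Lebesgue measure on finite-dimensional spaces *)

Section LebesgueStep.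
Variable R : realType.
Local Notation mR := (measurableTypeR R).
Variables (n : nat) (m : {sigma_finite_measure set (n.-tuple mR) -> \bar R}).

Definition tcons (p : mR * n.-tuple mR) : n.+1.-tuple mR :=
  [the n.+1.-tuple mR of p.1 :: p.2].

Lemma measurable_tcons : measurable_fun [set: mR * n.-tuple mR] tcons.
Proof. exact: measurable_cons. Qed.

Definition lebesgue_cons : set (n.+1.-tuple mR) -> \bar R :=
  pushforward (@lebesgue_measure R \x m)%E tcons.

Let lebesgue_cons0 : lebesgue_cons set0 = 0%E.
Proof. by rewrite /lebesgue_cons /pushforward preimage_set0 measure0. Qed.

Let lebesgue_cons_ge0 A : (0 <= lebesgue_cons A)%E.
Proof. by rewrite /lebesgue_cons /pushforward measure_ge0. Qed.

Let lebesgue_cons_sigma_additive : semi_sigma_additive lebesgue_cons.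
Proof.
move=> F mF tF mUF; rewrite /lebesgue_cons /pushforward preimage_bigcup.
apply: measure_semi_sigma_additive.
- by move=> i; rewrite -[X in measurable X]setTI; exact: measurable_tcons.
- by apply/trivIsetP => i j _ _ ij; rewrite -preimage_setI;
     move/trivIsetP : tF => -> //; rewrite preimage_set0.
- rewrite -preimage_bigcup -[X in measurable X]setTI.
  exact: measurable_tcons.
Qed.

HB.instance Definition _ := isMeasure.Build _ _ _ lebesgue_cons
  lebesgue_cons0 lebesgue_cons_ge0 lebesgue_cons_sigma_additive.

Let tuncons (t : n.+1.-tuple mR) : mR * n.-tuple mR :=
  (tnth t ord0, [tuple of behead t]).

Let measurable_tuncons : measurable_fun [set: n.+1.-tuple mR] tuncons.
Proof.
apply/measurable_fun_pairP; split; first exact: measurable_tnth.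
exact: measurable_behead.
Qed.

Let tconsK : cancel tcons tuncons.
Proof. by case=> x t; congr pair; apply/val_inj. Qed.

Let lebesgue_cons_sigma_finite : sigma_finite setT lebesgue_cons.
Proof.
have [F TF Foo] : sigma_finite setT (@lebesgue_measure R \x m)%E.
  have /sigma_finiteP[F [TF ndF Foo]] := sigma_finiteT (@lebesgue_measure R).
  have /sigma_finiteP[G [TG ndG Goo]] := sigma_finiteT m.
  exists (fun k => F k `*` G k).
    rewrite -setXTT TF TG predeqE => -[x y]; split.
      move=> [/= [i _ Fix] [j _ Gjy]]; exists (maxn i j) => //; split.
      - by move: x Fix; exact/subsetPset/ndF/leq_maxl.
      - by move: y Gjy; exact/subsetPset/ndG/leq_maxr.
    by move=> [k _ []/= ? ?]; split; exists k.
  move=> k; have [? ?] := Foo k; have [? ?] := Goo k.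
  split; first exact: measurableX.
  by rewrite [X in (X < _)%E]product_measure1E// lte_mul_pinfty// ge0_fin_numE.
exists (fun k => tuncons @^-1` F k).
  by rewrite -preimage_bigcup -TF preimage_setT.
move=> k; have [mFk Fkoo] := Foo k; split.
  by rewrite -[X in measurable X]setTI; exact: measurable_tuncons.
rewrite /lebesgue_cons /pushforward -comp_preimage.
by rewrite (_ : tuncons \o tcons = id)//; apply/funext => p /=; rewrite tconsK.
Qed.

HB.instance Definition _ := Measure_isSigmaFinite.Build _ _ _ lebesgue_cons
  lebesgue_cons_sigma_finite.

End LebesgueStep.

Fixpoint lebesgue_tuple (R : realType) (n : nat) :
    {sigma_finite_measure set (n.-tuple (measurableTypeR R)) -> \bar R} :=
  match n with
  | 0 => \d_([tuple] : 0.-tuple (measurableTypeR R))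
  | m.+1 => lebesgue_cons (lebesgue_tuple R m)
  end.

Section AlmostEvery.
Variable R : realType.

(* The first [n] real coordinates are the real parts, the last [n] ones the
   imaginary parts. *)
Definition cvec n (t : (n + n).-tuple (measurableTypeR R)) : 'rV[R[i]]_n :=
  \row_(j < n) ((tnth t (lshift n j) : R) +i* (tnth t (rshift n j) : R)).

Definition ae_cvec n (P : 'rV[R[i]]_n -> Prop) : Prop :=
  {ae lebesgue_tuple R (n + n), forall t, P (cvec t)}.

(* Lebesgue measure on a linear subspace [H] is transported from the space of
   coordinates in a basis of [H] (the rows of [B]); its null sets do not depend
   on the choice of the basis. *)
Definition ae_subspace d (H : set 'rV[R[i]]_d) (P : 'rV[R[i]]_d -> Prop)
    : Prop :=
  exists m (B : 'M[R[i]]_(m, d)),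
    [/\ row_free B, H = [set v | (v <= B)%MS] &
        ae_cvec (fun c : 'rV_m => P (c *m B))].

End AlmostEvery.

(* Main.v *)
(* Let q = e(-om). The twisted sums of b over the words zeta^n(a) form vectors with
   Phi_(n+1) = A_n Phi_n, where A_n is the transpose of the substitution matrix with
   its entries weighted by powers of q. If om = p(alpha), where the values of p at
   alpha and at all conjugates of modulus at least 1 are nearly equal, then
   om |zeta^n(a)| is nearly an integer for large n, and A_n is a small perturbation
   of a diagonalizable matrix with eigenvalues alpha and numbers of modulus at most
   1. By a cone argument Phi_n grows like rho^n, with rho close to alpha, unless b
   lies in a subspace E; such p exist by simultaneous approximation because some
   conjugate of alpha has modulus less than 1.

   E is proper once no det A_k vanishes. These determinants are integer polynomials
   in q of bounded height, and if one of them vanished for every admissible om, then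
   infinitely many numbers e(-om) in a single number field would have bounded
   height, contradicting Northcott's theorem. Constants belong to E because q <> 1,
   so E does not contain the hyperplane of functions of mean zero.

   Every window of length comparable to alpha^n of a point of the substitution space
   contains zeta^n(a). Hence along every orbit the twisted sums of length m are large
   for a long stretch of m, and the sum of their squared L^2 norms over m < M, with
   M comparable to alpha^n, is at least of order rho^(3n). Expanding in correlations
   and using the Cauchy-Schwarz inequality gives (ii). Expressing the norms by the
   spectral measure and bounding the Dirichlet kernel off the ball B_r(om) gives a
   lower bound for the measure of that ball, hence (i). *)

Require Import Defs.
From HB Require Import structures.
From mathcomp Require Import all_boot all_order all_algebra.
From mathcomp Require Import all_classical all_reals all_analysis.
From mathcomp Require Import complex.
From mathcomp Require Import perm separable measurable_realfun.
From mathcomp Require Import ring lra zify.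

Set Implicit Arguments.
Unset Strict Implicit.
Unset Printing Implicit Defensive.

Import Order.TTheory GRing.Theory Num.Theory.
Import numFieldNormedType.Exports.

Local Open Scope classical_set_scope.
Local Open Scope ring_scope.
Local Open Scope complex_scope.

(** * The modulus and the unit circle *)

(** The conjugates of [alpha] on the unit circle shape the argument. Their powers do not decay, so
    the phases [om |zeta^n(a)|] are only made eventually closer to integers than a prescribed [eta];
    they are not shown to converge. The perturbation of the substitution matrix thus keeps a fixed
    small size and costs some growth: the rate is [rho = alpha^(1-u)] with [u > 0], and the
    frequency depends on [u]. The infimum in (i) and the arbitrary exponent in (ii) absorb this
    loss. The proof runs through a sequence of losses [u_k] tending to 0 and discards one hyperplane
    of coefficient vectors for each [k].

    The length at which a twisted sum is large depends on the point of the substitution space.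
    Summing over all lengths below [M] removes this dependence: the lower bound becomes the same at
    every point and can be integrated. In [rho^(3n)] two factors come from the square and one from
    the length of the stretch. *)

Local Notation nc := (@Normc.normc _).

Section ComplexModulus.
Variable R : realType.
Implicit Types (x y z : R[i]) (a b : R).

Lemma nc_ge0 z : 0 <= nc z.
Proof. by case: z => a b; exact: sqrtr_ge0. Qed.

Lemma nc0 : nc (0 : R[i]) = 0. Proof. exact: Normc.normc0. Qed.
Lemma nc1 : nc (1 : R[i]) = 1. Proof. exact: Normc.normc1. Qed.
Lemma ncM x y : nc (x * y) = nc x * nc y. Proof. exact: Normc.normcM. Qed.
Lemma ncN x : nc (- x) = nc x. Proof. exact: normcN. Qed.
Lemma ncD x y : nc (x + y) <= nc x + nc y. Proof. exact: le_normcD. Qed.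

Lemma nc_eq0 z : (nc z == 0) = (z == 0).
Proof.
by apply/eqP/eqP => [/Normc.eq0_normc//|->]; exact: nc0.
Qed.

Lemma nc_gt0 z : (0 < nc z) = (z != 0).
Proof. by rewrite lt0r nc_eq0 nc_ge0 andbT. Qed.

Lemma ncB x y : nc (x - y) <= nc x + nc y.
Proof. by rewrite -(ncN y) ncD. Qed.

Lemma ncBC x y : nc (x - y) = nc (y - x).
Proof. by rewrite -ncN opprB. Qed.

Lemma ler_ncB x y : nc x - nc y <= nc (x - y).
Proof. by rewrite lerBlDr (le_trans _ (ncD _ _)) // subrK. Qed.

Lemma ncX z n : nc (z ^+ n) = nc z ^+ n.
Proof. by elim: n => [|n IH]; rewrite ?expr0 ?nc1// !exprS ncM IH. Qed.

Lemma nc_sum I (r : seq I) (P : pred I) (F : I -> R[i]) :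
  nc (\sum_(i <- r | P i) F i) <= \sum_(i <- r | P i) nc (F i).
Proof.
elim/big_rec2 : _ => [|i a z _ H]; first by rewrite nc0.
by rewrite (le_trans (ncD _ _)) // lerD2l.
Qed.

Lemma nc_prod I (r : seq I) (P : pred I) (F : I -> R[i]) :
  nc (\prod_(i <- r | P i) F i) = \prod_(i <- r | P i) nc (F i).
Proof. by apply: (big_morph nc); [exact: ncM|exact: nc1]. Qed.

Lemma ncC a : nc (a%:C) = `|a|.
Proof. by rewrite /= expr0n /= addr0 sqrtr_sqr. Qed.

Lemma nc_nat n : nc (n%:R : R[i]) = n%:R.
Proof. by rewrite -(rmorph_nat (real_complex R)) ncC ger0_norm. Qed.

Lemma nc_int (k : int) : nc (k%:~R : R[i]) = `|k%:~R : R|.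
Proof. by rewrite -(rmorph_int (real_complex R)) ncC. Qed.

Lemma sqr_nc z : nc z ^+ 2 = complex.Re z ^+ 2 + complex.Im z ^+ 2.
Proof. by case: z => a b /=; rewrite sqr_sqrtr // addr_ge0 ?sqr_ge0. Qed.

Lemma ncJ z : nc (z^*) = nc z.
Proof. by case: z => a b /=; rewrite sqrrN. Qed.

Lemma nc_conj_mul z : (nc z ^+ 2)%:C = z * z^*.
Proof.
case: z => a b; rewrite sqr_nc /=; apply/eqP; rewrite eq_complex /=.
by apply/andP; split; apply/eqP; ring.
Qed.

Lemma nc_Re z : `|complex.Re z| <= nc z.
Proof.
by rewrite -(@ler_pXn2r _ 2%N) ?nnegrE ?nc_ge0// sqr_nc real_normK ?num_real// lerDl sqr_ge0.
Qed.

Lemma ReC a : complex.Re (a%:C) = a. Proof. by []. Qed.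
Lemma ReD x y : complex.Re (x + y) = complex.Re x + complex.Re y.
Proof. by case: x y => ? ? [? ?]. Qed.
Lemma ReM x y : complex.Re (x * y) =
  complex.Re x * complex.Re y - complex.Im x * complex.Im y.
Proof. by case: x y => ? ? [? ?]. Qed.
Lemma ImM x y : complex.Im (x * y) =
  complex.Re x * complex.Im y + complex.Im x * complex.Re y.
Proof. by case: x y => ? ? [? ?]. Qed.
Lemma ImD x y : complex.Im (x + y) = complex.Im x + complex.Im y.
Proof. by case: x y => ? ? [? ?]. Qed.

Lemma Re_sum I (r : seq I) (P : pred I) (F : I -> R[i]) :
  complex.Re (\sum_(i <- r | P i) F i) = \sum_(i <- r | P i) complex.Re (F i).
Proof. by apply: (big_morph _ ReD). Qed.
Lemma Im_sum I (r : seq I) (P : pred I) (F : I -> R[i]) :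
  complex.Im (\sum_(i <- r | P i) F i) = \sum_(i <- r | P i) complex.Im (F i).
Proof. by apply: (big_morph _ ImD). Qed.

End ComplexModulus.

Section UnitCircle.
Variable R : realType.
Implicit Types (x y : R).

Definition ecirc x : R[i] := cos (2 * pi * x) +i* sin (2 * pi * x).

Lemma ecircD x y : ecirc (x + y) = ecirc x * ecirc y.
Proof.
rewrite /ecirc mulrDr cosD sinD; apply/eqP; rewrite eq_complex /=.
by rewrite eqxx /= addrC eqxx.
Qed.

Lemma ecirc0 : ecirc 0 = 1.
Proof. by rewrite /ecirc mulr0 cos0 sin0. Qed.

Lemma ecircN x : ecirc (- x) = (ecirc x)^*.
Proof. by rewrite /ecirc mulrN cosN sinN. Qed.

Lemma nc_ecirc x : nc (ecirc x) = 1.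
Proof. by rewrite /= cos2Dsin2 sqrtr1. Qed.

Lemma ecirc_neq0 x : ecirc x != 0.
Proof. by rewrite -nc_eq0 nc_ecirc oner_eq0. Qed.

Lemma ecircMn x n : ecirc (x *+ n) = ecirc x ^+ n.
Proof.
by elim: n => [|n IH]; rewrite ?ecirc0// mulrS ecircD exprS IH.
Qed.

Lemma ecirc1 : ecirc 1 = 1.
Proof. by rewrite /ecirc mulr1 mulr_natl cos2pi sin2pi. Qed.

Lemma ecirc_int (k : int) : ecirc k%:~R = 1.
Proof.
have N n : ecirc n%:R = 1 by rewrite ecircMn ecirc1 expr1n.
case: k => n; first exact: N n.
have -> : (Negz n)%:~R = - (n.+1%:R) :> R by rewrite NegzE rmorphN.
by rewrite ecircN N; apply/eqP; rewrite eq_complex /= oppr0 !eqxx.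
Qed.

Lemma ecircN_mul x : ecirc (- x) * ecirc x = 1.
Proof. by rewrite -ecircD addNr ecirc0. Qed.

Lemma ecircV x : ecirc (- x) = (ecirc x)^-1.
Proof.
by apply: (mulIf (ecirc_neq0 x)); rewrite ecircN_mul mulVf ?ecirc_neq0.
Qed.

Lemma sin_le_norm x : `|sin x| <= `|x|.
Proof.
have P y : 0 <= y -> sin y <= y.
  move=> y0; have [c _] := @MVT_segment R sin cos 0 y y0
    (fun z _ => is_derive_sin z) (continuous_subspaceT (@continuous_sin R)).
  rewrite sin0 !subr0 => ->; rewrite -[leRHS]mul1r ler_wpM2r ?cos_le1//.
have Q y : 0 <= y -> - y <= sin y.
  move=> y0; have [c _] := @MVT_segment R sin cos 0 y y0
    (fun z _ => is_derive_sin z) (continuous_subspaceT (@continuous_sin R)).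
  rewrite sin0 !subr0 => ->; rewrite -mulN1r ler_wpM2r ?cos_geN1//.
wlog x0 : x / 0 <= x => [H|].
  have [/H//|/ltW x0] := leP 0 x.
  by rewrite -normrN -sinN -[leRHS]normrN; apply: H; rewrite oppr_ge0.
by rewrite (ger0_norm x0) ler_norml P // andbT Q.
Qed.

(** A weak Jordan inequality. With [x = 2y], [sin x = 2 sin y cos y], and the mean value theorem
    gives [sin y = y cos c]; both cosines are at least [cos (pi / 4)], whose square is 1/2. *)
Lemma sin_ge_half x : 0 <= x <= pi / 2 -> x / 2 <= sin x.
Proof.
move=> /andP[x0 xpi]; pose y := x / 2.
have xE : x = y *+ 2 by rewrite /y -mulr_natr -mulrA mulVf ?mulr1.
have y0 : 0 <= y by rewrite divr_ge0.
have y4 : y <= pi / 4 by rewrite /y; lra.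
have pi0 := @pi_gt0 R.
have cos4 : cos (pi / 4 : R) ^+ 2 = 2^-1.
  have := cos_mulr2n (pi / 4 : R).
  have -> : (pi / 4 *+ 2 : R) = pi / 2 by lra.
  rewrite cos_pihalf => H; lra.
have c40 : 0 <= cos (pi / 4 : R) by apply: cos_ge0_pihalf; lra.
have cle z : 0 <= z <= pi / 4 -> cos (pi / 4 : R) <= cos z.
  by move=> /andP[z0 z1]; rewrite leNgt ltr_cos ?in_itv/= -?leNgt; lra.
have [c] := @MVT_segment R sin cos 0 y y0
    (fun z _ => is_derive_sin z) (continuous_subspaceT (@continuous_sin R)).
rewrite sin0 !subr0 in_itv/= => /andP[c0 cy] sy.
rewrite xE sin_mulr2n sy -xE.
have H1 : cos (pi / 4 : R) <= cos c by apply: cle; rewrite c0 (le_trans cy).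
have H2 : cos (pi / 4 : R) <= cos y by apply: cle; rewrite y0 y4.
have H3 : 2^-1 <= cos y * cos c by rewrite -cos4 expr2 ler_pM.
have : y * 2^-1 <= y * (cos y * cos c) by rewrite ler_wpM2l.
rewrite /y; lra.
Qed.

Lemma sqr_nc_ecircB1 x : nc (ecirc x - 1) ^+ 2 = (2 * sin (pi * x)) ^+ 2.
Proof.
rewrite sqr_nc /=.
have -> : 2 * pi * x = (pi * x) *+ 2 by rewrite -[RHS]mulr_natl mulrA.
rewrite cos_mulr2n sin_mulr2n.
have := cos2Dsin2 (pi * x); set c := cos _; set s := sin _ => H.
have Hc : c ^+ 2 = 1 - s ^+ 2 by rewrite -H; ring.
have -> : (c * s *+ 2 - 0) ^+ 2 = 4 * c ^+ 2 * s ^+ 2 by ring.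
rewrite Hc; ring.
Qed.

Lemma nc_ecircB1 x : nc (ecirc x - 1) = 2 * `|sin (pi * x)|.
Proof.
apply/eqP; rewrite -(@eqrXn2 _ 2%N) ?nc_ge0 ?mulr_ge0//.
by rewrite sqr_nc_ecircB1 !exprMn real_normK ?num_real.
Qed.

Lemma nc_ecircB1_le x : nc (ecirc x - 1) <= 2 * pi * `|x|.
Proof.
rewrite nc_ecircB1 -mulrA ler_pM2l// (le_trans (sin_le_norm _))//.
by rewrite normrM ger0_norm ?pi_ge0.
Qed.

Lemma ecirc_subint x (m : int) : ecirc (x - m%:~R) = ecirc x.
Proof. by rewrite ecircD -rmorphN ecirc_int mulr1. Qed.

Lemma nc_ecircB1_near x (m : int) : nc (ecirc x - 1) <= 2 * pi * `|x - m%:~R|.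
Proof. by rewrite -(ecirc_subint x m) nc_ecircB1_le. Qed.

(** Subtracting the nearest integer leaves [y] with [|y| <= 1/2], where the modulus is
    [2 sin (pi |y|) >= pi |y| >= |y|]. *)
Lemma nc_ecircB1_ge x (r : R) : (forall m : int, r <= `|x - m%:~R|) ->
  r <= nc (ecirc x - 1).
Proof.
move=> H; pose m := Num.floor (x + 2^-1); rewrite -(ecirc_subint x m).
apply: le_trans (H m) _.
have /andP[m1 m2] : m%:~R <= x + 2^-1 < (m + 1)%:~R by rewrite floor_itv ?num_real.
rewrite intrD in m2; set y := x - _.
have [y1 y2] : - 2^-1 <= y /\ y <= 2^-1 by rewrite /y; split; lra.
rewrite nc_ecircB1.
have -> : `|sin (pi * y)| = `|sin (pi * `|y|)|.
  have [y0|y0] := leP 0 y; first by rewrite (ger0_norm y0).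
  by rewrite (ltr0_norm y0) mulrN sinN normrN.
have pi2 := @pi_ge2 R.
have y3 : `|y| <= 2^-1 by rewrite ler_norml y1 y2.
have := @sin_ge_half (pi * `|y|).
have P0 : 0 <= pi * `|y| by rewrite mulr_ge0// pi_ge0.
rewrite P0 /= ler_pM2l ?pi_gt0// => /(_ y3) H1.
rewrite (@ger0_norm _ (sin _)); last by rewrite (le_trans _ H1)// divr_ge0.
have : 1 * `|y| <= pi * `|y| by rewrite ler_wpM2r//; lra.
by lra.
Qed.

Lemma ecirc_inj x y : 0 < x < 1 -> 0 < y < 1 -> ecirc x = ecirc y -> x = y.
Proof.
move=> /andP[x0 x1] /andP[y0 y1] exy; apply/eqP; rewrite -subr_eq0.
apply: contraT => xy.
have E : nc (ecirc (x - y) - 1) = 0.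
  by rewrite ecircD exy -ecircD subrr ecirc0 subrr nc0.
(* [r] bounds the distance from [x - y] to the integers from below, and it is positive because
   [0 < |x - y| < 1]. *)
pose r := Num.min `|x - y| (1 - `|x - y|).
have xy1 : `|x - y| < 1 by rewrite ltr_norml; apply/andP; split; lra.
have : r <= nc (ecirc (x - y) - 1).
  apply: nc_ecircB1_ge => m; have [->|m0] := eqVneq m 0.
    by rewrite subr0 /r ge_min lexx.
  rewrite /r ge_min; apply/orP; right.
  have m1 : 1 <= `|m%:~R : R|.
    by rewrite -intr_norm -[1]/(1%:~R) ler_int -gtz0_ge1 normr_gt0.
  by rewrite [leRHS]distrC (le_trans _ (lerB_dist _ _)) // lerB.
by rewrite E leNgt /r lt_min normr_gt0 xy subr_gt0 xy1.
Qed.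

End UnitCircle.

Section EntrywiseNorm.
Variable R : realType.

Definition mxl1 m n (M : 'M[R[i]]_(m, n)) : R := \sum_i \sum_j nc (M i j).

Lemma mxl1_ge0 m n (M : 'M[R[i]]_(m, n)) : 0 <= mxl1 M.
Proof. by apply: sumr_ge0 => i _; apply: sumr_ge0 => j _; exact: nc_ge0. Qed.

Lemma mxl1_entry m n (M : 'M[R[i]]_(m, n)) i j : nc (M i j) <= mxl1 M.
Proof.
rewrite /mxl1 (bigD1 i)//= (bigD1 j)//= -addrA lerDl addr_ge0 //.
  by apply: sumr_ge0 => k _; exact: nc_ge0.
by apply: sumr_ge0 => k _; apply: sumr_ge0 => l _; exact: nc_ge0.
Qed.

Lemma mxl1D m n (M N : 'M[R[i]]_(m, n)) : mxl1 (M + N) <= mxl1 M + mxl1 N.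
Proof.
rewrite /mxl1 -big_split /= ler_sum // => i _; rewrite -big_split /= ler_sum //.
by move=> j _; rewrite mxE ncD.
Qed.

Lemma mxl1Z m n a (M : 'M[R[i]]_(m, n)) : mxl1 (a *: M) = nc a * mxl1 M.
Proof.
rewrite /mxl1 mulr_sumr; apply: eq_bigr => i _; rewrite mulr_sumr.
by apply: eq_bigr => j _; rewrite mxE ncM.
Qed.

Lemma mxl1M m n p (M : 'M[R[i]]_(m, n)) (N : 'M[R[i]]_(n, p)) :
  mxl1 (M *m N) <= mxl1 M * mxl1 N.
Proof.
rewrite /mxl1 mulr_suml ler_sum // => i _.
have -> : (\sum_j nc (M i j)) * mxl1 N =
    \sum_j nc (M i j) * mxl1 N by rewrite mulr_suml.
apply: (@le_trans _ _ (\sum_k \sum_j nc (M i j) * nc (N j k))).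
  apply: ler_sum => k _; rewrite mxE (le_trans (nc_sum _ _ _))//.
  by apply: ler_sum => j _; rewrite ncM.
rewrite exchange_big /= ler_sum // => j _; rewrite -mulr_sumr ler_wpM2l ?nc_ge0//.
rewrite /mxl1 [leRHS](bigD1 j)//= lerDl.
by apply: sumr_ge0 => k _; apply: sumr_ge0 => l _; exact: nc_ge0.
Qed.

Lemma mxl1_gt0 m n (M : 'M[R[i]]_(m, n)) : M != 0 -> 0 < mxl1 M.
Proof.
move=> M0; rewrite lt_neqAle mxl1_ge0 andbT eq_sym; apply: contra M0 => /eqP H.
apply/eqP/matrixP => i j; rewrite mxE; apply/eqP.
by rewrite -nc_eq0 eq_le nc_ge0 andbT -H mxl1_entry.
Qed.

End EntrywiseNorm.

(** * Substituted words and twisted sums *)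

Lemma mulrn_nat (x n : nat) : x *+ n = (x * n)%N.
Proof. by elim: n => [|n IH]; rewrite ?muln0// mulrS IH mulnS. Qed.

Section Words.
Variables (d : nat) (zeta : 'I_d -> seq 'I_d).
Implicit Types (w : seq 'I_d) (a b c : 'I_d).

Lemma iter_subst_word n w :
  iter n (subst_word zeta) w = flatten (map (subst_iter zeta n) w).
Proof.
elim: n w => [|n IH] w; first by elim: w => //= a w {1}->.
have H a : subst_iter zeta n.+1 a = flatten (map (subst_iter zeta n) (zeta a)).
  by rewrite /subst_iter iterSr IH /subst_word /= cats0.
rewrite iterSr IH; elim: w => [//|a w IHw].
transitivity (subst_iter zeta n.+1 a ++ flatten (map (subst_iter zeta n.+1) w)).
  by rewrite -IHw H /subst_word /= map_cat flatten_cat.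
by [].
Qed.

Lemma subst_iterD n m a :
  subst_iter zeta (n + m) a = flatten (map (subst_iter zeta n) (subst_iter zeta m a)).
Proof. by rewrite /subst_iter iterD iter_subst_word. Qed.

Lemma subst_iterS n a :
  subst_iter zeta n.+1 a = flatten (map (subst_iter zeta n) (zeta a)).
Proof. by rewrite -addn1 subst_iterD /subst_iter /= /subst_word /= cats0. Qed.

Lemma sum_count_mem (A : nmodType) (F : 'I_d -> A) w :
  \sum_(x <- w) F x = \sum_c F c *+ count_mem c w.
Proof.
elim: w => [|x w IH]; first by rewrite big_nil big1.
rewrite big_cons IH /= [RHS](eq_bigr (fun c => F c *+ (x == c) + F c *+ count_mem c w)).
  rewrite big_split /=; congr (_ + _).
  rewrite (bigD1 x)//= eqxx big1 ?addr0// => c; rewrite eq_sym => /negPf ->.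
  by rewrite mulr0n.
by move=> c _; rewrite mulrnDr.
Qed.

Lemma subst_mxX (K : pzRingType) n a b :
  (subst_mx K zeta ^+ n) b a = (count_mem b (subst_iter zeta n a))%:R.
Proof.
elim: n a => [|n IH] a; first by rewrite expr0 mxE /= addn0 eq_sym.
rewrite exprSr mxE subst_iterS count_flatten sumnE big_map big_map.
rewrite (@sum_count_mem nat) natr_sum; apply: eq_bigr => c _.
by rewrite IH mxE -natrM mulrn_nat.
Qed.

Hypothesis zeta_ne : nonerasing zeta.

Lemma size_subst_word w : (size w <= size (subst_word zeta w))%N.
Proof.
elim: w => //= a w IH; rewrite /subst_word /= size_cat -add1n leq_add //.
by rewrite lt0n size_eq0; exact: zeta_ne.
Qed.

Lemma size_subst_iter_mono a n m : (n <= m)%N ->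
  (size (subst_iter zeta n a) <= size (subst_iter zeta m a))%N.
Proof.
move=> /subnK <-; rewrite /subst_iter iterD.
elim: (m - n)%N => //= k IH; exact: (leq_trans IH (size_subst_word _)).
Qed.

End Words.

(** * Blocks inside long windows, and recurrence *)

Section Windows.
Variables (T S : eqType) (u : T -> seq S) (L : nat).
Hypothesis uL : forall c, (size (u c) <= L)%N.

Lemma prefix_flatten_block (s : seq T) (w w' : seq S) :
  flatten (map u s) = w ++ w' -> (L < size w)%N -> exists c, prefix (u c) w.
Proof.
case: s => [|c s] /= E lw; first by case: w E lw.
exists c; apply/prefixP.
exists (drop (size (u c)) w).
have sl : (size (u c) <= size w)%N by rewrite (leq_trans (uL c))// ltnW.
have := congr1 (take (size (u c))) E; rewrite take_size_cat// takel_cat// => {1}->.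
by rewrite cat_take_drop.
Qed.

(** The first block that [w] meets takes at most [L] of its letters. More than [L] letters remain,
    they start at a block boundary, and so they begin with a whole block. *)
Lemma infix_flatten_block (s : seq T) (w : seq S) :
  infix w (flatten (map u s)) -> (2 * L < size w)%N -> exists c, infix (u c) w.
Proof.
move=> /infixP[p [s' E]] lw; elim: s p E => [|c s IH] p /= E.
  by case: p w E lw => //= -[].
have [pc|pc] := leqP (size (u c)) (size p).
  apply: (IH (drop (size (u c)) p)).
  have := congr1 (drop (size (u c))) E; rewrite drop_size_cat// drop_cat.
  case: ltnP => // H ->.
  have e : size (u c) = size p by apply/eqP; rewrite eqn_leq pc H.
  by rewrite e subnn drop0 drop_size cat0s.
pose k := (size (u c) - size p)%N.
have kw : (k <= size w)%N by rewrite /k; have := uL c; lia.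
have [] := @prefix_flatten_block s (drop k w) s'.
- have := congr1 (drop (size (u c))) E; rewrite drop_size_cat// drop_cat.
  rewrite ltnNge (ltnW pc) /= -/k drop_cat.
  case: ltnP => // H ->.
  have -> : k = size w by apply/eqP; rewrite eqn_leq kw H.
  by rewrite subnn drop0 drop_size cat0s.
- by rewrite size_drop /k; have := uL c; lia.
move=> c' /prefixP[t Et]; exists c'; apply/infixP; exists (take k w), t.
by rewrite -Et cat_take_drop.
Qed.

End Windows.

Section Recurrence.
Variables (d : nat) (zeta : 'I_d -> seq 'I_d).
Hypothesis zeta_ne : nonerasing zeta.
Hypothesis zeta_prim : primitive_subst zeta.

Lemma size_factor (x : int -> 'I_d) i n : size (Defs.factor x i n) = n.
Proof. by rewrite size_mkseq. Qed.

Lemma primitive_occurs : exists p, forall a c, a \in subst_iter zeta p c.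
Proof.
have [p Hp] := zeta_prim; exists p => a c.
by have := Hp a c; rewrite subst_mxX ltr0n -has_count has_pred1.
Qed.

Lemma infix_flatten_mem (T : eqType) (S : eqType) (u : T -> seq S) s a :
  a \in s -> infix (u a) (flatten (map u s)).
Proof.
move=> /path.splitPr[s1 s2]; rewrite map_cat flatten_cat /=.
by apply/infixP; exists (flatten (map u s1)), (flatten (map u s2)).
Qed.

(** By primitivity [zeta^p(c)] contains every letter, hence [zeta^(n+p)(c)] contains every
    [zeta^n(a)]. The window lies in some [zeta^m(b)]; its length forces [m >= n + p], so this word
    splits into blocks of level [n + p], one of which fits into the window. *)
Lemma subst_space_window : exists p : nat, forall (n M L : nat),
  (forall c, (size (subst_iter zeta (n + p) c) <= L)%N) -> (2 * L < M)%N ->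
  forall x i a, subst_space zeta x -> infix (subst_iter zeta n a) (Defs.factor x i M).
Proof.
have [p Hp] := primitive_occurs; exists p => n M L HL LM x i a Xx.
have [b [m]] := Xx i M => Hm.
have nm : (n + p <= m)%N.
  rewrite leqNgt; apply/negP => /ltnW mn.
  have := size_infix Hm; rewrite size_factor leqNgt => /negP; apply.
  apply: leq_ltn_trans (size_subst_iter_mono zeta_ne b mn) _.
  apply: leq_ltn_trans (HL b) _; apply: leq_ltn_trans LM; lia.
have [c Hc] : exists c, infix (subst_iter zeta (n + p) c) (Defs.factor x i M).
  apply: (@infix_flatten_block _ _ (subst_iter zeta (n + p)) L HL
    (subst_iter zeta (m - (n + p)) b)); last by rewrite size_factor.
  by rewrite -subst_iterD subnKC.
apply: infix_trans Hc; rewrite subst_iterD; exact: infix_flatten_mem.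
Qed.

End Recurrence.

(** * Twisted sums and their matrix recursion *)

Section TwistedSums.
Variables (d : nat).
Implicit Types (w : seq 'I_d) (a c : 'I_d).

(* [q ^ i] weights position [i] in [twsum]; [twcoef q l c w] adds up the weights
   of the occurrences of [c] in [w] when each letter [x] has length [l x]. *)
Fixpoint twsum (K : pzRingType) (q : K) (b : 'I_d -> K) w : K :=
  if w is x :: w' then b x + q * twsum q b w' else 0.

Fixpoint twcoef (K : pzRingType) (q : K) (l : 'I_d -> nat) c w : K :=
  if w is x :: w' then (x == c)%:R + q ^+ l x * twcoef q l c w' else 0.

Lemma twsum_cat (K : pzRingType) (q : K) b w1 w2 :
  twsum q b (w1 ++ w2) = twsum q b w1 + q ^+ size w1 * twsum q b w2.
Proof.
elim: w1 => [|x w1 IH] /=; first by rewrite add0r mul1r.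
by rewrite IH mulrDr addrA mulrA -exprS.
Qed.

(** Each block starts at the total length of the preceding ones, so its sum is multiplied by that
    power of [q]; [twcoef] collects these powers letter by letter. *)
Lemma twsum_flatten (K : comPzRingType) (q : K) b (u : 'I_d -> seq 'I_d) w :
  twsum q b (flatten (map u w)) =
  \sum_c twcoef q (fun x => size (u x)) c w * twsum q b (u c).
Proof.
elim: w => [|x w IH] /=; first by rewrite big1 // => c _; rewrite mul0r.
rewrite twsum_cat IH mulr_sumr.
under [RHS]eq_bigr do rewrite mulrDl.
rewrite big_split /=; congr (_ + _); last by apply: eq_bigr => c _; rewrite mulrA.
rewrite (bigD1 x)//= eqxx mul1r big1 ?addr0// => c.
by rewrite eq_sym => /negPf ->; rewrite mul0r.
Qed.

Lemma twsumD (K : pzRingType) (q : K) b1 b2 w :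
  twsum q (fun j => b1 j + b2 j) w = twsum q b1 w + twsum q b2 w.
Proof. by elim: w => /= [|x w ->]; rewrite ?addr0// mulrDr addrACA. Qed.

Lemma twsumZ (K : comPzRingType) (q : K) (k : K) b w :
  twsum q (fun j => k * b j) w = k * twsum q b w.
Proof. by elim: w => /= [|x w ->]; rewrite ?mulr0// mulrDr mulrCA. Qed.

Lemma twsum_const (K : pzRingType) (q : K) w :
  (q - 1) * twsum q (fun=> 1) w = q ^+ size w - 1.
Proof.
elim: w => [|x w IH] /=; first by rewrite mulr0 subrr.
rewrite mulrDr mulr1 mulrA (_ : (q - 1) * q = q * (q - 1)); last first.
  by rewrite mulrBl mulrBr mul1r mulr1.
by rewrite -mulrA IH mulrBr -exprS mulr1 addrC addrA subrK.
Qed.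

Lemma twcoef_morph (K L : pzRingType) (f : {rmorphism K -> L}) q l c w :
  f (twcoef q l c w) = twcoef (f q) l c w.
Proof.
elim: w => [|x w IH] /=; first by rewrite rmorph0.
by rewrite rmorphD rmorphM rmorphXn rmorph_nat IH.
Qed.

Lemma twcoef1 (K : pzRingType) l c w :
  twcoef (1 : K) l c w = (count_mem c w)%:R.
Proof. by elim: w => //= x w ->; rewrite expr1n mul1r natrD. Qed.

Definition twmx (K : pzRingType) (zeta : 'I_d -> seq 'I_d) (q : K) (n : nat) : 'M[K]_d :=
  \matrix_(a, c) twcoef q (fun x => size (subst_iter zeta n x)) c (zeta a).

Definition twvec (K : pzRingType) (zeta : 'I_d -> seq 'I_d) (q : K)
    (b : 'I_d -> K) (n : nat) : 'cV[K]_d :=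
  \col_a twsum q b (subst_iter zeta n a).

Lemma twvecS (K : comPzRingType) zeta (q : K) b n :
  twvec zeta q b n.+1 = twmx zeta q n *m twvec zeta q b n.
Proof.
apply/colP => a; rewrite !mxE subst_iterS twsum_flatten.
by apply: eq_bigr => c _; rewrite !mxE.
Qed.

Lemma twvec0 (K : pzRingType) zeta (q : K) b : twvec zeta q b 0 = \col_a b a.
Proof. by apply/colP => a; rewrite !mxE /= mulr0 addr0. Qed.

Lemma twmx_morph (K L : pzRingType) (f : {rmorphism K -> L}) zeta q n :
  map_mx f (twmx zeta q n) = twmx zeta (f q) n.
Proof. by apply/matrixP => a c; rewrite !mxE twcoef_morph. Qed.

Lemma twmx1 (K : pzRingType) zeta n : twmx zeta (1 : K) n = (subst_mx K zeta)^T.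
Proof. by apply/matrixP => a c; rewrite !mxE twcoef1. Qed.

End TwistedSums.

Section TwistedSumBounds.
Variables (R : realType) (d : nat).
Implicit Types (w : seq 'I_d).

Lemma twsum_le (q : R[i]) b (B : R) w : nc q = 1 -> (forall j, nc (b j) <= B) ->
  nc (twsum q b w) <= B *+ size w.
Proof.
move=> q1 bB; elim: w => [|x w IH]; first by rewrite [twsum _ _ _]/= nc0 mulr0n.
rewrite [twsum _ _ _]/= [size _]/=.
by rewrite (le_trans (ncD _ _))// mulrS lerD// ncM q1 mul1r.
Qed.

(** The weight of a letter is a product of fewer than [size w] unimodular factors within [eta] of 1,
    hence within [eta * size w] of 1, and there are at most [size w] letters. *)
Lemma twcoef_near1 (q : R[i]) l c w (eta : R) : nc q = 1 ->
  (forall x, nc (q ^+ l x - 1) <= eta) ->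
  nc (twcoef q l c w - (count_mem c w)%:R) <= eta *+ (size w * size w).
Proof.
move=> q1 Hl; elim: w => [|x w IH].
  by rewrite [twcoef _ _ _ _]/= [count_mem _ _]/= subrr nc0 mulr0n.
rewrite [twcoef _ _ _ _]/= [count_mem _ _]/= [size _]/=.
have eta0 : 0 <= eta by apply: le_trans (nc_ge0 _) (Hl x).
set t := twcoef q l c w; set m := count_mem c w.
have -> : (x == c)%:R + q ^+ l x * t - ((x == c) + m)%:R =
    q ^+ l x * (t - m%:R) + (q ^+ l x - 1) * m%:R by rewrite natrD; ring.
rewrite (le_trans (ncD _ _))// !ncM ncX q1 expr1n mul1r nc_nat.
have H : nc (q ^+ l x - 1) * m%:R <= eta *+ size w.
  rewrite -[leRHS]mulr_natr ler_pM ?nc_ge0 ?ler_nat ?count_size//; exact: Hl.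
apply: le_trans (lerD IH H) _; rewrite -mulrnDr; apply: (ler_wpMn2l eta0).
by nia.
Qed.

End TwistedSumBounds.

(** * Algebraic numbers of bounded degree and height *)

Section Northcott.
Variable R : realType.
Local Notation C := R[i].
Local Notation QtoC := (ratr : rat -> C).
Local Notation ZtoC := (intr : int -> C).
Implicit Types (x y z theta : C).

(** This is the ring [Q[theta]], which is the field [Q(theta)] as soon as [theta] is algebraic. *)
Definition in_Qfield theta y := exists p : {poly rat}, (map_poly QtoC p).[theta] = y.

Lemma in_Qfield1 theta : in_Qfield theta 1.
Proof. by exists 1; rewrite rmorph1 hornerC. Qed.

Lemma in_QfieldM theta x y :
  in_Qfield theta x -> in_Qfield theta y -> in_Qfield theta (x * y).
Proof.
by move=> [p <-] [q <-]; exists (p * q); rewrite rmorphM hornerM.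
Qed.

Lemma in_QfieldX theta x n : in_Qfield theta x -> in_Qfield theta (x ^+ n).
Proof.
by move=> H; elim: n => [|n IH]; [exact: in_Qfield1|rewrite exprS; exact: in_QfieldM].
Qed.

Lemma in_Qfield_trans theta x y :
  in_Qfield theta x -> in_Qfield x y -> in_Qfield theta y.
Proof.
move=> [p <-] [q <-]; exists (q \Po p).
by rewrite map_comp_poly horner_comp.
Qed.

Lemma primitive_element (s : seq C) : (forall x, x \in s -> algebraicOver QtoC x) ->
  exists theta, algebraicOver QtoC theta /\ forall x, x \in s -> in_Qfield theta x.
Proof.
elim: s => [|x s IH] Hs.
  by exists 0; split=> //; exists 'X; rewrite ?polyX_eq0// map_polyX rootX.
have [y [ay Hy]] := IH (fun z zs => Hs z (@mem_behead _ (x :: s) z zs)).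
have [p p0 px] : algebraicOver QtoC x by apply: Hs; rewrite mem_head.
have [q q0 qy] := ay.
have [n [zx zy]] := pchar0_PET p0 px q0 qy (@pchar_num rat).
exists (y *+ n - x); split.
  apply: algebraic_sub; last by exists p.
  by rewrite -mulr_natr; apply: algebraic_mul => //; rewrite -(rmorph_nat QtoC); exact: algebraic_id.
move=> z; rewrite inE => /predU1P[->//|/Hy]; exact: in_Qfield_trans.
Qed.

(* [theta] generates a space of dimension less than [size f] over the rationals, so
   that many powers of [y] are linearly dependent. *)
Lemma in_Qfield_degree theta (f : {poly rat}) : f != 0 -> root (map_poly QtoC f) theta ->
  forall y, in_Qfield theta y ->
  exists r : {poly rat}, [/\ r != 0, (size r <= size f)%N & root (map_poly QtoC r) y].
Proof.
move=> f0 f_th y [P <-].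
have sf : (0 < size f)%N by rewrite size_poly_gt0.
pose s := (size f).-1.
pose M : 'M[rat]_(s.+1, s) := \matrix_(i < s.+1) poly_rV (P ^+ i %% f).
have /rowV0Pn[v /sub_kermxP vM v0] : kermx M != 0.
  by rewrite -mxrank_eq0 mxrank_ker -lt0n subn_gt0 ltnS rank_leq_col.
exists (rVpoly v); split.
- apply: contra v0 => /eqP H; rewrite -[v]rVpolyK H; apply/eqP/rowP => i.
  by rewrite !mxE coef0.
- by rewrite (leq_trans (size_poly _ _))// /s prednK.
have H : \sum_(i < s.+1) v 0 i *: (P ^+ i %% f) = 0.
  have := congr1 rVpoly vM; rewrite mulmx_sum_row linear_sum /= linear0.
  move=> E; rewrite -[RHS]E; apply: eq_bigr => i _; rewrite linearZ /= rowK.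
  rewrite poly_rV_K //; move: (nat_of_ord i) => k.
  by rewrite -ltnS prednK// ltn_modp.
have modE (q : {poly rat}) : (map_poly QtoC (q %% f)).[theta] = (map_poly QtoC q).[theta].
  rewrite {2}(divp_eq q f) rmorphD rmorphM /= hornerD hornerM.
  by rewrite (rootP f_th) mulr0 add0r.
apply/rootP.
have -> : rVpoly v = \sum_(i < s.+1) v 0 i *: 'X^i.
  rewrite /rVpoly poly_def; apply: eq_bigr => i _.
  by rewrite (valK i).
rewrite rmorph_sum horner_sum.
have := congr1 (fun q => (map_poly QtoC q).[theta]) H.
rewrite rmorph_sum horner_sum rmorph0 horner0 => E; rewrite -[RHS]E.
apply: eq_bigr => i _ /=; rewrite !map_polyZ !hornerZ modE.
by rewrite map_polyXn hornerXn rmorphXn /= horner_exp.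
Qed.
End Northcott.

(** * Heights of integer polynomials and bounds for their roots *)

Section Majorant.
Implicit Types p q P Q : {poly int}.

(* Coefficientwise domination is compatible with sums and products, so the [l^1]
   norm of a determinant is controlled by the value at 1 of a majorant. *)
Definition majorant p P := forall i, `|p`_i| <= P`_i.

Lemma majorant_ge0 p P i : majorant p P -> 0 <= P`_i.
Proof. by move=> H; apply: le_trans (H i). Qed.

Lemma majorant0 : majorant 0 0.
Proof. by move=> i; rewrite coef0 normr0. Qed.

Lemma majorant1 : majorant 1 1.
Proof. by move=> i; rewrite coef1; case: eqP. Qed.

Lemma majorantX n : majorant 'X^n 'X^n.
Proof. by move=> i; rewrite coefXn; case: eqP. Qed.

Lemma majorantD p P q Q : majorant p P -> majorant q Q -> majorant (p + q) (P + Q).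
Proof. by move=> H K i; rewrite !coefD (le_trans (ler_normD _ _))// lerD. Qed.

Lemma majorantM p P q Q : majorant p P -> majorant q Q -> majorant (p * q) (P * Q).
Proof.
move=> H K i; rewrite !coefM (le_trans (ler_norm_sum _ _ _))// ler_sum// => j _.
by rewrite normrM ler_pM.
Qed.

Lemma majorant_sum I (r : seq I) (A : pred I) (F G : I -> {poly int}) :
  (forall i, majorant (F i) (G i)) ->
  majorant (\sum_(i <- r | A i) F i) (\sum_(i <- r | A i) G i).
Proof.
move=> H; elim/big_ind2 : _ => //; [exact: majorant0|by move=> *; apply: majorantD].
Qed.

Lemma majorant_prod I (r : seq I) (A : pred I) (F G : I -> {poly int}) :
  (forall i, majorant (F i) (G i)) ->
  majorant (\prod_(i <- r | A i) F i) (\prod_(i <- r | A i) G i).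
Proof.
move=> H; elim/big_ind2 : _ => //; [exact: majorant1|by move=> *; apply: majorantM].
Qed.

Lemma majorant_sign n p P : majorant p P -> majorant ((-1) ^+ n * p) P.
Proof.
move=> H i; rewrite -[(-1) ^+ n]signr_odd; case: (odd n).
  by rewrite expr1 mulN1r coefN normrN.
by rewrite expr0 mul1r.
Qed.

Lemma majorant_sum_coef p P n : majorant p P ->
  \sum_(i < n) `|p`_i| <= P.[1].
Proof.
move=> H; rewrite (horner_coef_wide 1 (leq_maxr n (size P))).
rewrite -(big_mkord xpredT (fun i => `|p`_i|)).
rewrite -(big_mkord xpredT (fun i => P`_i * 1 ^+ i)).
rewrite [leRHS](big_cat_nat (n := n)) ?leq_maxl//= -[leLHS]addr0 lerD//.
  by apply: ler_sum => i _; rewrite expr1n mulr1.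
by apply: sumr_ge0 => i _; rewrite expr1n mulr1; exact: majorant_ge0 H.
Qed.

Lemma majorant_coef_le p P i : majorant p P -> `|p`_i| <= P.[1].
Proof.
move=> H; apply: le_trans (majorant_sum_coef i.+1 H).
by rewrite big_ord_recr /= lerDr sumr_ge0.
Qed.

End Majorant.

Section RootBounds.
Variable R : realType.
Local Notation C := R[i].
Local Notation QtoC := (ratr : rat -> C).
Local Notation ZtoC := (intr : int -> C).

Lemma int_norm_ge1 (k : int) : k != 0 -> 1 <= `|k|.
Proof. by move=> k0; rewrite -gtz0_ge1 normr_gt0. Qed.

Lemma absz_shift_lt (x : int) (b : nat) :
  - b%:Z <= x <= b%:Z -> (`|(x + b%:Z)%R| < b.*2.+1)%N.
Proof. rewrite -addnn; lia. Qed.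

Lemma absz_shiftK (x : int) (b : nat) :
  - b%:Z <= x <= b%:Z -> `|(x + b%:Z)%R|%N%:Z - b%:Z = x.
Proof. lia. Qed.

(** Cauchy's bound: the leading coefficient is a nonzero integer, so for [|z| > 1] the leading term
    is at least [|z|^(n+1)], while the others add up to at most [P(1) |z|^n]. *)
Lemma root_le_majorant (D P : {poly int}) (z : C) : majorant D P -> D != 0 ->
  root (map_poly ZtoC D) z -> nc z <= (P.[1])%:~R.
Proof.
move=> H D0 Dz; have l1 := int_norm_ge1 (_ : lead_coef D != 0).
have h1 : 1 <= (P.[1])%:~R :> R.
  rewrite -[1]/(1%:~R) ler_int; apply: le_trans (majorant_coef_le (size D).-1 H).
  by apply: l1; rewrite lead_coef_eq0.
have [z1|z1] := leP (nc z) 1; first exact: le_trans z1 h1.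
have z0 : 0 < nc z by apply: lt_trans z1.
have inj : injective ZtoC by exact: intr_inj.
have sD : size (map_poly ZtoC D) = size D by rewrite size_map_inj_poly.
have sD1 : (1 < size D)%N.
  rewrite -sD; apply: root_size_gt1 Dz.
  by rewrite -size_poly_gt0 sD size_poly_gt0.
move: Dz => /rootP; rewrite horner_coef sD.
case sizeD: (size D) sD1 => [//|[//|n]] _.
rewrite big_ord_recr /= coef_map /= => E.
have {E}E : (D`_n.+1)%:~R * z ^+ n.+1 = - \sum_(i < n.+1) (map_poly ZtoC D)`_i * z ^+ i.
  by apply/eqP; rewrite -addr_eq0 addrC E.
have ln : lead_coef D = D`_n.+1 by rewrite /lead_coef sizeD.
have E1 : nc z ^+ n.+1 <= nc ((D`_n.+1)%:~R * z ^+ n.+1 : C).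
  rewrite ncM ncX nc_int -[leLHS]mul1r ler_wpM2r ?exprn_ge0 ?nc_ge0//.
  by rewrite -intr_norm -[1]/(1%:~R) ler_int -ln l1// lead_coef_eq0.
have E2 : nc ((D`_n.+1)%:~R * z ^+ n.+1 : C) <= (P.[1])%:~R * nc z ^+ n.
  rewrite E ncN (le_trans (nc_sum _ _ _))//.
  apply: (@le_trans _ _ (\sum_(i < n.+1) (`|D`_i|)%:~R * nc z ^+ n)).
    apply: ler_sum => i _; rewrite ncM coef_map /= nc_int ncX intr_norm.
    by rewrite ler_wpM2l// ler_weXn2l ?ltW// -ltnS ltn_ord.
  rewrite -mulr_suml ler_wpM2r ?exprn_ge0 ?nc_ge0//.
  by rewrite -rmorph_sum ler_int majorant_sum_coef.
have := le_trans E1 E2; rewrite exprS ler_pM2r // exprn_gt0//.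
Qed.

Lemma coef_prod_XsubC_le (h : R) (zs : seq C) i : (forall z, z \in zs -> nc z <= h) ->
  nc ((\prod_(z <- zs) ('X - z%:P))`_i) <= (1 + h) ^+ size zs.
Proof.
elim: zs i => [|z zs IH] i Hz.
  rewrite big_nil coef1 expr0; case: eqP => _; rewrite ?nc1 ?nc0//.
have h0 : 0 <= h by apply: le_trans (nc_ge0 z) (Hz z (mem_head _ _)).
have Hzs w : w \in zs -> nc w <= h by move=> ws; apply: Hz; rewrite inE ws orbT.
rewrite big_cons mulrBl coefB coefXM coefCM.
rewrite (le_trans (ncB _ _))// [size _]/= exprS mulrDl mul1r lerD//.
  by case: eqP => _; [rewrite nc0 exprn_ge0// addr_ge0|exact: IH].
by rewrite ncM ler_pM ?nc_ge0// ?Hz ?mem_head// IH.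
Qed.

Lemma finite_bounded_int_roots (s : nat) (B : int) : finite_set
  [set y : C | exists p : {poly int}, [/\ p != 0, (size p <= s)%N,
    forall i, `|p`_i| <= B & root (map_poly ZtoC p) y]].
Proof.
have inj : injective ZtoC by exact: intr_inj.
pose b := `|B|%N.
pose P (c : {ffun 'I_s -> 'I_(b.*2.+1)}) : {poly int} :=
  \poly_(i < s) (if insub i is Some j then (c j : nat)%:Z - b%:Z else 0).
(* The enumeration also produces the zero polynomial, whose root set is infinite; it is assigned no
   roots. *)
pose rts (p : {poly int}) : set C :=
  if p == 0 then set0 else [set y | root (map_poly ZtoC p) y].
apply: (@sub_finite_set _ _ (\bigcup_(c in setT) rts (P c))).
  move=> y [p [p0 sp pB py]].
  have pb i : - b%:Z <= p`_i <= b%:Z.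
    rewrite -ler_norml; apply: le_trans (pB i) _; rewrite /b abszE; exact: ler_norm.
  have lt_c i : (`|(p`_i + b%:Z)%R| < b.*2.+1)%N.
    exact: absz_shift_lt.
  pose c : {ffun 'I_s -> 'I_(b.*2.+1)} := [ffun i : 'I_s => Ordinal (lt_c i)].
  have Ep : P c = p.
    apply/polyP => i; rewrite coef_poly; case: ltnP => si.
      by rewrite insubT /= ffunE /= absz_shiftK.
    by rewrite nth_default// (leq_trans sp).
  by exists c => //; rewrite /rts Ep (negPf p0).
apply: bigcup_finite => [|c _]; first exact: finite_finset.
rewrite /rts; case: eqP => [_|/eqP p0]; first exact: finite_set0.
have [rs Ers] := closed_field_poly_normal (map_poly ZtoC (P c)).
apply: (@sub_finite_set _ _ [set` rs]); last exact: finite_seq.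
move=> y /=; rewrite Ers rootZ ?root_prod_XsubC//.
by rewrite lead_coef_map_inj// intr_eq0 lead_coef_eq0.
Qed.

(* The integral minimal polynomial of [y] divides [D], so its roots and its leading
   coefficient are bounded by [h]; its degree is bounded by that of [theta]. *)
Lemma northcott (theta : C) (h : int) : algebraicOver QtoC theta ->
  finite_set [set y : C | in_Qfield theta y /\
    exists D P : {poly int}, [/\ D != 0, majorant D P, P.[1] <= h &
      root (map_poly ZtoC D) y]].
Proof.
move=> [f f0 fth]; have inj : injective ZtoC by exact: intr_inj.
(* [B] bounds a leading coefficient at most [h] times a coefficient of a product of at most [s]
   factors [X - z] with [|z| <= h]. The case [h < 0] is excluded below, since a nonzero [D] forces
   [1 <= h]. *)
pose s := size f; have [B HB] : exists B : int, forall n : nat, (n <= s)%N ->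
    (h%:~R : R) * (1 + h%:~R) ^+ n <= B%:~R \/ h < 0.
  exists (h * (1 + h) ^+ s) => n ns; have [h0|] := leP 0 h; last by right.
  left; rewrite rmorphM rmorphXn rmorphD /= ler_wpM2l ?ler0z//.
  by rewrite ler_weXn2l// lerDl ler0z.
apply: sub_finite_set (finite_bounded_int_roots s B).
move=> y [yth [D [P [D0 DP Ph Dy]]]].
have [r [r0 sr ry]] := in_Qfield_degree f0 fth yth.
pose DQ := map_poly (intr : int -> rat) D.
have DQC : map_poly QtoC DQ = map_poly ZtoC D.
  by rewrite -map_poly_comp; apply: eq_map_poly => k /=; rewrite ratr_int.
(* This gcd stands in for the minimal polynomial: its degree is bounded by that of [r], and by
   Gauss's lemma a rational multiple [p] of it has integer coefficients and divides [D] over the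
   integers. *)
pose g := gcdp r DQ.
have gy : root (map_poly QtoC g) y by rewrite gcdp_map root_gcd ry DQC Dy.
have [p [a a0 Eg] [q Dpq]] := dvdpP_rat_int (dvdp_gcdr r DQ).
have g0 : g != 0 by rewrite gcdp_eq0 negb_and r0.
have p0 : p != 0 by apply: contraNneq D0 => p0; rewrite Dpq p0 mul0r.
have q0 : q != 0 by apply: contraNneq D0 => q0; rewrite Dpq q0 mulr0.
have py : root (map_poly ZtoC p) y.
  move: gy; rewrite /g Eg map_polyZ rootZ ?fmorph_eq0//.
  rewrite -map_poly_comp (eq_map_poly (g := ZtoC))// => k /=; exact: ratr_int.
have sp : (size p <= s)%N.
  apply: leq_trans sr; rewrite -(size_map_inj_poly (@intr_inj rat))//.
  rewrite -(size_scale _ a0) -Eg; exact: dvdp_leq r0 (dvdp_gcdl _ _).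
exists p; split=> // i.
have h0 : 1 <= h.
  apply: le_trans Ph; apply: le_trans (majorant_coef_le (size D).-1 DP).
  by apply: int_norm_ge1; rewrite lead_coef_eq0.
have lead_le : `|lead_coef p| <= h.
  apply: le_trans (_ : `|lead_coef D| <= _).
    rewrite Dpq lead_coefM normrM ler_peMr// int_norm_ge1// lead_coef_eq0//.
  exact: le_trans (majorant_coef_le _ DP) Ph.
have [zs Ezs] := closed_field_poly_normal (map_poly ZtoC p).
have lead_pC : lead_coef (map_poly ZtoC p) = (lead_coef p)%:~R.
  by rewrite lead_coef_map_inj.
have lp0 : (lead_coef p)%:~R != 0 :> C by rewrite intr_eq0 lead_coef_eq0.
have zsh z : z \in zs -> nc z <= h%:~R.
  move=> zz; apply: (@le_trans _ _ (P.[1])%:~R); last by rewrite ler_int.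
  apply: root_le_majorant DP D0 _; rewrite Dpq rmorphM /= rootM.
  by rewrite Ezs lead_pC rootZ// root_prod_XsubC zz.
have szs : (size zs <= s)%N.
  have := congr1 (fun p : {poly C} => size p) Ezs.
  rewrite size_map_inj_poly// size_scale ?lead_pC// size_prod_XsubC => E.
  by apply: leq_trans sp; rewrite E.
have [H|] := HB _ szs; last by rewrite ltNge (le_trans _ h0).
rewrite -(ler_int R) (le_trans _ H)// intr_norm -nc_int.
have -> : (p`_i)%:~R = (map_poly ZtoC p)`_i :> C by rewrite coef_map.
rewrite Ezs coefZ ncM lead_pC nc_int -intr_norm ler_pM ?nc_ge0 ?ler0z//.
  by rewrite ler_int.
exact: coef_prod_XsubC_le.
Qed.

End RootBounds.

(** * The spectrum of the substitution matrix *)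

Section EigenvectorMatrix.
Variables (F : fieldType) (n : nat).

Lemma char_poly_tr (A : 'M[F]_n) : char_poly A^T = char_poly A.
Proof.
rewrite /char_poly -[RHS]det_tr; congr (\det _); apply/matrixP => i j.
by rewrite !mxE eq_sym.
Qed.

(** The rows of [P] are left eigenvectors. A relation [u *m P = 0] survives multiplying each
    coordinate [u_j] by [q(z_j)], for any polynomial [q]; the product of the [X - z_j] over [j != i]
    isolates the [i]-th term. *)
Lemma eigenvector_matrix (A : 'M[F]_n) (z : 'I_n -> F) : injective z ->
  (forall i, eigenvalue A (z i)) ->
  exists2 P : 'M[F]_n, P \in unitmx & P *m A = diag_mx (\row_j z j) *m P.
Proof.
move=> zI ev.
have /choice[v Hv] : forall i, exists v : 'rV[F]_n, v *m A = z i *: v /\ v != 0.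
  by move=> i; have /eigenvalueP[v ? ?] := ev i; exists v.
pose P := \matrix_i v i.
have PA : P *m A = diag_mx (\row_j z j) *m P.
  apply/row_matrixP => i; rewrite !row_mul rowK (Hv i).1 row_diag_mx mxE.
  by rewrite -scalemxAl -rowE rowK.
exists P => //; rewrite -row_free_unit -kermx_eq0; apply/negPn/negP => /rowV0Pn[u].
move=> /sub_kermxP uP u0.
have H (q : {poly F}) : (\row_j (u 0 j * q.[z j])) *m P = 0.
  elim/poly_ind: q => [|q c IH].
    rewrite (_ : \row_j _ = 0) ?mul0mx//.
    by apply/rowP => j; rewrite !mxE horner0 mulr0.
  rewrite (_ : \row_j _ = (\row_j (u 0 j * q.[z j])) *m diag_mx (\row_j z j) + c *: u).
    by rewrite mulmxDl -mulmxA -PA mulmxA IH mul0mx -scalemxAl uP scaler0 addr0.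
  apply/rowP => j; rewrite mul_mx_diag !mxE hornerMXaddC.
  by rewrite mulrDr mulrA [c * _]mulrC.
have /rV0Pn[i ui] := u0.
pose q := \prod_(j | j != i) ('X - (z j)%:P).
have := H q; rewrite (_ : \row_j _ = (u 0 i * q.[z i]) *: delta_mx 0 i).
  rewrite -scalemxAl -rowE rowK => /eqP; rewrite scaler_eq0 (negPf (Hv i).2) orbF.
  rewrite mulf_eq0 (negPf ui) /= horner_prod => /prodf_eq0[j ji].
  by rewrite hornerXsubC subr_eq0 => /eqP/zI E; rewrite E eqxx in ji.
apply/rowP => j; rewrite !mxE eqxx /=; have [->|ji] := eqVneq j i; first by rewrite mulr1.
rewrite mulr0 /q horner_prod; apply/eqP; rewrite mulf_eq0; apply/orP; right.
by apply/prodf_eq0; exists j => //; rewrite hornerXsubC subrr.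
Qed.

End EigenvectorMatrix.

Section SalemSpectrum.
Variables (R : realType) (d : nat) (zeta : 'I_d -> seq 'I_d) (alpha : R).
Hypothesis d1 : (1 < d)%N.
Hypothesis salem : Salem_type zeta alpha.
Local Notation C := R[i].
Local Notation QtoC := (ratr : rat -> C).
Local Notation ZtoC := (intr : int -> C).
Local Notation chi := (char_poly (subst_mx rat zeta)).

Lemma map_subst_mx (K L : pzRingType) (f : {rmorphism K -> L}) :
  map_mx f (subst_mx K zeta) = subst_mx L zeta.
Proof. by apply/matrixP => i j; rewrite !mxE rmorph_nat. Qed.

Lemma chi_irr : irreducible_poly chi.
Proof. by case: salem. Qed.

Lemma chi_monic : chi \is monic. Proof. exact: char_poly_monic. Qed.

Lemma size_chi : size chi = d.+1. Proof. exact: size_char_poly. Qed.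

Lemma alpha_gt1 : 1 < alpha. Proof. by case: salem => _ _ []. Qed.

Lemma chi_alpha : root (map_poly ratr chi) alpha.
Proof.
case: salem => _ [+ _] _.
by rewrite eigenvalue_root_char map_char_poly map_subst_mx.
Qed.

Lemma chiC_alpha : root (map_poly QtoC chi) (alpha%:C).
Proof.
have := chi_alpha; rewrite -(fmorph_root (real_complex R)) -map_poly_comp.
by rewrite (eq_map_poly (g := QtoC))// => q /=; rewrite fmorph_rat.
Qed.

Lemma chiC_root_le1 (z : C) : root (map_poly QtoC chi) z -> z != alpha%:C -> nc z <= 1.
Proof.
case: salem => _ _ [_ _ H _] zr za; apply: H => //; exists chi; split => //.
- exact: chi_monic.
- exact: chi_irr.
- exact: chi_alpha.
Qed.

(** The gcd of [p] and [chi] vanishes at [a], so it is not constant, and irreducibility makes it a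
    multiple of [chi]. *)
Lemma chi_root_minimal (K : numFieldType) (a : K) (p : {poly rat}) : p != 0 ->
  root (map_poly ratr chi) a -> root (map_poly ratr p) a -> (d < size p)%N.
Proof.
move=> p0 ca pa; rewrite -ltnS -size_chi ltnS; apply: dvdp_leq => //.
have [_ /(_ (gcdp p chi))] := chi_irr.
have ga : root (map_poly ratr (gcdp p chi)) a by rewrite gcdp_map root_gcd pa ca.
have g0 : gcdp p chi != 0 by rewrite gcdp_eq0 negb_and p0.
have sg : size (gcdp p chi) != 1.
  have := root_size_gt1 (_ : map_poly (ratr : rat -> K) (gcdp p chi) != 0) ga.
  rewrite size_map_poly map_poly_eq0 => /(_ g0).
  by case: (size _) => [|[|]].
move=> /(_ sg (dvdp_gcdr _ _)) /eqp_dvdl <-; exact: dvdp_gcdl.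
Qed.

Lemma chi_root_minimal_int (K : numFieldType) (a : K) (p : {poly int}) : p != 0 ->
  (size p <= d)%N -> root (map_poly ratr chi) a -> (map_poly intr p).[a] != 0.
Proof.
move=> p0 sp ca; apply/negP => pa.
have := @chi_root_minimal K a (map_poly intr p) _ ca.
rewrite size_rat_int_poly ltnNge sp.
have inj : injective (intr : int -> rat) by exact: intr_inj.
rewrite -size_poly_gt0 size_rat_int_poly size_poly_gt0 p0 => /(_ isT).
rewrite -map_poly_comp (eq_map_poly (g := intr)).
  by move=> /(_ pa).
by move=> k /=; rewrite ratr_int.
Qed.

Lemma chi_coef0_neq0 : chi`_0 != 0.
Proof.
apply/negP => /eqP c0.
have r0 : root (map_poly (ratr : rat -> rat) chi) 0.
  by apply/rootP; rewrite horner_coef0 coef_map /= c0 rmorph0.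
have := chi_root_minimal (negbT (polyX_eq0 _)) r0 (_ : root (map_poly ratr 'X) 0).
by rewrite map_polyX rootX => /(_ isT); rewrite size_polyX ltnNge d1.
Qed.

Lemma det_subst_mx_neq0 : \det (subst_mx int zeta) != 0.
Proof.
have := chi_coef0_neq0; rewrite char_poly_det mulf_eq0 negb_or => /andP[_].
rewrite -(map_subst_mx (intr : int -> rat)) det_map_mx.
by apply: contra => /eqP ->; rewrite rmorph0.
Qed.

Lemma chi_separable : separable_poly chi.
Proof.
rewrite unlock irreducible_poly_coprime; last exact: chi_irr.
have sd : size chi^`() = d.
  have /monicP lc := chi_monic.
  apply/eqP; rewrite eqn_leq; apply/andP; split.
    by rewrite -ltnS -size_chi lt_size_deriv ?monic_neq0 ?chi_monic.
  rewrite leqNgt; apply/negP => sd.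
  have : chi^`()`_d.-1 = 0.
    by rewrite nth_default// -ltnS prednK// (ltn_trans _ d1).
  rewrite coef_deriv prednK; last by rewrite (ltn_trans _ d1).
  move: lc; rewrite /lead_coef size_chi /= => -> /eqP.
  by rewrite pnatr_eq0 eqn0Ngt (ltn_trans _ d1).
apply/negP => /dvdp_leq; rewrite sd size_chi ltnn => H; apply/notF/H.
by rewrite -size_poly_gt0 sd (ltn_trans _ d1).
Qed.

(** If no conjugate lay inside the unit disc, all but [alpha] would have modulus 1, and [alpha]
    would be the absolute value of the integer [chi(0)], hence a root of a polynomial of degree 1 <
    [d]. The transpose is diagonalized because it is the matrix of the twisted recursion at
    [q = 1]. *)
Lemma salem_spectrum : exists (z : 'I_d -> C) (j0 j2 : 'I_d) (P : 'M[C]_d),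
  [/\ P \in unitmx,
      P *m (subst_mx C zeta)^T = diag_mx (\row_j z j) *m P &
      map_poly QtoC chi = \prod_j ('X - (z j)%:P)] /\
  [/\ injective z, z j0 = alpha%:C, forall j, j != j0 -> nc (z j) <= 1 &
      nc (z j2) < 1].
Proof.
have [rs] := closed_field_poly_normal (map_poly QtoC chi).
rewrite lead_coef_map.
have /monicP -> := chi_monic; rewrite rmorph1 scale1r => Ers.
have srs : size rs = d.
  by have := congr1 (fun p : {poly C} => size p) Ers;
    rewrite size_map_poly size_chi size_prod_XsubC => -[].
have urs : uniq rs.
  by rewrite -separable_prod_XsubC -Ers separable_map chi_separable.
pose z (j : 'I_d) := rs`_j.
have zI : injective z.
  by move=> i j /eqP; rewrite /z nth_uniq ?srs// => /eqP/val_inj.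
have Ez : map_poly QtoC chi = \prod_j ('X - (z j)%:P).
  by rewrite Ers (big_nth 0) big_mkord srs.
have zr j : root (map_poly QtoC chi) (z j).
  by rewrite Ers root_prod_XsubC mem_nth// srs.
have [P uP EP] : exists2 P : 'M[C]_d, P \in unitmx &
    P *m (subst_mx C zeta)^T = diag_mx (\row_j z j) *m P.
  apply: eigenvector_matrix => // j.
  by rewrite eigenvalue_root_char char_poly_tr -(map_subst_mx QtoC) -map_char_poly.
have [j0 Ej0] : exists j0, z j0 = alpha%:C.
  have : alpha%:C \in rs by rewrite -root_prod_XsubC -Ers chiC_alpha.
  move=> /(nthP 0)[k]; rewrite srs => kd Ek; by exists (Ordinal kd).
have le1 j : j != j0 -> nc (z j) <= 1.
  move=> jj0; apply: chiC_root_le1 => //; rewrite -Ej0; apply: contra jj0.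
  by move=> /eqP/zI ->.
have [[j2 Hj2]|no] := pselect (exists j2, nc (z j2) < 1); first by exists z, j0, j2, P.
exfalso.
have e1 j : j != j0 -> nc (z j) = 1.
  move=> jj0; apply/eqP; rewrite eq_le le1//= leNgt; apply/negP => H.
  by apply: no; exists j.
pose k := (char_poly (subst_mx int zeta))`_0.
have chiZ : map_poly (intr : int -> rat) (char_poly (subst_mx int zeta)) = chi.
  by rewrite map_char_poly map_subst_mx.
have Ek : (k%:~R : C) = (map_poly QtoC chi)`_0.
  by rewrite -chiZ !coef_map /= ratr_int.
have na : alpha = `|k|%:~R.
  have := congr1 (fun p : {poly C} => nc p.[0]) Ez.
  rewrite horner_coef0 -Ek nc_int intr_norm => ->.
  rewrite horner_prod nc_prod (bigD1 j0)//= big1 ?mulr1 => [|j /e1].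
    by rewrite hornerXsubC sub0r ncN Ej0 ncC gtr0_norm// (lt_trans _ alpha_gt1).
  by rewrite hornerXsubC sub0r ncN.
have := @chi_root_minimal_int R alpha ('X - `|k|%:P).
rewrite polyXsubC_eq0 size_XsubC d1 => /(_ isT isT chi_alpha).
rewrite rmorphB /= map_polyX map_polyC hornerXsubC subr_eq0 => /eqP; exact.
Qed.

End SalemSpectrum.

(** * Simultaneous Diophantine approximation *)

Section SimultaneousApproximation.
Variable R : realType.

(** Dirichlet's pigeonhole argument: among [J.+1 ^ n + 1] multiples of [w] modulo 1, two fall into
    the same cube of side at most [eta]. Only multiples by [k * K.+1] are used, so that the
    difference of the two factors exceeds [K]. *)
Lemma dirichlet_simultaneous n (w : 'I_n -> R) (eta : R) (K : nat) : 0 < eta ->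
  exists t : nat, (K < t)%N /\ exists p : 'I_n -> int,
    forall i, `|(p i)%:~R - t%:R * w i| <= eta.
Proof.
move=> eta0; pose J := (Num.truncn eta^-1).
have HJ : eta^-1 < (J.+1)%:R by exact: truncnS_gt.
pose x (k : nat) i := (k * K.+1)%:R * w i.
pose fr (y : R) := y - (Num.floor y)%:~R.
have fr0 y : 0 <= fr y by rewrite subr_ge0 floor_le.
have fr1 y : fr y < 1 by rewrite ltrBlDr addrC -intrD1 floorD1_gt.
pose bx (y : R) : 'I_J.+1 := inord `|Num.floor (J.+1%:R * fr y)|%N.
have bxE y : (bx y : nat)%:Z = Num.floor (J.+1%:R * fr y).
  have f0 : 0 <= Num.floor (J.+1%:R * fr y) by rewrite floor_ge0 mulr_ge0.
  rewrite /bx inordK; first by rewrite gez0_abs.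
  rewrite -ltz_nat gez0_abs// floor_lt_int -pmulrn -[ltRHS]mulr1 ltr_pM2l//.
pose f (k : 'I_(J.+1 ^ n).+1) : {ffun 'I_n -> 'I_J.+1} := [ffun i => bx (x k i)].
have : ~~ injectiveb f.
  apply/injectiveP => /leq_card; rewrite card_ord card_ffun !card_ord ltnn//.
move=> /injectivePn[k [l kl fkl]].
wlog lt_kl : k l kl fkl / (k < l)%N.
  move=> H; case: (ltngtP k l) => [lt|lt|/val_inj E]; [exact: H kl fkl lt| |].
    by apply: H (esym fkl) lt; rewrite eq_sym.
  by rewrite E eqxx in kl.
exists ((l - k) * K.+1)%N; split.
  by rewrite leq_pmull// subn_gt0.
exists (fun i => Num.floor (x l i) - Num.floor (x k i)) => i.
have E : Num.floor (J.+1%:R * fr (x k i)) = Num.floor (J.+1%:R * fr (x l i)).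
  by rewrite -!bxE; have /ffunP/(_ i) := fkl; rewrite !ffunE => ->.
have xlk : ((l - k) * K.+1)%:R * w i = x l i - x k i.
  by rewrite /x -mulrBl -natrB ?mulnBl// leq_mul2r (ltnW lt_kl) orbT.
rewrite xlk intrB.
have -> : (Num.floor (x l i))%:~R - (Num.floor (x k i))%:~R - (x l i - x k i) =
   fr (x k i) - fr (x l i) by rewrite /fr; ring.
have H1 : `|J.+1%:R * fr (x k i) - J.+1%:R * fr (x l i)| <= 1.
  have A := floor_le (J.+1%:R * fr (x k i)).
  have A' := floorD1_gt (J.+1%:R * fr (x k i)).
  have B := floor_le (J.+1%:R * fr (x l i)).
  have B' := floorD1_gt (J.+1%:R * fr (x l i)).
  by move: A A'; rewrite E !intrD1 in B B' * => A A'; rewrite ler_norml; lra.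
rewrite -mulrBr normrM ger0_norm// in H1.
have J0 : 0 < J.+1%:R :> R by [].
rewrite -(ler_pM2l J0) (le_trans H1)//.
apply: (@le_trans _ _ (eta^-1 * eta)); first by rewrite mulVf ?gt_eqF.
by rewrite ler_wpM2r ?ltW.
Qed.

End SimultaneousApproximation.

Section Conjugates.
Variables (R : realType) (d : nat).
Local Notation C := R[i].
Local Notation QtoC := (ratr : rat -> C).
Local Notation ZtoC := (intr : int -> C).
Variables (chi : {poly rat}) (z : 'I_d -> C) (j2 : 'I_d).
Hypothesis d1 : (1 < d)%N.
Hypothesis chiE : map_poly QtoC chi = \prod_j ('X - (z j)%:P).
Hypothesis chi_size : size chi = d.+1.
Hypothesis z2 : nc (z j2) < 1.

Lemma chi_conj_closed j : exists k, z k = (z j)^*.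
Proof.
have : root (map_poly QtoC chi) (z j)^*.
  have : root (map_poly (@conjc R) (map_poly QtoC chi)) (z j)^*.
    rewrite fmorph_root chiE /root horner_prod; apply/prodf_eq0; exists j => //.
    by rewrite hornerXsubC subrr.
  rewrite -map_poly_comp (eq_map_poly (g := QtoC))// => q /=; exact: fmorph_rat.
rewrite chiE /root horner_prod => /prodf_eq0[k _].
by rewrite hornerXsubC subr_eq0 => /eqP ->; exists k.
Qed.

(* The real part of [chi / ('X - z j2)] still vanishes at all the roots of [chi] but
   [z j2] and its complex conjugate. *)
Lemma real_contracting_poly : exists w : {poly R}, [/\ size w = d, w`_d.-1 = 1 &
  forall j, 1 <= nc (z j) -> (map_poly (real_complex R) w).[z j] = 0].
Proof.
pose W := \prod_(j | j != j2) ('X - (z j)%:P).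
have EW : map_poly QtoC chi = ('X - (z j2)%:P) * W by rewrite chiE (bigD1 j2).
have mW : W \is monic by exact: monic_prod_XsubC.
have sW : size W = d.
  have := congr1 (fun p : {poly C} => size p) EW.
  rewrite size_monicM ?monicXsubC ?monic_neq0// size_XsubC add2n /=.
  by rewrite size_map_poly chi_size => -[].
have coefRe i : (map_poly (@complex.Re R) W)`_i = complex.Re W`_i.
  by rewrite coef_map_id0.
have W1 : W`_d.-1 = 1 by have := monicP mW; rewrite /lead_coef sW.
exists (map_poly (@complex.Re R) W); split.
- apply/eqP; rewrite eqn_leq; apply/andP; split.
    by apply: leq_trans (size_poly _ _) _; rewrite sW.
  rewrite leqNgt; apply/negP => H.
  have : (map_poly (@complex.Re R) W)`_d.-1 = 0 by rewrite nth_default// -ltnS prednK// ltnW.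
  by rewrite coefRe W1 => /eqP; rewrite oner_eq0.
- by rewrite coefRe W1.
move=> j zj.
have -> : map_poly (real_complex R) (map_poly (@complex.Re R) W) =
    2^-1 *: (W + map_poly (@conjc R) W).
  apply/polyP => i; rewrite coef_map /= coefRe coefZ coefD coef_map /=.
  by rewrite ReJ_add mulrC.
have W0 k : 1 <= nc (z k) -> W.[z k] = 0.
  move=> zk; rewrite /W horner_prod; apply/eqP/prodf_eq0; exists k.
    by apply: contraTneq zk => ->; rewrite -ltNge.
  by rewrite hornerXsubC subrr.
rewrite hornerZ hornerD W0// add0r.
have [k Ek] := chi_conj_closed j.
have -> : z j = (@conjc R) (z k) by rewrite Ek conjcK.
by rewrite horner_map W0 ?rmorph0 ?mulr0// Ek ncJ.
Qed.

End Conjugates.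

(** * Frequencies whose phases are eventually small *)

Section NearLine.
Variables (R : realType) (d : nat).
Local Notation C := R[i].
Local Notation ZtoC := (intr : int -> C).
Variables (w : {poly R}) (alpha : R).
Hypothesis d1 : (1 < d)%N.
Hypothesis alpha1 : 1 < alpha.
Hypothesis sw : size w = d.
Hypothesis w1 : w`_d.-1 = 1.

(** The coefficients of [p] approximate those of a multiple [t w], so [p] is small where [w]
    vanishes. As [w] has leading coefficient 1, that of [p] is within 1 of [t > K]; this
    unboundedness later provides infinitely many frequencies. *)
Lemma int_poly_near_line (eta : R) (K : nat) : 0 < eta ->
  exists p : {poly int}, [/\ (size p <= d)%N, (K%:Z <= p`_d.-1) &
    forall z : C, nc z <= alpha -> (map_poly (real_complex R) w).[z] = 0 ->
      nc (map_poly ZtoC p).[z] <= eta].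
Proof.
move=> eta0; have a0 : 0 < alpha by apply: lt_trans alpha1.
have d0 : (0 < d)%N by apply: ltn_trans d1.
(* The bound 1 controls the leading coefficient; the other one controls the value at [z], a sum of
   [d] terms of modulus at most [e * alpha ^+ d]. *)
pose e := Num.min 1 (eta / (d%:R * alpha ^+ d)).
have dd0 : 0 < d%:R * alpha ^+ d by rewrite mulr_gt0 ?ltr0n ?exprn_gt0.
have e0 : 0 < e by rewrite lt_min ltr01 divr_gt0.
have [t [Kt [p Hp]]] := dirichlet_simultaneous (fun i : 'I_d => w`_i) K e0.
pose P : {poly int} := \poly_(i < d) (if insub i is Some j then p j else 0).
have PE (i : 'I_d) : P`_i = p i by rewrite coef_poly ltn_ord (valK i).
exists P; split; first exact: size_poly.
  have ltd : (d.-1 < d)%N by rewrite prednK.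
  have := Hp (Ordinal ltd); rewrite -PE /= w1 mulr1 => H.
  have {}H : `|(P`_d.-1)%:~R - t%:R : R| <= 1.
    by apply: le_trans H _; rewrite ge_min lexx.
  rewrite pmulrn -intrB -intr_norm -[1]/(1%:~R) ler_int in H.
  by move: H Kt; rewrite ler_norml => /andP[+ _]; move: (P`_d.-1) => x; lia.
move=> z za wz.
have -> : (map_poly ZtoC P).[z] = \sum_(i < d) ((p i)%:~R - t%:R * w`_i)%:C * z ^+ i.
  have sP : (size (map_poly ZtoC P) <= d)%N.
    by apply: leq_trans (size_poly _ _) _; exact: size_poly.
  rewrite (horner_coef_wide _ sP).
  have : \sum_(i < d) (t%:R * w`_i)%:C * z ^+ i = 0.
    have swC : (size (map_poly (real_complex R) w) <= d)%N by rewrite size_map_poly sw.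
    transitivity (t%:R * (map_poly (real_complex R) w).[z]); last by rewrite wz mulr0.
    rewrite (horner_coef_wide _ swC) mulr_sumr; apply: eq_bigr => i _.
    by rewrite coef_map rmorphM mulrA rmorph_nat.
  move=> H; rewrite -[LHS]subr0 -[X in _ - X]H -sumrB; apply: eq_bigr => i _.
  by rewrite coef_map PE /= rmorphB mulrBl rmorph_int.
apply: le_trans (nc_sum _ _ _) _.
apply: (@le_trans _ _ (\sum_(i < d) e * alpha ^+ d)).
  apply: ler_sum => i _; rewrite ncM ncC ncX ler_pM ?normr_ge0 ?exprn_ge0 ?nc_ge0 ?Hp//.
  apply: (@le_trans _ _ (alpha ^+ i)); first by apply: lerXn2r; rewrite ?nnegrE ?nc_ge0 ?(ltW a0)//; exact: za.
  by rewrite ler_weXn2l ?ltW// ltnW.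
rewrite sumr_const card_ord -[leLHS]mulr_natl mulrCA -ler_pdivlMr//.
by rewrite ge_min lexx orbT.
Qed.

End NearLine.

Section Eventually.
Variable R : realType.

Lemma exprn_small (x e : R) : 0 <= x < 1 -> 0 < e ->
  exists n0, forall n, (n0 <= n)%N -> x ^+ n <= e.
Proof.
move=> /andP[x0 x1] e0.
have /cvgrPdist_le/(_ _ e0)[n0 _ H] : (fun n => x ^+ n) @ \oo --> (0 : R).
  by apply: cvg_expr; rewrite ger0_norm.
exists n0 => n n0n; have := H n n0n; rewrite sub0r normrN ger0_norm//.
exact: exprn_ge0.
Qed.

Lemma finite_eventually (I : finType) (Q : I -> nat -> Prop) :
  (forall i, exists n0, forall n, (n0 <= n)%N -> Q i n) ->
  exists n0, forall n, (n0 <= n)%N -> forall i, Q i n.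
Proof.
move=> /choice[f Hf]; exists (\max_i f i) => n Hn i; apply: Hf.
by apply: leq_trans Hn; exact: (leq_bigmax i).
Qed.

End Eventually.

Section Phases.
Variables (R : realType) (d : nat) (zeta : 'I_d -> seq 'I_d) (alpha : R).
Local Notation C := R[i].
Local Notation ZtoC := (intr : int -> C).
Variables (z : 'I_d -> C) (j0 : 'I_d) (P : 'M[C]_d).
Hypothesis uP : P \in unitmx.
Hypothesis EP : P *m (subst_mx C zeta)^T = diag_mx (\row_j z j) *m P.
Hypothesis z0 : z j0 = alpha%:C.
Hypothesis z1 : forall j, j != j0 -> nc (z j) <= 1.

Local Notation len n a := (size (subst_iter zeta n a)).

Lemma twsum1_const (w : seq (ordinal d)) : twsum (1 : C) (fun=> 1) w = (size w)%:R.
Proof. by elim: w => //= x w ->; rewrite mul1r -[in RHS]add1n natrD. Qed.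

(** Lengths are twisted sums of the constant 1 at [q = 1], where every matrix of the recursion is
    the transposed substitution matrix. *)
Lemma len_spectral : exists c : 'I_d -> 'I_d -> C, forall n a,
  (len n a)%:R = \sum_j c a j * z j ^+ n.
Proof.
pose v n := twvec zeta (1 : C) (fun=> 1) n.
have Pv n : P *m v n = \col_j (z j ^+ n * (P *m v 0) j 0).
  elim: n => [|n IH]; first by apply/colP => j; rewrite [RHS]mxE expr0 mul1r.
  rewrite /v twvecS twmx1 mulmxA EP -mulmxA IH; apply/colP => j.
  by rewrite mul_diag_mx !mxE exprS mulrA.
exists (fun a j => (invmx P) a j * (P *m v 0) j 0) => n a.
have -> : (len n a)%:R = v n a 0 by rewrite mxE twsum1_const.
rewrite -[v n](mulKmx uP) (Pv n) mxE; apply: eq_bigr => j _.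
by rewrite -[RHS]mulrA [X in _ = _ * X]mulrC; congr (_ * _); rewrite mxE.
Qed.

(** The integer is the sum of the [p_k |zeta^(n+k)(a)|]. By [len_spectral] its difference from
    [p(alpha) |zeta^n(a)|] is the sum of the [c_(a,j) z_j^n (p(alpha) - p(z_j))]: the term of
    [alpha] vanishes, those with [|z_j| < 1] decay, and those with [|z_j| = 1] are small by
    assumption. *)
Lemma phases (eta : R) : 0 < eta -> exists2 eta', 0 < eta' &
  forall p : {poly int},
  (forall j, 1 <= nc (z j) ->
    nc ((map_poly ZtoC p).[alpha%:C] - (map_poly ZtoC p).[z j]) <= eta') ->
  exists n0, forall n, (n0 <= n)%N -> forall a, exists m : int,
    `|(map_poly intr p).[alpha] * (len n a)%:R - m%:~R| <= eta.
Proof.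
move=> eta0; have [c Hc] := len_spectral.
pose M := 1 + \sum_a \sum_j nc (c a j).
have M0' a : \sum_j nc (c a j) <= M.
  rewrite /M [X in 1 + X](bigD1 a)//= addrCA lerDl addr_ge0// sumr_ge0// => b _.
  by apply: sumr_ge0 => j _; exact: nc_ge0.
have M1 : 0 < M.
  rewrite /M ltr_pwDl// sumr_ge0// => b _.
  by apply: sumr_ge0 => j _; exact: nc_ge0.
exists (eta / M); first exact: divr_gt0.
move=> p Hp; pose D j := (map_poly ZtoC p).[alpha%:C] - (map_poly ZtoC p).[z j].
have [n0 Hn0] : exists n0, forall n, (n0 <= n)%N -> forall j,
    nc (z j) ^+ n * nc (D j) <= eta / M.
  apply: finite_eventually => j.
  have [->|jj0] := eqVneq j j0.
    by exists 0%N => n _; rewrite /D z0 subrr nc0 mulr0 divr_ge0 ?ltW.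
  have [zj|zj] := leP 1 (nc (z j)).
    exists 0%N => n _; have -> : nc (z j) = 1 by apply/eqP; rewrite eq_le zj z1.
    by rewrite expr1n mul1r; exact: Hp.
  have D1 : 0 < 1 + nc (D j) by rewrite ltr_pwDl ?nc_ge0.
  have [] := @exprn_small _ (nc (z j)) (eta / M / (1 + nc (D j))).
  - by rewrite nc_ge0.
  - by rewrite !divr_gt0.
  move=> n0 H; exists n0 => n /H; rewrite ler_pdivlMr// => {}H.
  apply: le_trans H; rewrite ler_wpM2l ?exprn_ge0 ?nc_ge0// lerDr//.
exists n0 => n /Hn0 {}Hn0 a.
exists (\sum_(k < size p) p`_k * (len (n + k) a)%:R).
pose om := (map_poly intr p).[alpha].
have Eom : om%:C = (map_poly ZtoC p).[alpha%:C].
  rewrite -horner_map /= -map_poly_comp; congr (_.[_]).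
  by apply: eq_map_poly => k /=; rewrite rmorph_int.
rewrite -/om -ncC.
have -> : (om * (len n a)%:R - (\sum_(k < size p) p`_k * (len (n + k) a)%:R)%:~R)%:C =
    \sum_j c a j * (z j ^+ n * D j).
  rewrite rmorphB rmorphM /= Eom rmorph_nat Hc rmorph_int rmorph_sum /=.
  rewrite mulr_sumr.
  have -> : \sum_(k < size p) (p`_k * (len (n + k) a)%:R)%:~R =
      \sum_j c a j * z j ^+ n * (map_poly ZtoC p).[z j].
    have inj : injective ZtoC by exact: intr_inj.
    under [RHS]eq_bigr do rewrite horner_coef size_map_inj_poly// mulr_sumr.
    rewrite exchange_big /=; apply: eq_bigr => k _.
    rewrite rmorphM /= rmorph_nat Hc mulr_sumr; apply: eq_bigr => j _.
    by rewrite coef_map /= exprD; ring.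
  rewrite -sumrB; apply: eq_bigr => j _; rewrite /D; ring.
apply: le_trans (nc_sum _ _ _) _.
apply: (@le_trans _ _ (\sum_j nc (c a j) * (eta / M))).
  by apply: ler_sum => j _; rewrite ncM ler_wpM2l ?nc_ge0// ncM ncX.
by rewrite -mulr_suml mulrCA ger_pMr// ler_pdivrMr// mul1r.
Qed.

End Phases.

(** * Determinants of the twisted matrices as integer polynomials *)

Section TwistDeterminant.
Variables (d : nat) (zeta : 'I_d -> seq 'I_d).

Definition twdet (k : nat) : {poly int} := \det (twmx zeta 'X k).

Lemma map_horner_twdet (K : comNzRingType) (q : K) k :
  (map_poly intr (twdet k)).[q] = \det (twmx zeta q k).
Proof.
pose f : {rmorphism {poly int} -> K} := horner_eval q \o map_poly (intr : int -> K).
have -> : (map_poly intr (twdet k)).[q] = f (twdet k) by [].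
rewrite /twdet -(det_map_mx f) twmx_morph /f /= map_polyX /horner_eval hornerX //.
Qed.

Lemma twdet_neq0 k : \det (subst_mx int zeta) != 0 -> twdet k != 0.
Proof.
apply: contra => /eqP H; have := map_horner_twdet (1 : int) k.
by rewrite H rmorph0 horner0 twmx1 det_tr => <-.
Qed.

Lemma twcoef_majorant l (c : ordinal d) w :
  majorant (twcoef ('X : {poly int}) l c w) (twcoef 'X l c w).
Proof.
elim: w => [|x w IH] /=; first exact: majorant0.
apply: majorantD; last by apply: majorantM => //; exact: majorantX.
by case: eqP => _; [exact: majorant1|exact: majorant0].
Qed.

(** The level [k] enters only through exponents of [q], which disappear at 1. The majorant is the
    permanent of the twisted matrix, and its value at 1 is the permanent of the substitution
    matrix. *)
Lemma twdet_majorant : exists h : int, forall k,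
  exists2 M : {poly int}, majorant (twdet k) M & M.[1] <= h.
Proof.
exists (\sum_(s : {perm 'I_d}) \prod_(i < d) (count_mem (s i) (zeta i))%:R) => k.
exists (\sum_(s : {perm 'I_d}) \prod_(i < d) twmx zeta 'X k i (s i)).
  apply: majorant_sum => s; apply: majorant_sign; apply: majorant_prod => i.
  by rewrite mxE; exact: twcoef_majorant.
rewrite horner_sum; apply: ler_sum => s _; rewrite horner_prod.
rewrite le_eqVlt; apply/orP; left; apply/eqP; apply: eq_bigr => i _.
rewrite mxE -[LHS]/(horner_eval 1 _) twcoef_morph /= /horner_eval hornerX.
by rewrite twcoef1.
Qed.

End TwistDeterminant.

Section GoodFrequency.
Variables (R : realType) (d : nat) (zeta : 'I_d -> seq 'I_d) (alpha : R).
Hypothesis d1 : (1 < d)%N.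
Hypothesis salem : Salem_type zeta alpha.
Local Notation C := R[i].
Local Notation QtoC := (ratr : rat -> C).
Local Notation ZtoC := (intr : int -> C).
Local Notation chi := (char_poly (subst_mx rat zeta)).
Local Notation ev p := ((map_poly (intr : int -> R) p).[alpha]).
Local Notation len n a := (size (subst_iter zeta n a)).

Lemma ecirc_eq1 (y : R) : ecirc y = 1 -> exists m : int, y = m%:~R.
Proof.
move=> ey; exists (Num.floor y); apply/eqP; rewrite -subr_eq0; apply: contraT => f0.
set f := y - _ in f0.
have f1 : f < 1 by rewrite /f ltrBlDr addrC -intrD1 floorD1_gt.
have fp : 0 < f by rewrite lt0r f0 subr_ge0 floor_le.
have ef : ecirc f = 1 by rewrite /f ecirc_subint.
have : (1 - f) / 2 = (1 - f) / 2 + f.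
  apply: ecirc_inj; [by apply/andP; split; lra..|].
  by rewrite [RHS]ecircD ef mulr1.
lra.
Qed.

Lemma ev_neq0 (p : {poly int}) : p != 0 -> (size p <= d)%N -> ev p != 0.
Proof.
move=> p0 sp; apply: (chi_root_minimal_int salem p0 sp); exact: chi_alpha.
Qed.

Lemma evC p : (ev p)%:C = (map_poly ZtoC p).[alpha%:C].
Proof.
rewrite -horner_map /= -map_poly_comp; congr (_.[_]).
by apply: eq_map_poly => k /=; rewrite rmorph_int.
Qed.

(* [ev r] divides a nonzero integer [N] in the ring [Z[alpha]], hence
   [N Z[alpha]] is contained in the ideal generated by [ev r]. *)
Lemma ev_bezout (r : {poly int}) : r != 0 -> (size r <= d)%N ->
  exists (u : {poly int}) (N : int), N != 0 /\ N%:~R = ev u * ev r.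
Proof.
move=> r0 sr; pose rQ := map_poly (intr : int -> rat) r.
have rQ0 : rQ != 0 by rewrite -size_poly_gt0 size_rat_int_poly size_poly_gt0.
have /Bezout_coprimepP[[u1 u2] /=] : coprimep chi rQ.
  rewrite irreducible_poly_coprime; last exact: chi_irr salem.
  apply/negP => /dvdp_leq => /(_ rQ0); rewrite size_rat_int_poly size_chi.
  by rewrite leqNgt ltnS sr.
rewrite -size_poly_eq1 => /size_poly1P[c c0 Ec].
have [u [a a0 Eu]] := rat_poly_scale u2.
exists (denq c *: u), (numq c * a); split.
  by rewrite mulf_neq0// numq_eq0.
have ca := rootP (chi_alpha salem).
have evQ (q : {poly int}) : (map_poly ratr (map_poly (intr : int -> rat) q)).[alpha] = ev q.
  rewrite -map_poly_comp; congr (_.[_]); apply: eq_map_poly => k /=; exact: ratr_int.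
have := congr1 (fun p => (map_poly (ratr : rat -> R) p).[alpha]) Ec.
rewrite rmorphD !rmorphM /= hornerD !hornerM ca mulr0 add0r map_polyC hornerC /=.
rewrite Eu map_polyZ hornerZ !evQ fmorphV /= ratr_int => H.
rewrite map_polyZ hornerZ /=.
have a0' : (a%:~R : R) != 0 by rewrite intr_eq0.
have -> : (numq c)%:~R = (denq c)%:~R * ratr c :> R.
  by rewrite -!(ratr_int R) -rmorphM mulrC -numqE.
by rewrite -H; field.
Qed.

(** Reduced modulo the monic integer polynomial [chi], [ev v] is an integer combination of the
    [alpha^j] with [j < d], so the number is a monomial in the given generators; negative exponents
    call for the inverses. *)
Lemma ecirc_comb_in_Qfield (om : R) (theta : C) :
  (forall j : 'I_d, in_Qfield theta (ecirc (- (alpha ^+ j * om))) /\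
                    in_Qfield theta (ecirc (- (alpha ^+ j * om)))^-1) ->
  forall v : {poly int}, in_Qfield theta (ecirc (- (ev v * om))).
Proof.
move=> Hg v.
pose chiZ := char_poly (subst_mx int zeta).
have mchi : chiZ \is monic by exact: char_poly_monic.
have Echi : ev chiZ = 0.
  have := rootP (chi_alpha salem); rewrite -(map_subst_mx zeta (intr : int -> rat)) -map_char_poly.
  rewrite -map_poly_comp => H; rewrite -[RHS]H; congr (_.[_]).
  by apply: eq_map_poly => k /=; rewrite ratr_int.
pose t := Pdiv.Ring.rmodp v chiZ.
have st : (size t <= d)%N.
  rewrite -ltnS -(size_char_poly (subst_mx int zeta)).
  by apply: Pdiv.Ring.ltn_rmodpN0; exact: monic_neq0.
have -> : ev v = \sum_(j < d) (t`_j)%:~R * alpha ^+ j.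
  have -> : ev v = ev t.
    rewrite (Pdiv.RingMonic.rdivp_eq mchi v) rmorphD rmorphM /= hornerD hornerM.
    by rewrite Echi mulr0 add0r.
  rewrite (horner_coef_wide (n := d)).
    by apply: eq_bigr => j _; rewrite coef_map.
  by apply: leq_trans (size_poly _ _) _.
rewrite mulr_suml -sumrN; elim/big_ind : _ => [|x y Hx Hy|j _].
- by rewrite ecirc0; exact: in_Qfield1.
- by rewrite ecircD; exact: in_QfieldM.
have [Hp Hn] := Hg j; case: (t`_j) => n.
  rewrite (_ : - _ = (- (alpha ^+ j * om)) *+ n); last by rewrite -mulr_natr; ring.
  by rewrite ecircMn; exact: in_QfieldX.
rewrite NegzE (_ : - _ = (- - (alpha ^+ j * om)) *+ n.+1); last first.
  by rewrite opprK -mulr_natr rmorphN /=; ring.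
by rewrite ecircMn ecircV; exact: in_QfieldX.
Qed.

(* Otherwise the numbers [e(-om)], for [om] in a suitable infinite set, would be roots
   of the polynomials [twdet zeta k], whose heights are bounded; as they lie in a
   number field generated by the [e(-alpha^j om0)], this contradicts [northcott]. *)
Lemma good_frequency (eta : R) : 0 < eta -> exists om : R,
  [/\ 0 < om < 1, Z_adjoin alpha om,
      exists n0, forall n, (n0 <= n)%N -> forall a, exists m : int,
        `|om * (len n a)%:R - m%:~R| <= eta &
      forall k, \det (twmx zeta (ecirc (- om)) k) != 0].
Proof.
move=> eta0.
have [z [j0 [j2 [P [[uP EP chiE] [zI z0 z1 z2]]]]]] := salem_spectrum d1 salem.
have [w [sw w1 wz]] := real_contracting_poly d1 chiE (size_chi zeta) z2.
have a1 := alpha_gt1 salem; have a0 : 0 < alpha by apply: lt_trans a1.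
have zle j : nc (z j) <= alpha.
  have [->|/z1 H] := eqVneq j j0; last by apply: le_trans H _; exact: ltW.
  by rewrite z0 ncC ger0_norm// ltW.
have zj01 : 1 <= nc (z j0) by rewrite z0 ncC ger0_norm ltW.
have [eta' eta'0 Hphase] := phases uP EP z0 z1 eta0.
(* With all values at most [eta' / 2] their differences are at most [eta'], as [phases] requires;
   the bound 1/2 keeps [ev p] away from nonzero integers. *)
pose e1 := Num.min (eta' / 2) (1 / 2).
have e10 : 0 < e1 by rewrite lt_min !divr_gt0.
pose small (e : R) (p : {poly int}) :=
  forall j, 1 <= nc (z j) -> nc (map_poly ZtoC p).[z j] <= e.
have small_ev e p : small e p -> `|ev p| <= e.
  by move=> /(_ j0 zj01); rewrite z0 -evC ncC.
have near K (e : R) : 0 < e -> exists p : {poly int},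
    [/\ (size p <= d)%N, K%:Z <= p`_d.-1 & small e p].
  move=> e0; have [p [sp Kp Hp]] := int_poly_near_line d1 a1 sw w1 K e0.
  by exists p; split=> // j zj; apply: Hp (wz j zj).
have [h Hh] := twdet_majorant zeta.
have Ddet k : twdet zeta k != 0 by apply: twdet_neq0; exact: det_subst_mx_neq0 d1 salem.
apply: contrapT => no.
have bad p : small e1 p -> ev p != 0 ->
    exists k, root (map_poly ZtoC (twdet zeta k)) (ecirc (- ev p)).
  (* Subtracting [m] moves the frequency into [(0, 1)]. It changes neither [e(-ev p)] nor the
     differences [p(alpha) - p(z_j)]. *)
  move=> sp p0; pose m := Num.floor (ev p); pose p' := p - m%:P.
  have Ep' : ev p' = ev p - m%:~R by rewrite rmorphB /= map_polyC hornerD hornerN hornerC.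
  have p1 : `|ev p| < 1.
    have := small_ev _ _ sp; rewrite /e1 le_min => /andP[_ H]; lra.
  have om01 : 0 < ev p' < 1.
    rewrite Ep'; apply/andP; split; last by rewrite ltrBlDr addrC -intrD1 floorD1_gt.
    rewrite lt0r subr_ge0 floor_le andbT.
    apply/negP => /eqP E; have {}E : ev p = m%:~R by lra.
    have m0 : m != 0 by apply: contraNneq p0 => m0; rewrite E m0.
    have := int_norm_ge1 m0; rewrite -(ler_int R) intr_norm -E.
    by rewrite leNgt p1.
  apply: contrapT => nok; apply: no; exists (ev p'); split => //.
  - by exists p'.
  - apply: Hphase => j zj.
    have Eq y : (map_poly ZtoC p').[y] = (map_poly ZtoC p).[y] - m%:~R.
      by rewrite rmorphB /= map_polyC hornerD hornerN hornerC.
    rewrite !Eq opprB addrA subrK (le_trans (ncB _ _))//.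
    have H1 := sp j zj; have H2 := small_ev _ _ sp.
    rewrite -evC ncC; move: H1 H2; rewrite /e1 !le_min => /andP[H1 _] /andP[H2 _]; lra.
  - move=> k; apply/negP => /eqP H; apply: nok; exists k; apply/rootP.
    by rewrite map_horner_twdet -H Ep' opprB -opprB ecircN -ecircN -(ecirc_subint _ (- m))
      rmorphN opprK opprB addrC.
have ad : 0 < alpha ^+ d by rewrite exprn_gt0.
(* The division by [alpha ^+ d] leaves room for multiplying by [X^j], [j < d]. Hence [bad] applies
   to every [alpha^j * ev r0], and the generators of the number field are algebraic. *)
have [r0 [sr0 Kr0 Hr0]] := near 1%N (e1 / alpha ^+ d) (divr_gt0 e10 ad).
have r00 : r0 != 0 by apply: contraTneq Kr0 => ->; rewrite coef0.
have evr0 := ev_neq0 r00 sr0.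
have [u [N [N0 EN]]] := ev_bezout r00 sr0.
have alg (j : 'I_d) : algebraicOver QtoC (ecirc (- (alpha ^+ j * ev r0))).
  have Ex : ev ('X^j * r0) = alpha ^+ j * ev r0.
    by rewrite rmorphM /= map_polyXn hornerM hornerXn.
  have [k Hk] : exists k, root (map_poly ZtoC (twdet zeta k)) (ecirc (- ev ('X^j * r0))).
    apply: bad; last by rewrite Ex mulf_neq0// expf_neq0// gt_eqF.
    move=> i zi; rewrite rmorphM /= map_polyXn hornerM hornerXn ncM ncX.
    apply: (@le_trans _ _ (alpha ^+ d * (e1 / alpha ^+ d))).
      rewrite ler_pM ?exprn_ge0 ?nc_ge0//; last exact: Hr0.
      apply: (@le_trans _ _ (alpha ^+ j)).
        by apply: lerXn2r; rewrite ?nnegrE ?nc_ge0 ?(ltW a0).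
      by rewrite ler_weXn2l ?ltW// ltnW.
    by rewrite mulrCA divff ?mulr1// gt_eqF.
  rewrite -Ex; exists (map_poly intr (twdet zeta k)).
    by rewrite -size_poly_gt0 size_rat_int_poly size_poly_gt0.
  rewrite -map_poly_comp (eq_map_poly (g := ZtoC))// => x /=; exact: ratr_int.
pose gs := [seq ecirc (- (alpha ^+ j * ev r0)) | j : 'I_d <- enum 'I_d].
have [theta [atheta Htheta]] : exists theta, algebraicOver QtoC theta /\
    forall x, x \in gs ++ [seq y^-1 | y <- gs] -> in_Qfield theta x.
  apply: primitive_element => x; rewrite mem_cat => /orP[/mapP[j _ ->]//|].
  by move=> /mapP[y /mapP[j _ ->] ->]; apply: algebraic_inv.
have comb := @ecirc_comb_in_Qfield (ev r0) theta _.
have {}comb : forall v, in_Qfield theta (ecirc (- (ev v * ev r0))).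
  apply: comb => j.
  have jg : ecirc (- (alpha ^+ j * ev r0)) \in gs by apply: map_f; rewrite mem_enum.
  by split; apply: Htheta; rewrite mem_cat ?jg// map_f ?orbT.
have /finite_seqP[s Es] := northcott h atheta.
have N0' : 0 < (`|N|%:~R : R) by rewrite ltr0z normr_gt0.
(* The values [N * ev r] form the infinite set of frequencies: multiplication by [N] puts them into
   [Z[alpha] * ev r0], hence their exponentials into the number field. The second alternative can
   occur only for [K = 0]. *)
have /choice[r Hr] : forall K : nat, exists r : {poly int}, [/\ (size r <= d)%N,
    K%:Z <= r`_d.-1 & ecirc (- (N%:~R * ev r)) \in s \/ r`_d.-1 <= 0].
  move=> K; have [r [sr Kr Hr]] := near K (e1 / `|N|%:~R) (divr_gt0 e10 N0').
  exists r; split=> //; have [rd|rd] := leP (r`_d.-1) 0; [by right|left].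
  have r1 : r != 0 by apply: contraTneq rd => ->; rewrite coef0.
  have Ex : ev (N *: r) = N%:~R * ev r by rewrite map_polyZ hornerZ.
  have : [set` s] (ecirc (- (N%:~R * ev r))).
    rewrite -Es; split.
      have -> : N%:~R * ev r = ev (u * r) * ev r0.
        by rewrite EN rmorphM /= hornerM; ring.
      exact: comb.
    have [k Hk] : exists k, root (map_poly ZtoC (twdet zeta k)) (ecirc (- ev (N *: r))).
      apply: bad; last by rewrite Ex mulf_neq0 ?intr_eq0// ev_neq0.
      move=> i zi; rewrite map_polyZ hornerZ ncM nc_int -intr_norm.
      by rewrite mulrC -ler_pdivlMr//; exact: Hr.
    have [M MD Mh] := Hh k.
    by exists (twdet zeta k), M; split => //; rewrite -Ex.
  by [].
(* Equal exponentials differ in argument by an integer [m], so [N (r L - r K) - m] vanishes at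
   [alpha]. Its degree is less than [d], so it is zero, and as [d >= 2] the constant [m] does not
   affect the coefficient of degree [d - 1]. *)
have same K L : ecirc (- (N%:~R * ev (r K))) = ecirc (- (N%:~R * ev (r L))) ->
    (r K)`_d.-1 = (r L)`_d.-1.
  move=> E; have [sK _ _] := Hr K; have [sL _ _] := Hr L.
  have [m Hm] : exists m : int, N%:~R * ev (r L) - N%:~R * ev (r K) = m%:~R.
    by apply: ecirc_eq1; rewrite addrC ecircD E ecircN_mul.
  pose q := N *: (r L - r K) - m%:P.
  have Eq : ev q = 0.
    rewrite rmorphB /= map_polyZ rmorphB /= map_polyC hornerD hornerN hornerC.
    by rewrite hornerZ hornerD hornerN /= -Hm; ring.
  have sq : (size q <= d)%N.
    apply: leq_trans (size_polyD _ _) _; rewrite geq_max size_polyN; apply/andP; split.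
      apply: leq_trans (size_scale_leq _ _) _.
      by apply: leq_trans (size_polyD _ _) _; rewrite geq_max size_polyN sL sK.
    by apply: leq_trans (size_polyC_leq1 _) _; exact: ltnW.
  have q0 : q = 0.
    by apply/eqP; apply: contraT => /ev_neq0 => /(_ sq); rewrite Eq eqxx.
  have := congr1 (fun q : {poly int} => q`_d.-1) q0.
  rewrite coefB coefZ coefB coefC coef0.
  have -> /= : (d.-1 == 0)%N = false by case: d d1 => [|[]].
  rewrite subr0 => /eqP; rewrite mulf_eq0 (negPf N0) /= subr_eq0 => /eqP //.
have /choice[B HB] : forall y : C, exists B : nat, forall K,
    ecirc (- (N%:~R * ev (r K))) = y -> (r K)`_d.-1 <= B%:Z.
  move=> y; have [[L EL]|nL] := pselect (exists L, ecirc (- (N%:~R * ev (r L))) = y).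
    exists (absz ((r L)`_d.-1)%R) => K EK; rewrite (same K L) ?EK// abszE; exact: ler_norm.
  by exists 0%N => K EK; case: nL; exists K.
(* This [K] exceeds the bound [B y] of every [y] in the finite set [s], while [r K] has a
   coefficient at least [K] and its exponential lies in [s]. *)
pose K := (\max_(y <- s) B y).+1.
have [_ Kr [Ks|Kneg]] := Hr K; last by have := le_trans Kr Kneg.
have := le_trans Kr (HB _ K erefl); rewrite lez_nat ltnNge => /negP; apply.
by apply: (@leq_bigmax_seq _ s xpredT B).
Qed.

End GoodFrequency.

(** * Growth of the twisted sums *)

Section ConeDichotomy.
Variables (R : realType) (alpha rho delta : R) (Y Z : nat -> R) (n0 : nat).
Hypothesis delta0 : 0 < delta.
Hypothesis rho_sigma : 1 + delta *+ 2 <= rho.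
Hypothesis rho_alpha : rho <= alpha - delta *+ 2.
Hypothesis Y0 : forall n, 0 <= Y n.
Hypothesis Z0 : forall n, 0 <= Z n.
Hypothesis HY : forall n, (n0 <= n)%N -> alpha * Y n - delta * (Y n + Z n) <= Y n.+1.
Hypothesis HZ : forall n, (n0 <= n)%N -> Z n.+1 <= Z n + delta * (Y n + Z n).

(** [Y] is the component along the eigenvalue [alpha], [Z] the size of the rest. In the cone
    [Z <= Y], the next [Y] is at least [(alpha - 2 delta) Y >= rho Y] and the next [Z] at most
    [(1 + 2 delta) Y <= rho Y], so the cone is preserved. *)
Lemma cone_growth n1 : (n0 <= n1)%N -> Z n1 <= Y n1 ->
  forall k, Z (n1 + k) <= Y (n1 + k) /\ rho ^+ k * Y n1 <= Y (n1 + k).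
Proof.
move=> n01 ZY; elim=> [|k [IH1 IH2]]; first by rewrite addn0 expr0 mul1r.
have nk : (n0 <= n1 + k)%N by rewrite (leq_trans n01)// leq_addr.
have := HY nk; have := HZ nk; rewrite addnS.
set y := Y _ in IH1 IH2 *; set x := Z _ in IH1 IH2 *; move=> Hz Hy.
have y0 : 0 <= y by exact: Y0.
have dxy : delta * (y + x) <= delta * (y *+ 2) by rewrite ler_pM2l// mulr2n lerD2l.
have ry : rho * y <= Y (n1 + k).+1.
  apply: le_trans Hy; have : rho * y <= (alpha - delta *+ 2) * y by rewrite ler_wpM2r.
  move: dxy; rewrite !mulr2n; lra.
split.
  apply: le_trans Hz _; apply: le_trans ry.
  have : (1 + delta *+ 2) * y <= rho * y by rewrite ler_wpM2r.
  move: dxy; rewrite !mulr2n; lra.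
have r0 : 0 <= rho by apply: le_trans rho_sigma; rewrite addr_ge0// mulrn_wge0// ltW.
by apply: le_trans ry; rewrite exprS -mulrA ler_wpM2l.
Qed.

(** Where [Y < Z], the perturbation adds at most [2 delta Z]. *)
Lemma off_cone_growth : (forall n, (n0 <= n)%N -> Y n < Z n) ->
  forall k, Z (n0 + k) <= (1 + delta *+ 2) ^+ k * Z n0.
Proof.
move=> H; elim=> [|k IH]; first by rewrite addn0 expr0 mul1r.
have nk : (n0 <= n0 + k)%N by rewrite leq_addr.
rewrite addnS; apply: le_trans (HZ nk) _.
rewrite exprS -mulrA; apply: (@le_trans _ _ ((1 + delta *+ 2) * Z (n0 + k))); last first.
  by rewrite ler_wpM2l// addr_ge0// mulrn_wge0// ltW.
have := H _ nk; move: (Y _) (Z _) => y x yx.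
have : delta * (y + x) <= delta * (x *+ 2) by rewrite ler_pM2l// mulr2n lerD2r ltW.
rewrite !mulr2n; lra.
Qed.

End ConeDichotomy.

Section TwistedGrowth.
Variables (R : realType) (d : nat) (zeta : 'I_d -> seq 'I_d) (alpha : R).
Local Notation C := R[i].
Variables (z : 'I_d -> C) (j0 : 'I_d) (P : 'M[C]_d).
Hypothesis uP : P \in unitmx.
Hypothesis EP : P *m (subst_mx C zeta)^T = diag_mx (\row_j z j) *m P.
Hypothesis z0 : z j0 = alpha%:C.
Hypothesis z1 : forall j, j != j0 -> nc (z j) <= 1.
Hypothesis alpha1 : 1 < alpha.
Local Notation len n a := (size (subst_iter zeta n a)).
Local Notation vec q b n := (twvec zeta q (fun j => b 0 j) n).

Lemma mxl1_col m (v : 'cV[C]_m) : mxl1 v = \sum_i nc (v i 0).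
Proof. by apply: eq_bigr => i _; rewrite big_ord1. Qed.

Lemma twmx_near (delta : R) : 0 < delta -> exists2 eta : R, 0 < eta &
  forall (om : R) n, (forall a, exists m : int, `|om * (len n a)%:R - m%:~R| <= eta) ->
  mxl1 (P *m (twmx zeta (ecirc (- om)) n - (subst_mx C zeta)^T) *m invmx P) <= delta.
Proof.
move=> delta0.
pose W : R := \sum_(a < d) \sum_(c < d) (size (zeta a) * size (zeta a))%:R.
pose M := 1 + mxl1 P * mxl1 (invmx P).
have W0 : 0 <= W by apply: sumr_ge0 => a _; apply: sumr_ge0.
have M0 : 0 < M by rewrite ltr_pwDl// mulr_ge0 ?mxl1_ge0.
have W1 : 0 < 1 + W by rewrite ltr_pwDl.
have p0 := @pi_gt0 R.
(* Phases within [eta] of integers give weights within [2 pi eta] of 1; [W] comes from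
   [twcoef_near1] and [M] from the conjugation by [P]. The summands 1 keep the denominator
   positive. *)
pose eta := delta / (2 * pi * (1 + W) * M).
have D0 : 0 < 2 * pi * (1 + W) * M by rewrite !mulr_gt0.
exists eta; first exact: divr_gt0.
move=> om n Hm; set A := twmx _ _ _ - _.
have HA : mxl1 A <= 2 * pi * eta * W.
  rewrite /mxl1 /W mulr_sumr ler_sum// => a _; rewrite mulr_sumr ler_sum// => c _.
  rewrite !mxE mulr_natr; apply: twcoef_near1; first exact: nc_ecirc.
  move=> x; rewrite -ecircMn (_ : - om *+ _ = - (om * (len n x)%:R)); last first.
    by rewrite mulr_natr mulNrn.
  have [m H] := Hm x; apply: le_trans (nc_ecircB1_near _ (- m)) _.
  by rewrite ler_pM2l ?mulr_gt0// rmorphN opprK addrC distrC.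
apply: le_trans (mxl1M _ _) _.
apply: (@le_trans _ _ (mxl1 P * mxl1 A * mxl1 (invmx P))).
  by rewrite ler_wpM2r ?mxl1_ge0// mxl1M.
have e0 : 0 < 2 * pi * eta by apply: mulr_gt0; [rewrite mulr_gt0|exact: divr_gt0].
have H1 : mxl1 A <= 2 * pi * eta * (1 + W).
  by apply: le_trans HA _; rewrite ler_pM2l// lerDr.
have H2 : mxl1 P * mxl1 (invmx P) <= M by rewrite lerDr.
have -> : delta = (2 * pi * eta * (1 + W)) * M.
  rewrite -[LHS](divfK (lt0r_neq0 D0)) -/eta; ring.
rewrite mulrAC mulrC ler_pM ?mulr_ge0 ?mxl1_ge0//.
Qed.

(** The recursion is solved backwards; this is where the nonvanishing of the determinants enters. *)
Lemma twvec_onto (q : C) : (forall k, \det (twmx zeta q k) != 0) ->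
  forall n (u : 'cV[C]_d), exists b : 'rV[C]_d, vec q b n = u.
Proof.
move=> Hdet; elim=> [|n IH] u.
  by exists u^T; rewrite twvec0; apply/colP => a; rewrite !mxE.
have [b Hb] := IH (invmx (twmx zeta q n) *m u); exists b.
by rewrite twvecS Hb mulKVmx// unitmxE unitfE.
Qed.

(** The exceptional subspace. It is used with [sigma = 1 + 2 delta], the growth rate outside the
    cone, which is less than [rho]. *)
Definition slow (q : C) (sigma : R) (b : 'rV[C]_d) : Prop :=
  exists K, forall n, mxl1 (vec q b n) <= K * sigma ^+ n.

Lemma slow_lin q sigma k b1 b2 : 0 <= sigma ->
  slow q sigma b1 -> slow q sigma b2 -> slow q sigma (k *: b1 + b2).
Proof.
move=> s0 [K1 H1] [K2 H2]; exists (nc k * K1 + K2) => n.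
have -> : vec q (k *: b1 + b2) n = k *: vec q b1 n + vec q b2 n.
  apply/colP => a; rewrite !mxE -twsumZ -twsumD; congr twsum.
  by apply/funext => j; rewrite !mxE.
apply: le_trans (mxl1D _ _) _; rewrite mxl1Z mulrDl -mulrA lerD//.
by rewrite ler_wpM2l ?nc_ge0.
Qed.

Lemma slow_const q sigma : nc q = 1 -> q != 1 -> 1 <= sigma ->
  slow q sigma (const_mx 1).
Proof.
move=> q1 qn1 s1; exists (d%:R * (2 / nc (q - 1))) => n.
have n0 : 0 < nc (q - 1) by rewrite nc_gt0 subr_eq0.
apply: (@le_trans _ _ (d%:R * (2 / nc (q - 1)))); last first.
  rewrite ler_peMr ?exprn_ege1// mulr_ge0// divr_ge0// ltW//.
rewrite mxl1_col -[d in d%:R]card_ord -sum1_card natr_sum mulr_suml ler_sum// => a _.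
rewrite mul1r ler_pdivlMr// mulrC -ncM mxE.
rewrite (_ : (fun j => _) = fun=> 1); last by apply/funext => j; rewrite mxE.
rewrite twsum_const (le_trans (ncB _ _))// ncX q1 expr1n nc1//.
Qed.

Lemma twisted_growth (rho : R) : 1 < rho < alpha -> exists2 eta : R, 0 < eta &
  forall om : R, ecirc (- om) != 1 ->
  (exists n0, forall n, (n0 <= n)%N -> forall a, exists m : int,
     `|om * (len n a)%:R - m%:~R| <= eta) ->
  (forall k, \det (twmx zeta (ecirc (- om)) k) != 0) ->
  exists E : 'rV[C]_d -> Prop,
    [/\ forall k b1 b2, E b1 -> E b2 -> E (k *: b1 + b2), E (const_mx 1),
        exists b, ~ E b &
        forall b, ~ E b -> exists c n1, 0 < c /\ forall n, (n1 <= n)%N ->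
          exists a, c * rho ^+ n <= nc (vec (ecirc (- om)) b n a 0)].
Proof.
move=> /andP[rho1 rhoa].
(* The two bounds give [rho <= alpha - 2 delta] and [1 + 2 delta < rho], the conditions of the cone
   argument. *)
pose delta := Num.min ((alpha - rho) / 2) ((rho - 1) / 4).
have delta0 : 0 < delta by rewrite lt_min !divr_gt0 ?subr_gt0.
have [da db] : delta <= (alpha - rho) / 2 /\ delta <= (rho - 1) / 4.
  by rewrite !ge_min !lexx orbT.
have rho_alpha : rho <= alpha - delta *+ 2 by rewrite mulr2n; lra.
have rho_sigma : 1 + delta *+ 2 < rho by rewrite mulr2n; lra.
pose sigma := 1 + delta *+ 2.
have sigma1 : 1 <= sigma by rewrite lerDl mulrn_wge0// ltW.
have sigma0 : 0 <= sigma by apply: le_trans sigma1.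
have rho0 : 0 < rho by apply: lt_trans rho1.
have [eta eta0 Heta] := twmx_near delta0.
exists eta => // om qn1 [n0 Hn0] Hdet; set q := ecirc (- om) in qn1 Hdet *.
(* In the coordinates given by [P] the recursion becomes [y_(n+1) = (diag z + G_n) y_n] with [G_n]
   of norm at most [delta] for [n >= n0]. *)
pose y (b : 'rV[C]_d) n : 'cV[C]_d := P *m vec q b n.
pose Y b n := nc (y b n j0 0).
pose Z b n := \sum_(j | j != j0) nc (y b n j 0).
have Y0 b n : 0 <= Y b n by exact: nc_ge0.
have Z0 b n : 0 <= Z b n by apply: sumr_ge0 => j _; exact: nc_ge0.
have YZ b n : mxl1 (y b n) = Y b n + Z b n by rewrite mxl1_col (bigD1 j0).
pose G n := P *m (twmx zeta q n - (subst_mx C zeta)^T) *m invmx P.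
have yS b n : y b n.+1 = diag_mx (\row_j z j) *m y b n + G n *m y b n.
  rewrite /y twvecS mulmxA -EP -mulmxA /G -!mulmxA mulKmx// -mulmxDr -mulmxDl.
  by rewrite addrC subrK mulmxA.
have yE b n j : y b n.+1 j 0 = z j * y b n j 0 + (G n *m y b n) j 0.
  by rewrite yS mxE mul_diag_mx [X in X + _]mxE [X in X * _]mxE.
have GE b n : (n0 <= n)%N -> mxl1 (G n *m y b n) <= delta * (Y b n + Z b n).
  move=> n0n; rewrite -YZ; apply: le_trans (mxl1M _ _) _.
  by rewrite ler_wpM2r ?mxl1_ge0//; apply: Heta; exact: Hn0.
have HY b n : (n0 <= n)%N -> alpha * Y b n - delta * (Y b n + Z b n) <= Y b n.+1.
  move=> n0n; rewrite lerBlDr; apply: le_trans (lerD (lexx _) (GE b n n0n)).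
  rewrite -lerBlDr /Y yE z0.
  have -> : alpha * nc (y b n j0 0) = nc (alpha%:C * y b n j0 0).
    by rewrite ncM ncC gtr0_norm// (lt_trans _ alpha1).
  apply: (@le_trans _ _ (nc (alpha%:C * y b n j0 0) - nc ((G n *m y b n) j0 0))).
    by rewrite lerD2l lerN2 mxl1_entry.
  rewrite lerBlDr; set a := _ * _; set g := (G n *m y b n) j0 0.
  by rewrite -{1}[a](addrK g) ncB.
have HZ b n : (n0 <= n)%N -> Z b n.+1 <= Z b n + delta * (Y b n + Z b n).
  move=> n0n; apply: (@le_trans _ _ (Z b n + mxl1 (G n *m y b n))); last first.
    by rewrite lerD2l GE.
  rewrite mxl1_col [X in _ + X](bigD1 j0)//= addrCA.
  apply: (@le_trans _ _ (Z b n + \sum_(j | j != j0) nc ((G n *m y b n) j 0))); last first.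
    by rewrite lerDr nc_ge0.
  rewrite /Z -big_split /= ler_sum// => j jj0.
  rewrite yE (le_trans (ncD _ _))// lerD2r ncM.
  by rewrite ler_piMl ?nc_ge0// z1.
have cone b := @cone_growth R alpha rho delta (Y b) (Z b) n0 delta0 (ltW rho_sigma)
  rho_alpha (Y0 b) (HY b) (HZ b).
have vY (b : 'rV[C]_d) n : Y b n <= mxl1 P * mxl1 (vec q b n).
  by apply: le_trans (mxl1M _ _); rewrite YZ lerDl.
have vyle (b : 'rV[C]_d) n : mxl1 (vec q b n) <= mxl1 (invmx P) * (Y b n + Z b n).
  by rewrite -YZ -{1}[vec q b n](mulKmx uP) mxl1M.
have slow_of (b : 'rV[C]_d) n1 K : 0 <= K ->
    (forall k, mxl1 (vec q b (n1 + k)) <= K * sigma ^+ k) -> slow q sigma b.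
  move=> K0 H; pose S := \sum_(k < n1) mxl1 (vec q b k).
  have S0 : 0 <= S by apply: sumr_ge0 => k _; exact: mxl1_ge0.
  exists (S + K) => n; rewrite mulrDl; have [nn|nn] := ltnP n n1.
    rewrite -[leLHS]addr0 lerD ?mulr_ge0 ?exprn_ge0//.
    apply: (@le_trans _ _ S); last by rewrite ler_peMr// exprn_ege1.
    rewrite /S (bigD1 (Ordinal nn))//= lerDl sumr_ge0// => k _; exact: mxl1_ge0.
  rewrite -[leLHS]add0r lerD ?mulr_ge0 ?exprn_ge0//.
  rewrite -{1}(subnKC nn); apply: le_trans (H _) _.
  by rewrite ler_wpM2l// ler_weXn2l// leq_subr.
exists (slow q sigma); split.
- by move=> k b1 b2; exact: slow_lin.
- by apply: slow_const => //; exact: nc_ecirc.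
(* This [b] is at level [n0] exactly in the direction of [alpha], hence in the cone. Growth at rate
   [rho] from there on contradicts slowness, because [sigma < rho]. *)
- have [b Hb] := twvec_onto Hdet n0 (invmx P *m delta_mx j0 0).
  exists b => -[K HK].
  have yb : y b n0 = delta_mx j0 0 by rewrite /y Hb mulKVmx.
  have Yb : Y b n0 = 1 by rewrite /Y yb mxE !eqxx nc1.
  have Zb : Z b n0 = 0.
    by rewrite /Z big1// => j /negPf jj0; rewrite yb mxE jj0 andFb mulr0n nc0.
  have {}cone := cone b n0 (leqnn _) (_ : Z b n0 <= Y b n0).
  rewrite Yb Zb in cone; have {}cone := cone ler01.
  have K0 : 0 <= K.
    by have := HK 0%N; rewrite expr0 mulr1; apply: le_trans; exact: mxl1_ge0.
  pose K' := 1 + mxl1 P * K * rho ^+ n0.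
  have K'0 : 0 < K' by rewrite ltr_pwDl// mulr_ge0 ?exprn_ge0 ?(ltW rho0)// mulr_ge0// mxl1_ge0.
  have [||N HN] := @exprn_small R (sigma / rho) (2^-1 / K').
  - by rewrite divr_ge0 ?(ltW rho0)//= ltr_pdivrMr// mul1r.
  - by rewrite divr_gt0.
  have {}HN := HN (n0 + N)%N (leq_addl _ _).
  have [_ C1] := cone N; have C2 := vY b (n0 + N)%N.
  have C3 : mxl1 P * mxl1 (vec q b (n0 + N)) <= mxl1 P * (K * sigma ^+ (n0 + N)).
    by rewrite ler_wpM2l ?mxl1_ge0.
  have C4 := le_trans C1 (le_trans C2 C3).
  rewrite mulr1 in C4.
  have C5 : rho ^+ (n0 + N) <= mxl1 P * K * rho ^+ n0 * sigma ^+ (n0 + N).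
    rewrite exprD; apply: (@le_trans _ _ (rho ^+ n0 * (mxl1 P * (K * sigma ^+ (n0 + N))))).
      by rewrite ler_wpM2l// exprn_ge0// ltW.
    by rewrite le_eqVlt; apply/orP; left; apply/eqP; ring.
  have C6 : rho ^+ (n0 + N) <= K' * sigma ^+ (n0 + N).
    by apply: le_trans C5 _; rewrite ler_wpM2r ?exprn_ge0// lerDr.
  have r0 : 0 < rho ^+ (n0 + N) by rewrite exprn_gt0.
  move: HN; rewrite expr_div_n ler_pdivrMr// mulrAC ler_pdivlMr// [_ * K']mulrC => HN.
  have := le_trans C6 HN; lra.
move=> b nE.
(* A vector that never enters the cone grows at most at rate [sigma], so it is slow. *)
have [n1 n01 ZY] : exists2 n1, (n0 <= n1)%N & Z b n1 <= Y b n1.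
  apply: contrapT => nc'; apply: nE.
  have H n : (n0 <= n)%N -> Y b n < Z b n.
    by move=> n0n; rewrite ltNge; apply/negP => H; apply: nc'; exists n.
  apply: (slow_of b n0 (mxl1 (invmx P) * (Z b n0 *+ 2))).
    by rewrite mulr_ge0 ?mxl1_ge0// mulrn_wge0.
  move=> k; apply: le_trans (vyle _ _) _; rewrite -mulrA ler_wpM2l ?mxl1_ge0//.
  have K1 := off_cone_growth delta0 (HZ b) H k.
  have K2 : Y b (n0 + k) <= Z b (n0 + k) by rewrite ltW// H// leq_addr.
  apply: le_trans (lerD K2 (lexx _)) _; apply: le_trans (lerD K1 K1) _.
  by rewrite -/sigma [Z b n0 *+ 2]mulr2n mulrDl [sigma ^+ k * _]mulrC.
have Yn1 : 0 < Y b n1.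
  rewrite lt0r Y0 andbT; apply/negP => /eqP Yn; apply: nE.
  have v0 : vec q b n1 = 0.
    apply/eqP; apply: contraT => /mxl1_gt0; rewrite ltNge => /negP; case.
    apply: le_trans (vyle _ _) _.
    have -> : Z b n1 = 0 by apply/eqP; rewrite eq_le Z0 -Yn ZY.
    by rewrite Yn addr0 mulr0.
  have v0k k : vec q b (n1 + k) = 0.
    by elim: k => [|k IH]; rewrite ?addn0// addnS twvecS IH mulmx0.
  apply: (slow_of b n1 0) => // k; rewrite v0k mul0r.
  by rewrite mxl1_col big1// => i _; rewrite mxE nc0.
have P0 : 0 < mxl1 P.
  apply: mxl1_gt0; apply: contraTneq Yn1 => P0.
  by rewrite /Y /y P0 mul0mx mxE nc0 ltxx.
have d0 : 0 < d%:R :> R by rewrite ltr0n; case: d j0 => [[]|].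
(* [Y] is at most the norm of [P] times a sum over [d] letters, so one of the letters carries the
   fraction [1/d] of the growth. *)
pose c := Y b n1 / rho ^+ n1 / (mxl1 P * d%:R).
exists c, n1; split; first by rewrite !divr_gt0 ?exprn_gt0 ?mulr_gt0.
move=> n n1n; apply: contrapT => Hno.
have [_ H1] := cone b n1 n01 ZY (n - n1)%N.
rewrite subnKC// in H1; have H2 := vY b n.
have H3 : mxl1 (vec q b n) < d%:R * (c * rho ^+ n).
  rewrite mxl1_col -[d in d%:R]card_ord -sum1_card natr_sum mulr_suml.
  apply: ltr_sum; first by apply/hasP; exists j0; rewrite ?mem_index_enum.
  move=> a _; rewrite mul1r ltNge; apply/negP => H; apply: Hno; by exists a.
have := le_lt_trans (le_trans H1 H2) (_ : _ < mxl1 P * (d%:R * (c * rho ^+ n))).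
rewrite ltr_pM2l// => /(_ H3); rewrite -{2}(subnKC n1n) exprD /c ltNge => /negP; apply.
rewrite le_eqVlt; apply/orP; left; apply/eqP; field; rewrite !gt_eqF ?exprn_gt0//.
Qed.

End TwistedGrowth.

(** * Correlations and the mean square of the twisted Birkhoff sums *)

Section BoundedMeasurable.
Context (R : realType) disp (T : measurableType disp).
Variable mu : {finite_measure set T -> \bar R}.
Variable D : set T.
Hypothesis mD : measurable D.
Implicit Types g h : T -> R.

(** This class is closed under all the operations needed, and its members are integrable for a
    finite measure, which settles the integrability conditions once and for all. *)
Definition bdd_measurable g :=
  measurable_fun D g /\ exists B, forall x, `|g x| <= B.

Lemma bdd_integrable g : bdd_measurable g -> mu.-integrable D (EFin \o g).
Proof.
move=> [mg [B HB]]; apply: measurable_bounded_integrable => //.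
  by rewrite -ge0_fin_numE ?fin_num_measure.
exists B; split; first by rewrite num_real.
by move=> M BM x _; apply: le_trans (HB x) (ltW BM).
Qed.

Lemma bdd_cst (c : R) : bdd_measurable (fun=> c).
Proof. by split; [exact: measurable_cst|exists `|c|]. Qed.

Lemma bddD g h : bdd_measurable g -> bdd_measurable h ->
  bdd_measurable (fun x => g x + h x).
Proof.
move=> [mg [B HB]] [mh [B' HB']]; split; first exact: measurable_funD.
by exists (B + B') => x; rewrite (le_trans (ler_normD _ _))// lerD.
Qed.

Lemma bddM g h : bdd_measurable g -> bdd_measurable h ->
  bdd_measurable (fun x => g x * h x).
Proof.
move=> [mg [B HB]] [mh [B' HB']]; split; first exact: measurable_funM.
by exists (B * B') => x; rewrite normrM ler_pM.
Qed.

Lemma bddZ (c : R) g : bdd_measurable g -> bdd_measurable (fun x => c * g x).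
Proof. by apply: bddM; exact: bdd_cst. Qed.

Lemma bddN g : bdd_measurable g -> bdd_measurable (fun x => - g x).
Proof.
move=> H; rewrite (_ : (fun x => _) = fun x => -1 * g x); first exact: bddZ.
by apply/funext => x; rewrite mulN1r.
Qed.

Lemma bddB g h : bdd_measurable g -> bdd_measurable h ->
  bdd_measurable (fun x => g x - h x).
Proof. by move=> Hg Hh; apply: bddD => //; exact: bddN. Qed.

Lemma bdd_sum I (r : seq I) (P : pred I) (g : I -> T -> R) :
  (forall i, P i -> bdd_measurable (g i)) ->
  bdd_measurable (fun x => \sum_(i <- r | P i) g i x).
Proof.
move=> H; elim: r => [|i r IH].
  by rewrite (_ : (fun x => _) = fun=> 0); [exact: bdd_cst|apply/funext => x; rewrite big_nil].
case Pi: (P i).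
  rewrite (_ : (fun x => _) = fun x => g i x + \sum_(j <- r | P j) g j x).
    by apply: bddD => //; exact: H.
  by apply/funext => x; rewrite big_cons Pi.
by rewrite (_ : (fun x => _) = fun x => \sum_(j <- r | P j) g j x)//;
  apply/funext => x; rewrite big_cons Pi.
Qed.

Lemma Rintegral_sum_bdd I (r : seq I) (P : pred I) (g : I -> T -> R) :
  (forall i, P i -> bdd_measurable (g i)) ->
  \int[mu]_(x in D) (\sum_(i <- r | P i) g i x) =
  \sum_(i <- r | P i) \int[mu]_(x in D) g i x.
Proof.
move=> H; elim: r => [|i r IH].
  rewrite big_nil (@eq_Rintegral _ _ _ mu D (fun=> 0)) => [|x _]; last by rewrite big_nil.
  by rewrite Rintegral_cst// mul0r.
rewrite big_cons -IH; case Pi: (P i).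
  rewrite -RintegralD//; [|by apply: bdd_integrable; exact: H|].
    by apply: eq_Rintegral => x _; rewrite big_cons Pi.
  by apply: bdd_integrable; exact: bdd_sum.
by apply: eq_Rintegral => x _; rewrite big_cons Pi.
Qed.

Lemma RintegralZ_bdd (c : R) g : bdd_measurable g ->
  \int[mu]_(x in D) (c * g x) = c * \int[mu]_(x in D) g x.
Proof. by move=> H; rewrite RintegralZl//; exact: bdd_integrable. Qed.

Lemma RintegralB_bdd g h : bdd_measurable g -> bdd_measurable h ->
  \int[mu]_(x in D) (g x - h x) = \int[mu]_(x in D) g x - \int[mu]_(x in D) h x.
Proof. by move=> Hg Hh; rewrite RintegralB//; exact: bdd_integrable. Qed.

Lemma le_Rintegral_bdd g h : bdd_measurable g -> bdd_measurable h ->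
  (forall x, D x -> g x <= h x) ->
  \int[mu]_(x in D) g x <= \int[mu]_(x in D) h x.
Proof. by move=> Hg Hh; apply: le_Rintegral => //; exact: bdd_integrable. Qed.

Definition cbdd_measurable (F : T -> R[i]) :=
  bdd_measurable (fun x => complex.Re (F x)) /\
  bdd_measurable (fun x => complex.Im (F x)).

Lemma cbdd_cst c : cbdd_measurable (fun=> c).
Proof. by split; exact: bdd_cst. Qed.

Lemma cbddM F G : cbdd_measurable F -> cbdd_measurable G ->
  cbdd_measurable (fun x => F x * G x).
Proof.
move=> [Fr Fi] [Gr Gi]; split.
  rewrite (_ : (fun x => _) = fun x => complex.Re (F x) * complex.Re (G x) -
    complex.Im (F x) * complex.Im (G x)); first by apply: bddB; exact: bddM.
  by apply/funext => x; rewrite ReM.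
rewrite (_ : (fun x => _) = fun x => complex.Re (F x) * complex.Im (G x) +
  complex.Im (F x) * complex.Re (G x)); first by apply: bddD; exact: bddM.
by apply/funext => x; rewrite ImM.
Qed.

Lemma cbddJ F : cbdd_measurable F -> cbdd_measurable (fun x => (F x)^*).
Proof.
move=> [Fr Fi]; split.
  rewrite (_ : (fun x => _) = fun x => complex.Re (F x))//.
  by apply/funext => x; case: (F x).
rewrite (_ : (fun x => _) = fun x => - complex.Im (F x)); first exact: bddN.
by apply/funext => x; case: (F x).
Qed.

Lemma cbdd_sum I (r : seq I) (P : pred I) (F : I -> T -> R[i]) :
  (forall i, cbdd_measurable (F i)) ->
  cbdd_measurable (fun x => \sum_(i <- r | P i) F i x).
Proof.
move=> H; split.
  rewrite (_ : (fun x => _) = fun x => \sum_(i <- r | P i) complex.Re (F i x)).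
    by apply: bdd_sum => i _; exact: (H i).1.
  by apply/funext => x; rewrite Re_sum.
rewrite (_ : (fun x => _) = fun x => \sum_(i <- r | P i) complex.Im (F i x)).
  by apply: bdd_sum => i _; exact: (H i).2.
by apply/funext => x; rewrite Im_sum.
Qed.

Lemma bdd_sqr_nc F : cbdd_measurable F -> bdd_measurable (fun x => nc (F x) ^+ 2).
Proof.
move=> [Fr Fi]; rewrite (_ : (fun x => _) = fun x => complex.Re (F x) * complex.Re (F x) +
    complex.Im (F x) * complex.Im (F x)); first by apply: bddD; exact: bddM.
by apply/funext => x; rewrite sqr_nc.
Qed.

Lemma Re_mul_cintegral c F : cbdd_measurable F ->
  \int[mu]_(x in D) complex.Re (c * F x) = complex.Re (c * cintegral mu D F).
Proof.
move=> [Fr Fi]; rewrite ReM /= -!RintegralZ_bdd// -RintegralB_bdd.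
- by apply: eq_Rintegral => x _; rewrite ReM.
- exact: bddZ.
- exact: bddZ.
Qed.

Lemma cintegral_conj F : cbdd_measurable F ->
  cintegral mu D (fun x => (F x)^*) = (cintegral mu D F)^*.
Proof.
move=> [Fr Fi]; rewrite /cintegral /=; congr (_ +i* _).
  by apply: eq_Rintegral => x _; case: (F x).
rewrite -mulN1r -RintegralZ_bdd//; apply: eq_Rintegral => x _.
by rewrite mulN1r; case: (F x).
Qed.

(** The family [u] is arbitrary because two expansions are needed: translates of a cylindrical
    function under [mu], and characters under the spectral measure. *)
Lemma Rintegral_sqr_nc_sum (c : nat -> R[i]) (u : nat -> T -> R[i]) n :
  (forall k, cbdd_measurable (u k)) ->
  \int[mu]_(x in D) (nc (\sum_(k < n) c k * u k x) ^+ 2) =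
  \sum_(k < n) \sum_(l < n)
    complex.Re (c k * (c l)^* * cintegral mu D (fun x => u k x * (u l x)^*)).
Proof.
move=> Hu.
have E x : nc (\sum_(k < n) c k * u k x) ^+ 2 =
    \sum_(k < n) \sum_(l < n) complex.Re (c k * (c l)^* * (u k x * (u l x)^*)).
  rewrite -[LHS]ReC nc_conj_mul rmorph_sum /= mulr_suml Re_sum; apply: eq_bigr => k _.
  rewrite mulr_sumr Re_sum; apply: eq_bigr => l _; rewrite rmorphM /=.
  by rewrite mulrACA.
rewrite (@eq_Rintegral _ _ _ mu D (fun x => \sum_(k < n) \sum_(l < n)
    complex.Re (c k * (c l)^* * (u k x * (u l x)^*)))) => [|x _]; last exact: E.
have Hkl k l : cbdd_measurable (fun x => u k x * (u l x)^*).
  by apply: cbddM => //; exact: cbddJ.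
have Hb k l : bdd_measurable (fun x => complex.Re (c k * (c l)^* * (u k x * (u l x)^*))).
  by apply: (cbddM (cbdd_cst _) (Hkl k l)).1.
rewrite Rintegral_sum_bdd => [|k _]; last exact: bdd_sum.
apply: eq_bigr => k _; rewrite Rintegral_sum_bdd => [|l _]; last exact: Hb.
by apply: eq_bigr => l _; rewrite Re_mul_cintegral.
Qed.

End BoundedMeasurable.

(** * The shift space, invariance and the energy *)

Section ShiftSpace.
Variables (R : realType) (d : nat) (hd : (1 < d)%N).
Variables (zeta : 'I_d -> seq 'I_d) (mu : probability (full_shift hd) R).
Local Notation Omega := (full_shift hd).
Local Notation X := (subst_space zeta : set Omega).

Lemma measurable_coord (n : int) (P : pred 'I_d) :
  measurable [set x : Omega | P (x n)].
Proof.
have H a : measurable ([set x | x n = a] : set Omega).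
  by apply: sub_gen_smallest; exists n, a.
rewrite (_ : [set x | _] = \bigcup_(a in [set a | P a]) ([set x | x n = a] : set Omega)).
  by apply: fin_bigcup_measurable => // ; exact: finite_finset.
apply/seteqP; split => [x /= Px|x [a /= Pa xa]]; first by exists (x n).
by rewrite /= xa.
Qed.

Lemma measurable_shift_pow (k : int) :
  measurable_fun setT (@shift_pow d hd k).
Proof.
have H := @measurability _ _ Omega Omega setT (@shift_pow d hd k) (@coord_sets d hd).
apply: H => //.
move=> _ [_ [n [a ->]] <-]; rewrite setTI.
rewrite (_ : _ @^-1` _ = [set x : Omega | pred1 a (x (n + k))]).
  exact: measurable_coord.
by apply/seteqP; split => x /eqP.
Qed.

Lemma measurable_factor (i : int) (n : nat) (L : set (seq 'I_d)) :
  measurable [set x : Omega | L (Defs.factor x i n)].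
Proof.
pose V (t : n.-tuple 'I_d) : set Omega :=
  \bigcap_(k in [set: 'I_n]) [set x : Omega | x (i + k%:Z) == tnth t k].
rewrite (_ : [set x | _] = \bigcup_(t in [set t : n.-tuple 'I_d | L t]) V t).
  apply: fin_bigcup_measurable; first exact: finite_finset.
  move=> t _; apply: fin_bigcap_measurable; first exact: finite_finset.
  move=> k _; exact: (measurable_coord (i + k%:Z) (pred1 (tnth t k))).
apply/seteqP; split => [x /= Lx|x /= [t /= Lt Vx]].
  have sx : size (Defs.factor x i n) == n by rewrite size_mkseq.
  exists (Tuple sx) => // k _ /=; apply/eqP.
  by rewrite (tnth_nth (x 0)) /= nth_mkseq.
suff -> : Defs.factor x i n = t by [].
apply: (@eq_from_nth _ (x 0)); rewrite size_mkseq ?size_tuple// => k kn.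
rewrite nth_mkseq//; have /eqP -> := Vx (Ordinal kn) I.
by rewrite (tnth_nth (x 0)).
Qed.

Lemma measurable_subst_space : measurable X.
Proof.
rewrite (_ : X = \bigcap_(p in [set: int * nat])
   [set x : Omega | exists a m, infix (Defs.factor x p.1 p.2) (subst_iter zeta m a)]).
  rewrite -[X in measurable X]setCK setC_bigcap; apply: measurableC.
  apply: countable_bigcupT_measurable => [|p]; first exact: countableP.
  apply: measurableC.
  exact: (measurable_factor p.1 p.2 [set s | exists a m, infix s (subst_iter zeta m a)]).
by apply/seteqP; split => [x Xx [i n] _ /=|x Hx i n]; [exact: Xx|exact: (Hx (i, n))].
Qed.

Lemma shift_powD (k l : int) (x : Omega) :
  shift_pow k (shift_pow l x) = shift_pow (l + k) x.
Proof. by apply/funext => n; rewrite /shift_pow -addrA [k + l]addrC. Qed.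

Lemma subst_space_shift (k : int) (x : Omega) : X (shift_pow k x) <-> X x.
Proof.
have fE (y : Omega) (l i : int) n : Defs.factor (shift_pow l y) i n = Defs.factor y (i + l) n.
  by apply: eq_mkseq => j; rewrite /shift_pow addrAC.
split => Xx i n; last by rewrite fE; exact: Xx.
by have := Xx (i - k) n; rewrite fE subrK.
Qed.

Hypothesis mu_inv : invariant_probability zeta mu.

Lemma mu_shift_pow (k : nat) A : measurable A -> mu (shift_pow k%:Z @^-1` A) = mu A.
Proof.
move=> mA; elim: k => [|k IH].
  by congr (mu _); apply/seteqP; split => x /=;
    rewrite (_ : shift_pow 0%:Z x = x)//; apply/funext => n; rewrite /shift_pow addr0.
rewrite -IH -[RHS](mu_inv.2); last first.
  rewrite -[X in measurable X]setTI; exact: measurable_shift_pow.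
congr (mu _); apply/seteqP; split => x /=; rewrite shift_powD -[k.+1]add1n PoszD//.
Qed.

Lemma Rintegral_shift (k : nat) (g : Omega -> R) : bdd_measurable setT g ->
  \int[mu]_x g (shift_pow k%:Z x) = \int[mu]_x g x.
Proof.
move=> Hg; have mk := measurable_shift_pow k%:Z.
have bg : bdd_measurable setT (fun x => g (shift_pow k%:Z x)).
  case: Hg => mg [B HB]; split; first exact: measurableT_comp.
  by exists B => x; exact: HB.
rewrite /Rintegral; congr fine.
have := @integral_pushforward _ _ _ _ _ _ mk mu setT (EFin \o g) _ _ measurableT.
rewrite preimage_setT => <- //.
- by apply: eq_measure_integral => A mA _; exact: mu_shift_pow.
- by apply/measurable_EFinP; case: Hg.
- exact: bdd_integrable bg.
Qed.

Section CylindricalFunction.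
Variable b : 'rV[R[i]]_d.
Local Notation f := (cyl_fun hd zeta b).

Lemma cyl_funE x : X x -> f x = b 0 (x 0).
Proof.
move=> Xx; rewrite /cyl_fun (bigD1 (x 0))//= indicE mem_set// mulr1.
rewrite big1 ?addr0// => j jx; rewrite indicE memNset ?mulr0//.
by case=> _ /eqP; rewrite eq_sym (negPf jx).
Qed.

Lemma cyl_fun_out x : ~ X x -> f x = 0.
Proof.
move=> Xx; rewrite /cyl_fun big1// => j _.
by rewrite indicE memNset ?mulr0// => -[].
Qed.

Lemma cyl_fun_shift (k : int) x : X x -> f (shift_pow k x) = b 0 (x k).
Proof.
by move=> Xx; rewrite cyl_funE ?subst_space_shift// /shift_pow add0r.
Qed.

Lemma bdd_of_letters (h : 'I_d -> R) :
  bdd_measurable setT (fun x : Omega => \sum_(j < d) h j * \1_(cylinder hd zeta j) x).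
Proof.
apply: bdd_sum => j _; apply: bddZ; split; last first.
  by exists 1 => x; rewrite indicE; case: (_ \in _); rewrite ?normr1 ?normr0.
apply: measurable_indic; rewrite /cylinder.
rewrite (_ : [set x | _] = X `&` [set x : Omega | pred1 j (x 0)]).
  by apply: measurableI; [exact: measurable_subst_space|exact: measurable_coord].
by apply/seteqP; split=> x /= [? /eqP ?]; split=> //; apply/eqP.
Qed.

Lemma cyl_fun_bdd : cbdd_measurable setT f.
Proof.
split.
  rewrite (_ : (fun x => _) = fun x : Omega => \sum_(j < d) complex.Re (b 0 j) *
    \1_(cylinder hd zeta j) x); first exact: bdd_of_letters.
  apply/funext => x; rewrite /cyl_fun Re_sum; apply: eq_bigr => j _.
  by rewrite !indicE; case: (_ \in _); rewrite ?mulr0n ?mulr1n ?mulr0 ?mulr1.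
rewrite (_ : (fun x => _) = fun x : Omega => \sum_(j < d) complex.Im (b 0 j) *
    \1_(cylinder hd zeta j) x); first exact: bdd_of_letters.
apply/funext => x; rewrite /cyl_fun Im_sum; apply: eq_bigr => j _.
by rewrite !indicE; case: (_ \in _); rewrite ?mulr0n ?mulr1n ?mulr0 ?mulr1.
Qed.

Lemma cyl_fun_shift_bdd (k : int) : cbdd_measurable setT (f \o @shift_pow d hd k).
Proof.
have [[mr [B HB]] [mi [B' HB']]] := cyl_fun_bdd.
by split; split; [exact: measurableT_comp mr (measurable_shift_pow k)|by exists B => x; exact: HB|
  exact: measurableT_comp mi (measurable_shift_pow k)|by exists B' => x; exact: HB'].
Qed.

Lemma cintegral_shift_mul (k l : nat) :
  cintegral mu setT (fun x => f (shift_pow k%:Z x) * (f (shift_pow l%:Z x))^*) =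
  autocorr mu f (k%:Z - l%:Z).
Proof.
pose F x := f (shift_pow (k%:Z - l%:Z) x) * (f x)^*.
have HF : cbdd_measurable setT F.
  apply: cbddM; first exact: cyl_fun_shift_bdd.
  by apply: cbddJ; exact: cyl_fun_bdd.
have E x : f (shift_pow k%:Z x) * (f (shift_pow l%:Z x))^* = F (shift_pow l%:Z x).
  by rewrite /F shift_powD addrC subrK.
rewrite /autocorr /dotL2 /cintegral; congr (_ +i* _).
  rewrite -[RHS](Rintegral_shift l HF.1).
  by apply: eq_Rintegral => x _; rewrite E.
rewrite -[RHS](Rintegral_shift l HF.2).
by apply: eq_Rintegral => x _; rewrite E.
Qed.

(* The sum over [m < M] of the squared [L^2] norms of the twisted Birkhoff sums of
   length [m], written in terms of correlations (see [energy_ge]). *)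
Definition energy (om : R) (M : nat) : R := \sum_(m < M) \sum_(k < m) \sum_(l < m)
  complex.Re (ecirc (- (om * k%:R)) * (ecirc (- (om * l%:R)))^* *
              autocorr mu f (k%:Z - l%:Z)).

Lemma energy_ge (om : R) (M : nat) (B0 : R) :
  (forall x, X x -> B0 <= \sum_(m < M)
     nc (\sum_(k < m) ecirc (- (om * k%:R)) * b 0 (x k%:Z)) ^+ 2) ->
  B0 <= energy om M.
Proof.
move=> HB.
pose S m x := \sum_(k < m) ecirc (- (om * k%:R)) * f (shift_pow k%:Z x).
have ES m : \int[mu]_x (nc (S m x) ^+ 2) = \sum_(k < m) \sum_(l < m)
    complex.Re (ecirc (- (om * k%:R)) * (ecirc (- (om * l%:R)))^* *
              autocorr mu f (k%:Z - l%:Z)).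
  rewrite (@Rintegral_sqr_nc_sum _ _ _ mu setT measurableT
    (fun k => ecirc (- (om * k%:R))) (fun k x => f (shift_pow k%:Z x))).
    apply: eq_bigr => k _; apply: eq_bigr => l _; congr (complex.Re (_ * _)).
    exact: cintegral_shift_mul.
  by move=> k; exact: cyl_fun_shift_bdd.
have bS m : bdd_measurable setT (fun x => nc (S m x) ^+ 2).
  apply: bdd_sqr_nc; apply: cbdd_sum => k.
  by apply: cbddM; [exact: cbdd_cst|exact: cyl_fun_shift_bdd].
have -> : energy om M = \sum_(m < M) \int[mu]_x (nc (S m x) ^+ 2).
  by apply: eq_bigr => m _; rewrite ES.
rewrite -Rintegral_sum_bdd//.
have muX : mu X = 1%E := mu_inv.1.
have mX := measurable_subst_space.
(* The lower bound holds on [X] only. With the indicator of [X] it holds everywhere, and its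
   integral is still [B0] because [X] has full mass. *)
have -> : B0 = \int[mu]_x (B0 * \1_X x).
  rewrite RintegralZ_bdd//; last first.
    split; first exact: measurable_indic.
    by exists 1 => x; rewrite indicE; case: (_ \in _); rewrite ?normr1 ?normr0.
  rewrite /Rintegral integral_indic// setIT.
  by rewrite (_ : fine (mu _) = 1) ?mulr1//; rewrite [X in fine X]muX.
apply: le_Rintegral_bdd => //.
- apply: bddZ; split; first exact: measurable_indic.
  by exists 1 => x; rewrite indicE; case: (_ \in _); rewrite ?normr1 ?normr0.
- exact: bdd_sum.
move=> x _; rewrite indicE; have [Xx|Xx] := pselect (X x).
  rewrite mem_set// mulr1; apply: le_trans (HB x Xx) _; apply: ler_sum => m _.
  rewrite le_eqVlt; apply/orP; left; apply/eqP; congr (nc _ ^+ 2).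
  by apply: eq_bigr => k _; rewrite cyl_fun_shift.
by rewrite memNset// mulr0 sumr_ge0// => m _; rewrite exprn_ge0// nc_ge0.
Qed.

End CylindricalFunction.
End ShiftSpace.

(** * Lower bounds along a single orbit *)

Section PointwiseLowerBound.
Variables (R : realType) (d : nat) (zeta : 'I_d -> seq 'I_d).
Local Notation C := R[i].
Local Notation len n a := (size (subst_iter zeta n a)).

Lemma sum_factor (q : C) (b : 'I_d -> C) (x : int -> 'I_d) m :
  \sum_(k < m) q ^+ k * b (x k%:Z) = twsum q b (Defs.factor x 0 m).
Proof.
rewrite /Defs.factor /mkseq.
have H s : twsum q b [seq x (0 + k%:Z) | k <- iota s m] = \sum_(k < m) q ^+ k * b (x (s + k)%:Z).
  elim: m s => [|m IH] s; first by rewrite big_ord0.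
  rewrite big_ord_recl /= IH mulr_sumr expr0 mul1r addn0 add0r; congr (_ + _).
  by apply: eq_bigr => k _; rewrite exprS mulrA addSnnS.
by rewrite H.
Qed.

Lemma sum_window_ge (F : nat -> R) (v : R) (m0 T M : nat) : (forall m, 0 <= F m) ->
  (m0 + T < M)%N -> (forall t, (t <= T)%N -> v <= F (m0 + t)%N) ->
  v *+ T.+1 <= \sum_(m < M) F m.
Proof.
move=> F0 lM HF; rewrite -(big_mkord xpredT F).
rewrite (big_cat_nat (n := m0)) //=; last by lia.
rewrite -[leLHS]add0r lerD ?sumr_ge0//.
rewrite (big_cat_nat (n := m0 + T.+1)) ?leq_addr//=; last by lia.
rewrite -[leLHS]addr0 lerD ?sumr_ge0//.
rewrite -{1}[m0]add0n big_addn addKn -[T.+1]subn0 -sumr_const_nat subn0.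
rewrite !big_nat ler_sum// => t /= tT; rewrite addnC; exact: HF.
Qed.

(* One of the partial sums at the two ends of the occurrence of [s] has modulus at
   least [h], and it takes about [h / (2 B)] further terms to get below [h / 2]. *)
Lemma twsum_partial_sums_ge (q : C) (b : 'I_d -> C) (B h : R) (x : int -> 'I_d)
    (s : seq 'I_d) (W M : nat) :
  nc q = 1 -> 0 < B -> (forall j, nc (b j) <= B) ->
  infix s (Defs.factor x 0 W) -> 0 <= h -> h *+ 2 <= nc (twsum q b s) ->
  (W + size s < M)%N ->
  h ^+ 3 / (8 * B) <= \sum_(m < M) nc (\sum_(k < m) q ^+ k * b (x k%:Z)) ^+ 2.
Proof.
move=> q1 B0 bB /infixP[s1 [s2 Es]] h0 hs WM.
pose S m := twsum q b (Defs.factor x 0 m).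
have sW : W = (size s1 + size s + size s2)%N.
  by have := congr1 size Es; rewrite size_mkseq !size_cat addnA.
have Spre m (t1 t2 : seq 'I_d) : Defs.factor x 0 W = t1 ++ t2 -> size t1 = m -> S m = twsum q b t1.
  move=> E <-; rewrite /S; congr twsum.
  have le1 : (size t1 <= W)%N.
    by have := congr1 size E; rewrite size_mkseq size_cat => ->; exact: leq_addr.
  transitivity (take (size t1) (Defs.factor x 0 W)); last by rewrite E take_size_cat.
  by rewrite /Defs.factor -map_take take_iota (minn_idPl le1).
have S1 : S (size s1) = twsum q b s1 by apply: Spre Es _.
have S2 : S (size s1 + size s)%N = twsum q b s1 + q ^+ size s1 * twsum q b s.
  by rewrite -twsum_cat; apply: (Spre _ _ s2); rewrite -?catA ?size_cat.
have Sstep m t : nc (S (m + t)%N - S m) <= B *+ t.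
  elim: t => [|t IH]; first by rewrite addn0 subrr nc0 mulr0n.
  have -> : S (m + t.+1)%N - S m = (S (m + t)%N - S m) + q ^+ (m + t) * b (x (m + t)%:Z).
    by rewrite /S addnS -!sum_factor big_ord_recr /= addrAC.
  by rewrite (le_trans (ncD _ _))// mulrS addrC lerD// ncM ncX q1 expr1n mul1r.
have [m0 m0W m0h] : exists2 m0, (m0 <= W)%N & h <= nc (S m0).
  have [H|H] := leP h (nc (S (size s1))); first by exists (size s1) => //; lia.
  exists (size s1 + size s)%N; first by lia.
  have E : nc (twsum q b s) = nc (S (size s1 + size s)%N - S (size s1)).
    by rewrite S2 S1 addrAC subrr add0r ncM ncX q1 expr1n mul1r.
  have := ncB (S (size s1 + size s)%N) (S (size s1)); rewrite -E.
  move: hs H; rewrite mulr2n; lra.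
(* Each further term changes the sum by at most [B], so [T] terms lose at most [h / 2]. The
   [T + 1 > h / (2 B)] lengths together give [(h / 2)^2 h / (2 B) = h^3 / (8 B)]. *)
pose T := Num.truncn (h / (2 * B)).
have hB : 0 <= h / (2 * B) by rewrite divr_ge0// mulr_ge0// ltW.
have T1 : T%:R <= h / (2 * B) by rewrite truncn_le.
have T2 : h / (2 * B) < T.+1%:R by exact: truncnS_gt.
have Ts : (T <= size s)%N.
  rewrite -(ler_nat R); apply: le_trans T1 _; rewrite ler_pdivrMr ?mulr_gt0//.
  have := le_trans hs (twsum_le s q1 bB); rewrite -(mulr_natl B) mulr2n.
  have : 0 <= (size s)%:R * B by rewrite mulr_ge0// ltW.
  lra.
have FT t : (t <= T)%N -> (h / 2) ^+ 2 <= nc (S (m0 + t)%N) ^+ 2.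
  move=> tT; rewrite lerXn2r ?nnegrE ?nc_ge0 ?divr_ge0//.
  have H1 := Sstep m0 t; have H2 := ler_ncB (S m0) (S (m0 + t)%N).
  rewrite ncBC in H2; have H3 : B *+ t <= h / 2.
    rewrite -[leLHS]mulr_natl; apply: (@le_trans _ _ (T%:R * B)).
      by rewrite ler_wpM2r ?(ltW B0)// ler_nat.
    move: T1; rewrite ler_pdivlMr ?mulr_gt0//; lra.
  lra.
have := @sum_window_ge (fun m => nc (S m) ^+ 2) _ m0 T M (fun m => exprn_ge0 2 (nc_ge0 _)).
move=> /(_ ((h / 2) ^+ 2)) H; apply: (@le_trans _ _ ((h / 2) ^+ 2 *+ T.+1)).
  rewrite -[leRHS]mulr_natr; apply: (@le_trans _ _ ((h / 2) ^+ 2 * (h / (2 * B)))).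
    by rewrite le_eqVlt; apply/orP; left; apply/eqP; field; rewrite gt_eqF.
  by rewrite ler_wpM2l ?exprn_ge0 ?divr_ge0// ltW.
apply: le_trans (H _ FT) _; first by lia.
by apply: ler_sum => m _; rewrite /S -sum_factor.
Qed.

End PointwiseLowerBound.

Section EnergyLowerBound.
Variables (R : realType) (d : nat) (hd : (1 < d)%N).
Variables (zeta : 'I_d -> seq 'I_d) (alpha : R) (mu : probability (full_shift hd) R).
Hypothesis zeta_ne : nonerasing zeta.
Hypothesis zeta_prim : primitive_subst zeta.
Hypothesis mu_inv : invariant_probability zeta mu.
Hypothesis alpha1 : 1 < alpha.
Local Notation C := R[i].
Local Notation len n a := (size (subst_iter zeta n a)).

Lemma energy_lower_bound (K : R) :
  (forall n a, (len n a)%:R <= K * alpha ^+ n) ->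
  exists (M : nat -> nat) (C0 : R), [/\ 0 < C0,
    forall n, alpha ^+ n <= (M n)%:R, forall n, (M n)%:R <= C0 * alpha ^+ n &
  forall (om rho c : R) (b : 'rV[C]_d), 0 < c -> 0 < rho -> exists2 c', 0 < c' &
    forall n, (exists a, c * rho ^+ n <=
       nc (twsum (ecirc (- om)) (fun j => b 0 j) (subst_iter zeta n a))) ->
    c' * rho ^+ (3 * n) <= energy zeta mu b om (M n)].
Proof.
move=> HK; have [p Hp] := subst_space_window zeta_ne zeta_prim.
pose K1 := 1 + `|K| * alpha ^+ p.
have K11 : 1 <= K1 by rewrite lerDl mulr_ge0// exprn_ge0// ltW// (lt_trans _ alpha1).
have a0 : 0 < alpha by rewrite (lt_trans _ alpha1).
have an1 n : 1 <= alpha ^+ n by rewrite exprn_ege1// ltW.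
have Kn n : 0 <= K1 * alpha ^+ n by rewrite mulr_ge0 ?exprn_ge0 ?ltW// (lt_le_trans _ K11).
pose L n := Num.truncn (K1 * alpha ^+ n).
have L1 n : (L n)%:R <= K1 * alpha ^+ n by rewrite truncn_le.
have L2 n : K1 * alpha ^+ n < (L n).+1%:R by exact: truncnS_gt.
have lenL n m a : (m <= n + p)%N -> (len m a <= L n)%N.
  move=> mn; rewrite -ltnS -(ltr_nat R); apply: le_lt_trans (L2 n).
  apply: le_trans (_ : (len (n + p) a)%:R <= _).
    by rewrite ler_nat size_subst_iter_mono.
  apply: le_trans (HK _ _) _; rewrite exprD mulrCA [K1 * _]mulrC ler_wpM2l ?exprn_ge0 ?ltW//.
  rewrite /K1; apply: (@le_lt_trans _ _ (`|K| * alpha ^+ p)); last by rewrite ltrDr.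
  by rewrite ler_wpM2r ?exprn_ge0 ?(ltW a0)// ler_norm.
(* A window of length [2 L + 1] contains [zeta^n(a)], whose length is at most [L], and [4 L + 2]
   exceeds their sum. As [K1 >= 1], it is also at least [alpha ^+ n]. *)
exists (fun n => 4 * L n + 2)%N, (4 * K1 + 2); split.
- by rewrite addr_gt0// mulr_gt0// (lt_le_trans _ K11).
- move=> n; rewrite natrD natrM; have := L2 n; rewrite -natr1.
  have : 1 * alpha ^+ n <= K1 * alpha ^+ n by rewrite ler_wpM2r// exprn_ge0// ltW.
  have := an1 n; lra.
- move=> n; rewrite natrD natrM mulrDl; have := L1 n; have := an1 n; lra.
move=> om rho c b c0 rho0.
pose B := 1 + \sum_j nc (b 0 j).
have B0 : 0 < B by rewrite ltr_pwDl// sumr_ge0// => j _; exact: nc_ge0.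
have bB j : nc (b 0 j) <= B.
  rewrite /B (bigD1 j)//= addrCA lerDl addr_ge0// sumr_ge0// => k _; exact: nc_ge0.
exists ((c / 2) ^+ 3 / (8 * B)); first by rewrite divr_gt0 ?exprn_gt0 ?mulr_gt0 ?divr_gt0.
move=> n [a Ha]; apply: (energy_ge mu_inv) => x Xx.
have := @twsum_partial_sums_ge R d (ecirc (- om)) (fun j => b 0 j) B (c / 2 * rho ^+ n) x
  (subst_iter zeta n a) (2 * L n).+1 (4 * L n + 2)%N (nc_ecirc _) B0 bB.
have -> : (c / 2 * rho ^+ n) ^+ 3 / (8 * B) = (c / 2) ^+ 3 / (8 * B) * rho ^+ (3 * n).
  by rewrite exprMn -exprM mulnC mulrAC.
have -> : c / 2 * rho ^+ n *+ 2 = c * rho ^+ n by rewrite mulr2n; field.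
move=> H; apply: le_trans (H _ _ Ha _) _.
- by apply: (Hp n _ (L n)) => // e; exact: lenL.
- by rewrite mulr_ge0 ?divr_ge0 ?exprn_ge0 ?ltW.
- by have := lenL n n a (leq_addr _ _); lia.
rewrite le_eqVlt; apply/orP; left; apply/eqP; apply: eq_bigr => m _.
congr (nc _ ^+ 2); apply: eq_bigr => k _; congr (_ * _).
by rewrite -ecircMn mulr_natr mulNrn.
Qed.

End EnergyLowerBound.

(** * From the energy to the mean square of the correlations *)

Section CorrelationDecay.
Variables (R : realType) (d : nat) (hd : (1 < d)%N).
Variables (zeta : 'I_d -> seq 'I_d) (mu : probability (full_shift hd) R).
Hypothesis mu_inv : invariant_probability zeta mu.
Variable b : 'rV[R[i]]_d.
Local Notation f := (cyl_fun hd zeta b).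
Local Notation corr j := (nc (autocorr mu f j)).

Lemma corr_opp (k l : nat) : corr (k%:Z - l%:Z) = corr (l%:Z - k%:Z).
Proof.
rewrite -!(cintegral_shift_mul mu_inv) -[RHS]ncJ -cintegral_conj.
- congr nc; rewrite /cintegral; congr (_ +i* _); apply: eq_Rintegral => x _;
    by rewrite rmorphM /= conjcK mulrC.
- exact: measurableT.
- by apply: cbddM; [|apply: cbddJ]; exact: cyl_fun_shift_bdd.
Qed.

Lemma corr_dist (k l : nat) : corr (k%:Z - l%:Z) = corr (`|k - l|)%N.
Proof.
have [lk|kl] := leqP l k; first by rewrite subzn// distnEl.
by rewrite corr_opp subzn ?(ltnW kl)// distnEr// ltnW.
Qed.

(** For fixed [k] each distance occurs at most twice, once on either side of [k]. *)
Lemma sum_dist_le (a : nat -> R) (k m M : nat) : (forall j, 0 <= a j) ->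
  (k < m)%N -> (m <= M)%N ->
  \sum_(l < m) a `|k - l|%N <= 2 * \sum_(j < M) a j.
Proof.
move=> a0 km mM; rewrite -(big_mkord xpredT (fun l => a `|k - l|%N)).
rewrite -(big_mkord xpredT a) (big_cat_nat (n := k)) ?(ltnW km)//= mulrDl mul1r.
apply: lerD.
  rewrite big_nat_rev /= add0n.
  rewrite (eq_big_nat _ _ (F2 := fun l => a l.+1)); last first.
    move=> l /andP[_ lk]; congr a; lia.
  rewrite -(big_add1 _ _ 0 k.+1 xpredT a) [leRHS](big_cat_nat (n := 1)) //=; last by lia.
  rewrite -[leLHS]add0r lerD ?sumr_ge0//.
  by rewrite [leRHS](big_cat_nat (n := k.+1)) //=; [rewrite lerDl sumr_ge0|lia].
rewrite -{1}[k]add0n big_addn.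
rewrite (eq_big_nat _ _ (F2 := a)); last by move=> l _; congr a; lia.
by rewrite [leRHS](big_cat_nat (n := m - k)) //=; [rewrite lerDl sumr_ge0|lia].
Qed.

Lemma energy_le_corr (om : R) (M : nat) :
  energy zeta mu b om M <= M%:R * (M%:R * (2 * \sum_(j < M) corr j%:Z)).
Proof.
have c0 j : 0 <= corr j by exact: nc_ge0.
have S0 : 0 <= 2 * \sum_(j < M) corr j%:Z by rewrite mulr_ge0// sumr_ge0.
rewrite -[M in M%:R * _]card_ord -sum1_card natr_sum mulr_suml.
apply: ler_sum => m _; rewrite mul1r.
apply: (@le_trans _ _ (m%:R * (2 * \sum_(j < M) corr j%:Z))); last first.
  by rewrite ler_wpM2r// ler_nat ltnW.
rewrite -[X in X%:R * _]card_ord -sum1_card natr_sum mulr_suml.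
apply: ler_sum => k _; rewrite mul1r.
apply: le_trans (sum_dist_le (a := fun j => corr j%:Z) _ (ltn_ord k) (ltnW (ltn_ord m))) => //.
apply: ler_sum => l _; apply: le_trans (ler_norm _) _; apply: le_trans (nc_Re _) _.
by rewrite !ncM ncJ !nc_ecirc !mul1r corr_dist.
Qed.

(** The Cauchy-Schwarz inequality, from the nonnegativity of the squared deviations from the mean
    [A / m]. *)
Lemma sqr_sum_le (a : nat -> R) (M : nat) :
  (\sum_(j < M) a j) ^+ 2 <= M%:R * \sum_(j < M) a j ^+ 2.
Proof.
case: M => [|M]; first by rewrite !big_ord0 expr0n mul0r.
set A := \sum_(j < M.+1) a j; set m := M.+1%:R : R.
have m0 : 0 < m by rewrite ltr0n.
have : 0 <= \sum_(j < M.+1) (a j - A / m) ^+ 2 by apply: sumr_ge0 => j _; exact: sqr_ge0.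
have -> : \sum_(j < M.+1) (a j - A / m) ^+ 2 =
    \sum_(j < M.+1) a j ^+ 2 - A ^+ 2 / m.
  transitivity (\sum_(j < M.+1) (a j ^+ 2 - 2 * (A / m) * a j + (A / m) ^+ 2)).
    by apply: eq_bigr => j _; ring.
  rewrite big_split /= sumrB -mulr_sumr -/A sumr_const card_ord -[(A / m) ^+ 2 *+ _]mulr_natl -/m.
  by field; rewrite gt_eqF.
by rewrite subr_ge0 ler_pdivrMr// mulrC.
Qed.

(** Let [A] and [Q] be the sums of the moduli and of their squares. The energy is at most [2 M^2 A]
    and [A^2 <= M Q], so [e^2 <= 4 M^5 Q]; the mean takes one more factor [M]. *)
Lemma mean_corr_ge (om e : R) (M : nat) : (0 < M)%N -> 0 <= e ->
  e <= energy zeta mu b om M ->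
  e ^+ 2 / (4 * M%:R ^+ 6) <= M%:R^-1 * \sum_(0 <= k < M) corr k%:Z ^+ 2.
Proof.
move=> M0 e0 He; have m0 : 0 < M%:R :> R by rewrite ltr0n.
rewrite big_mkord; set Q := \sum_(k < M) _.
have H1 := le_trans He (energy_le_corr om M).
have H2 := sqr_sum_le (fun j => corr j%:Z) M; rewrite -/Q in H2.
set A := \sum_(j < M) _ in H1 H2.
have H3 : e ^+ 2 <= (M%:R * (M%:R * (2 * A))) ^+ 2.
  by rewrite lerXn2r ?nnegrE// (le_trans e0).
have H4 : e ^+ 2 <= 4 * M%:R ^+ 4 * (M%:R * Q).
  apply: le_trans H3 _; rewrite (_ : _ ^+ 2 = 4 * M%:R ^+ 4 * A ^+ 2); last by ring.
  by rewrite ler_wpM2l// mulr_ge0 ?exprn_ge0.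
rewrite ler_pdivrMr ?mulr_gt0 ?exprn_gt0//; apply: le_trans H4 _.
by rewrite le_eqVlt; apply/orP; left; apply/eqP; field; rewrite gt_eqF.
Qed.

End CorrelationDecay.

Section PowerAsymptotics.
Variable R : realType.

Lemma exprn_unbounded (x A : R) : 1 < x -> exists n0, forall n, (n0 <= n)%N -> A <= x ^+ n.
Proof.
move=> x1; have x0 : 0 < x by apply: lt_trans x1.
have A1 : 0 < 1 + `|A| by rewrite ltr_pwDl.
have [||n0 H] := @exprn_small R x^-1 (1 + `|A|)^-1.
- by rewrite invr_ge0 (ltW x0) invf_lt1.
- by rewrite invr_gt0.
exists n0 => n /H; rewrite exprVn lef_pV2 ?posrE ?exprn_gt0// => {}H.
by apply: le_trans H; have := ler_norm A; lra.
Qed.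

(** Up to constants, the lower bound for [Q n] is [alpha^(-6un)] and [M^(-theta)] is
    [alpha^(-theta n)]. Their quotient [beta ^+ n] tends to infinity because [6 u < theta], and it
    absorbs the constants. *)
Lemma mean_corr_unbounded (alpha u theta C C0 c' : R) (M : nat -> nat) (Q : nat -> R) n1 :
  1 < alpha -> 0 < theta -> 6 * u < theta -> 0 < c' -> 0 < C0 -> 0 < C ->
  (forall n, alpha ^+ n <= (M n)%:R) -> (forall n, (M n)%:R <= C0 * alpha ^+ n) ->
  (forall n, (n1 <= n)%N ->
     (c' * (alpha `^ (1 - u)) ^+ (3 * n)) ^+ 2 / (4 * (M n)%:R ^+ 6) <= Q n) ->
  exists n2, forall n, (n2 <= n)%N -> C * (M n)%:R `^ (- theta) <= Q n.
Proof.
move=> a1 t0 ut c0 C00 CC ML MU HQ; have a0 : 0 < alpha by apply: lt_trans a1.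
pose beta := alpha `^ (theta - 6 * u).
have beta1 : 1 < beta.
  rewrite -(powRr0 alpha) /beta -ltr_ln ?posrE ?powR_gt0// !ln_powR.
  by rewrite ltr_pM2r ?ln_gt0// subr_gt0.
have [n2 Hn2] := exprn_unbounded (4 * C0 ^+ 6 * C / c' ^+ 2) beta1.
exists (maxn n1 n2) => n; rewrite geq_max => /andP[n1n n2n].
apply: le_trans (HQ n n1n); have an0 : 0 < alpha ^+ n by rewrite exprn_gt0.
have M0 : 0 < (M n)%:R :> R by apply: lt_le_trans (ML n).
have HM : (M n)%:R `^ (- theta) <= (alpha ^+ n) `^ (- theta).
  rewrite !powRN lef_pV2 ?posrE ?powR_gt0//.
  by apply: ge0_ler_powR; rewrite ?nnegrE ?(ltW t0) ?(ltW an0) ?(ltW M0).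
have HM6 : (M n)%:R ^+ 6 <= C0 ^+ 6 * (alpha ^+ n) ^+ 6.
  by rewrite -exprMn lerXn2r ?nnegrE ?(ltW M0)// mulr_ge0 ?(ltW C00) ?(ltW an0).
apply: (@le_trans _ _ (C * (alpha ^+ n) `^ (- theta))); first by rewrite ler_pM2l.
have D0 : 0 < 4 * (C0 ^+ 6 * (alpha ^+ n) ^+ 6).
  by rewrite mulr_gt0// mulr_gt0// exprn_gt0.
have num0 : 0 <= (c' * (alpha `^ (1 - u)) ^+ (3 * n)) ^+ 2 by exact: sqr_ge0.
apply: (@le_trans _ _ ((c' * (alpha `^ (1 - u)) ^+ (3 * n)) ^+ 2 /
    (4 * (C0 ^+ 6 * (alpha ^+ n) ^+ 6)))); last first.
  rewrite ler_wpM2l// lef_pV2 ?posrE ?mulr_gt0 ?exprn_gt0//.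
  by rewrite ler_pM2l.
rewrite ler_pdivlMr//.
have e1 : (alpha ^+ n) `^ (- theta) * (alpha ^+ n) ^+ 6 * beta ^+ n =
    ((alpha `^ (1 - u)) ^+ (3 * n)) ^+ 2.
  have E k r : (alpha `^ r) ^+ k = alpha `^ (r * k%:R).
    by rewrite -powR_mulrn ?powR_ge0// -powRrM.
  have E1 k : alpha ^+ k = alpha `^ k%:R by rewrite powR_mulrn// ltW.
  rewrite -[_ ^+ (3 * n) ^+ 2]exprM -[alpha ^+ n ^+ 6]exprM /beta !E !E1 -powRrM.
  have nz (r s : R) : (r + s == 0) ==> (alpha != 0) by rewrite [alpha == 0]gt_eqF// implybT.
  rewrite -!powRD ?nz//; congr (_ `^ _); rewrite !natrM; ring.
rewrite exprMn -e1 -[leLHS]mulr1.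
have := Hn2 n n2n; rewrite ler_pdivrMr ?exprn_gt0// => H.
have P0 : 0 <= (alpha ^+ n) `^ (- theta) * (alpha ^+ n) ^+ 6.
  by apply: mulr_ge0; [exact: powR_ge0|apply: exprn_ge0; exact: ltW].
have := ler_wpM2l P0 H; lra.
Qed.

End PowerAsymptotics.

(** * Local dimension of the spectral measure *)

Section LocalDimensionBounds.
Variable R : realType.
Variable sigma : {finite_measure set (measurableTypeR R) -> \bar R}.

Lemma measurable_circle_ball (w r : R) : measurable (circle_ball w r).
Proof.
rewrite (_ : circle_ball w r = \bigcup_(m in [set: int]) ball (w + m%:~R : R) r).
  apply: countable_bigcupT_measurable => [|m]; first exact: countableP.
  exact: measurable_ball.
apply/seteqP; split => x /=.
  by move=> [m H]; exists m => //; rewrite -ball_normE /= distrC opprD addrA.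
by move=> [m _]; rewrite -ball_normE /= distrC opprD addrA => H; exists m.
Qed.

Lemma circle_ball_fin_num (w r : R) : sigma (circle_ball w r) \is a fin_num.
Proof. by apply: fin_num_measure; exact: measurable_circle_ball. Qed.

Lemma lower_local_dim_ge0 (w : R) : (0 <= lower_local_dim sigma w)%E.
Proof.
rewrite /lower_local_dim limf_einfE; apply/lee_addgt0Pr => e e0.
rewrite -leeBlDr// sub0e.
(* The maximum with 1 makes [ln s] nonnegative. Radii below [delta] satisfy [ln s <= - e * ln r], so
   the quotient is at least [-e]; where the ball has measure 0 the quotient is [+oo]. *)
pose s := Num.max 1 (fine (sigma setT)).
have s1 : 1 <= s by rewrite le_max lexx.
pose delta := expR (- (ln s / e)).
have d0 : 0 < delta by exact: expR_gt0.
have d1 : delta <= 1.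
  by rewrite /delta -[leRHS]expR0 ler_expR oppr_le0 divr_ge0 ?ln_ge0// ltW.
apply: le_trans (ereal_sup_ubound _); last first.
  exists [set r : R | 0 < r < delta] => //.
  near=> r; apply/andP; split; first by near: r; exact: nbhs_right_gt.
  by near: r; exact: nbhs_right_lt.
apply: le_ereal_inf_tmp => _ [r /= /andP[r0 rd] <-].
have lnr : ln r < 0 by apply: ln_lt0; rewrite r0 (lt_le_trans rd).
have fB := circle_ball_fin_num w r; set B := circle_ball w r in fB *.
have sB0 : (0 <= sigma B)%E by exact: measure_ge0.
have [sB|sB] := eqVneq (sigma B) 0%E.
  by rewrite sB le0_lneNy// mulNyr ltr0_sg ?invr_lt0// mulN1e /= leey.
have sBp : 0 < fine (sigma B).
  by rewrite fine_gt0// lt0e sB sB0 /= -ge0_fin_numE.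
rewrite -(fineK fB) lne_EFin// -EFinM ?lee_fin.
rewrite ler_ndivlMr//.
have H1 : ln (fine (sigma B)) <= ln s.
  rewrite ler_ln ?posrE ?(lt_le_trans ltr01 s1)// /s le_max; apply/orP; right.
  rewrite fine_le//; first by apply: fin_num_measure.
  by apply: le_measure; rewrite ?inE//; exact: measurable_circle_ball.
apply: le_trans H1 _.
have := rd; rewrite -ltr_ln ?posrE// /delta expRK => H2.
rewrite mulNr -mulrN -ler_pdivrMl// mulrC lerNr; exact: ltW.
Unshelve. all: end_near. Qed.

Lemma lower_local_dim_le (w e : R) :
  (forall delta, 0 < delta -> exists r, 0 < r < delta /\
     r `^ e <= fine (sigma (circle_ball w r))) ->
  (lower_local_dim sigma w <= e%:E)%E.
Proof.
move=> H; rewrite /lower_local_dim limf_einfE; apply: ge_ereal_sup => _ [V HV <-].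
have [delta /= d0 HV'] := HV.
(* Radii below 1 have a negative logarithm, so dividing by it reverses the inequality. *)
have d10 : 0 < Num.min delta 1 by rewrite lt_min d0 ltr01.
have [r [/andP[r0 rd] Hr]] := H (Num.min delta 1) d10.
have r1 : r < 1 by move: rd; rewrite lt_min => /andP[].
have Vr : V r.
  by apply: HV' => //=; rewrite sub0r normrN gtr0_norm//; move: rd; rewrite lt_min => /andP[].
apply: ge_ereal_inf; exists (lne (sigma (circle_ball w r)) * ((ln r)^-1)%:E)%E.
  by exists r.
have lnr : ln r < 0 by apply: ln_lt0; rewrite r0.
have fB := circle_ball_fin_num w r; set B := circle_ball w r in fB Hr *.
have sBp : 0 < fine (sigma B) by apply: lt_le_trans Hr; exact: powR_gt0.
rewrite -(fineK fB) lne_EFin// -EFinM lee_fin ler_ndivrMr//.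
by rewrite -ln_powR ler_ln ?posrE ?powR_gt0.
Qed.

End LocalDimensionBounds.

(** * The energy in terms of the spectral measure *)

Section SpectralEnergy.
Variables (R : realType) (d : nat) (hd : (1 < d)%N).
Variables (zeta : 'I_d -> seq 'I_d) (mu : probability (full_shift hd) R).
Variable b : 'rV[R[i]]_d.
Local Notation f := (cyl_fun hd zeta b).
Variable sigma : {finite_measure set (measurableTypeR R) -> \bar R}.
Hypothesis Hsigma : spectral_measure mu f sigma.
Local Notation D := (`[0%R, 1%R[%classic : set (measurableTypeR R)).

Lemma ecirc_bdd (t : R) : cbdd_measurable D (fun w : measurableTypeR R => ecirc (t * w)).
Proof.
have mt : measurable_fun setT (fun w : measurableTypeR R => 2 * pi * (t * w)).
  by apply: measurable_funM => //; apply: measurable_funM.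
split; split.
- apply: measurable_funTS; apply: (measurableT_comp _ mt).
  by apply: continuous_measurable_fun; exact: continuous_cos.
- by exists 1 => w; exact: cos_max.
- apply: measurable_funTS; apply: (measurableT_comp _ mt).
  by apply: continuous_measurable_fun; exact: continuous_sin.
- by exists 1 => w; exact: sin_max.
Qed.

Lemma energy_spectral (om : R) (M : nat) : energy zeta mu b om M =
  \sum_(m < M) \int[sigma]_(w in D)
    (nc (\sum_(k < m) ecirc (- (om * k%:R)) * ecirc (k%:R * w)) ^+ 2).
Proof.
apply: eq_bigr => m _.
have mD : measurable D by exact: measurable_itv.
rewrite (@Rintegral_sqr_nc_sum _ _ _ sigma D mD (fun k => ecirc (- (om * k%:R)))
  (fun k w => ecirc (k%:R * w))) => [|k]; last exact: ecirc_bdd.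
apply: eq_bigr => k _; apply: eq_bigr => l _; congr (complex.Re (_ * _)).
rewrite -(Hsigma.2 (k%:Z - l%:Z)).
have E (w : R) : ecirc (k%:R * w) * conjc (ecirc (l%:R * w)) =
   cos (2 * pi * (k%:Z - l%:Z)%:~R * w) +i* sin (2 * pi * (k%:Z - l%:Z)%:~R * w).
  rewrite -ecircN -ecircD /ecirc; have -> : k%:R * w + - (l%:R * w) = (k%:Z - l%:Z)%:~R * w.
    by rewrite intrB mulrBl.
  by rewrite !mulrA.
rewrite /cintegral; congr (_ +i* _); apply: eq_Rintegral => w _; by rewrite E.
Qed.

(** In the ball the trivial bound [m] is used; outside, [nc_ecircB1_ge] bounds the geometric sum by
    [2 / |q - 1| <= 2 / r]. *)
Lemma fejer_bound (om r w : R) (m : nat) : 0 < r ->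
  nc (\sum_(k < m) ecirc (- (om * k%:R)) * ecirc (k%:R * w)) ^+ 2 <=
  m%:R ^+ 2 * \1_(circle_ball om r) w + 4 / r ^+ 2.
Proof.
move=> r0; pose q := ecirc (w - om).
have -> : \sum_(k < m) ecirc (- (om * k%:R)) * ecirc (k%:R * w) = \sum_(k < m) q ^+ k.
  apply: eq_bigr => k _; rewrite -ecircD /q -ecircMn; congr ecirc.
  by rewrite -mulr_natl; ring.
have r4 : 0 <= 4 / r ^+ 2 by rewrite divr_ge0// sqr_ge0.
rewrite indicE; have [wB|wB] := pselect (circle_ball om r w).
  rewrite mem_set// mulr1 -[leLHS]addr0 lerD// lerXn2r ?nnegrE ?nc_ge0//.
  apply: le_trans (nc_sum _ _ _) _; rewrite -[leRHS]mulr1 mulr_natl -[X in _ <= _ *+ X]card_ord.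
  by rewrite -sumr_const ler_sum// => k _; rewrite ncX nc_ecirc expr1n.
rewrite memNset// mulr0 add0r.
have rq : r <= nc (q - 1).
  apply: nc_ecircB1_ge => j; rewrite leNgt; apply/negP => H.
  by apply: wB; exists j.
have -> : 4 / r ^+ 2 = (2 / r) ^+ 2 by field; rewrite gt_eqF.
rewrite lerXn2r ?nnegrE ?nc_ge0 ?divr_ge0 ?(ltW r0)// ler_pdivlMr//.
apply: (@le_trans _ _ (nc (\sum_(k < m) q ^+ k) * nc (q - 1))).
  by rewrite ler_wpM2l ?nc_ge0.
rewrite -ncM mulrC -subrX1 (le_trans (ncB _ _))// ncX nc_ecirc expr1n nc1//.
Qed.

Lemma energy_le_ball (om r : R) (M : nat) : 0 < r ->
  energy zeta mu b om M <=
  M%:R ^+ 3 * fine (sigma (circle_ball om r)) + M%:R * (4 / r ^+ 2) * fine (sigma setT).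
Proof.
move=> r0; have mD : measurable D by exact: measurable_itv.
have mB := measurable_circle_ball om r.
have fB := circle_ball_fin_num sigma om r.
have fT : sigma setT \is a fin_num by exact: fin_num_measure.
have r4 : 0 <= 4 / r ^+ 2 by rewrite divr_ge0// sqr_ge0.
rewrite energy_spectral.
apply: (@le_trans _ _ (\sum_(m < M) (M%:R ^+ 2 * fine (sigma (circle_ball om r)) +
    4 / r ^+ 2 * fine (sigma setT)))); last first.
  rewrite sumr_const card_ord -[leLHS]mulr_natl le_eqVlt; apply/orP; left; apply/eqP; ring.
apply: ler_sum => m _.
have bi : bdd_measurable D (fun w => m%:R ^+ 2 * \1_(circle_ball om r) w : R).
  apply: bddZ; split; first exact: measurable_indic.
  by exists 1 => x; rewrite indicE; case: (_ \in _); rewrite ?normr1 ?normr0.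
have bi' : bdd_measurable D (\1_(circle_ball om r) : _ -> R).
  split; first exact: measurable_indic.
  by exists 1 => x; rewrite indicE; case: (_ \in _); rewrite ?normr1 ?normr0.
apply: le_trans (le_Rintegral_bdd sigma mD _ (bddD bi (bdd_cst _ (4 / r ^+ 2)))
  (fun w _ => @fejer_bound om r w m r0)) _.
  apply: bdd_sqr_nc; apply: cbdd_sum => k; apply: cbddM; first exact: cbdd_cst.
  exact: ecirc_bdd.
have i1 := bdd_integrable sigma mD bi.
have i2 := bdd_integrable sigma mD (bdd_cst D (4 / r ^+ 2)).
rewrite RintegralD//.
rewrite RintegralZ_bdd// Rintegral_cst//.
apply: lerD.
  apply: ler_pM; rewrite ?exprn_ge0//.
  - by apply: Rintegral_ge0 => x _; rewrite indicE.
  - by rewrite lerXn2r ?nnegrE// ler_nat ltnW.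
  rewrite /Rintegral integral_indic// fine_le//.
    by apply: fin_num_measure; exact: measurableI.
  by apply: le_measure; rewrite ?inE//; exact: measurableI.
rewrite ler_wpM2l// fine_le//; first exact: fin_num_measure.
by apply: le_measure; rewrite ?inE.
Qed.

End SpectralEnergy.

Section DimensionUpperBound.
Variable R : realType.

(* At the radius [r = alpha^((2u-1)n)] the tail [M n / r^2 ~ alpha^((3-4u)n)] is
   negligible against [En n >= c' alpha^((3-3u)n)]. *)
Lemma local_dim_from_energy (sigma : {finite_measure set (measurableTypeR R) -> \bar R})
    (om alpha u e C0 c' : R) (M : nat -> nat) (En : nat -> R) n1 :
  1 < alpha -> 0 < u -> 3 * u < (1 - 2 * u) * e -> 0 < e -> 0 < c' -> 0 < C0 ->
  (forall n, (M n)%:R <= C0 * alpha ^+ n) ->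
  (forall n, (n1 <= n)%N -> c' * (alpha `^ (1 - u)) ^+ (3 * n) <= En n) ->
  (forall n r, 0 < r -> En n <= (M n)%:R ^+ 3 * fine (sigma (circle_ball om r)) +
     (M n)%:R * (4 / r ^+ 2) * fine (sigma setT)) ->
  (lower_local_dim sigma om <= e%:E)%E.
Proof.
move=> a1 u0 ue e0 c0 C00 MU HE HB; have a0 : 0 < alpha by apply: lt_trans a1.
have u2 : 0 < 1 - 2 * u.
  have : 0 < (1 - 2 * u) * e by apply: lt_trans ue; rewrite mulr_gt0.
  by rewrite pmulr_lgt0.
have pow1 t : 0 < t -> 1 < alpha `^ t.
  by move=> t0; rewrite -(powRr0 alpha) -ltr_ln ?posrE ?powR_gt0// !ln_powR
    ltr_pM2r ?ln_gt0.
apply: lower_local_dim_le => delta d0.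
set s1 := fine (sigma setT) in HB.
have s10 : 0 <= s1 by exact: fine_ge0.
(* From [na] on the tail is at most half of the lower bound for the energy; from [nb] on the gain
   from [3 u < (1 - 2 u) e] absorbs the constants; from [nc'] on the radius is below [delta]. *)
have [na Hna] := exprn_unbounded (8 * C0 * s1 / c') (pow1 _ u0).
have ue' : 0 < (1 - 2 * u) * e - 3 * u by rewrite subr_gt0.
have [nb Hnb] := exprn_unbounded (2 * C0 ^+ 3 / c') (pow1 _ ue').
have [nc' Hnc] := exprn_unbounded (2 / delta) (pow1 _ u2).
pose n := maxn n1 (maxn na (maxn nb nc')).
have [n1n nan nbn ncn] : [/\ n1 <= n, na <= n, nb <= n & nc' <= n]%N.
  by rewrite /n !leq_max !leqnn !orbT.
pose r := (alpha `^ (1 - 2 * u)) ^- n.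
have P0 t : 0 < (alpha `^ t) ^+ n by rewrite exprn_gt0// powR_gt0.
have r0 : 0 < r by rewrite invr_gt0.
exists r; split.
  rewrite r0 /=; have := Hnc n ncn; rewrite ler_pdivrMr// => H.
  rewrite /r invf_plt ?posrE//.
  have : delta^-1 * 2 <= (alpha `^ (1 - 2 * u)) ^+ n by rewrite mulrC ler_pdivrMr.
  have : 0 < delta^-1 by rewrite invr_gt0.
  lra.
have HEn := le_trans (HE n n1n) (HB n r r0).
have E k t : (alpha `^ t) ^+ k = alpha `^ (t * k%:R).
  by rewrite -powR_mulrn ?powR_ge0// -powRrM.
have E1 k : alpha ^+ k = alpha `^ k%:R by rewrite powR_mulrn// ltW.
have nz (x y : R) : (x + y == 0) ==> (alpha != 0) by rewrite [alpha == 0]gt_eqF// implybT.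
have an0 : 0 < alpha ^+ n by rewrite exprn_gt0.
set S := fine _ in HEn *.
have S0 : 0 <= S by exact: fine_ge0.
have M0 : 0 <= (M n)%:R :> R by [].
have HM3 : (M n)%:R ^+ 3 <= C0 ^+ 3 * alpha ^+ (3 * n).
  by rewrite mulnC exprM -exprMn lerXn2r ?nnegrE// mulr_ge0 ?(ltW C00) ?(ltW an0).
have rE : r ^+ 2 * (alpha `^ (1 - 2 * u)) ^+ n ^+ 2 = 1.
  by rewrite -exprMn mulVf ?expr1n// gt_eqF.
have Htail : (M n)%:R * (4 / r ^+ 2) * s1 <= c' / 2 * (alpha `^ (1 - u)) ^+ (3 * n).
  have -> : 4 / r ^+ 2 = 4 * (alpha `^ (1 - 2 * u)) ^+ n ^+ 2.
    by rewrite /r -exprVn invrK.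
  apply: (@le_trans _ _ (C0 * alpha ^+ n * (4 * (alpha `^ (1 - 2 * u)) ^+ n ^+ 2) * s1)).
    by rewrite !ler_wpM2r// mulr_ge0// sqr_ge0.
  have -> : (alpha `^ (1 - u)) ^+ (3 * n) =
      alpha ^+ n * (alpha `^ (1 - 2 * u)) ^+ n ^+ 2 * (alpha `^ u) ^+ n.
    rewrite -[_ ^+ n ^+ 2]exprM !E !E1 -!powRD ?nz//; congr (_ `^ _).
    by rewrite !natrM; ring.
  have := Hna n nan; rewrite ler_pdivrMr// => H.
  set X := alpha ^+ n * _ ^+ 2.
  have X0 : 0 <= X by rewrite mulr_ge0 ?sqr_ge0 ?(ltW an0).
  have := ler_wpM2l X0 H; rewrite /X; lra.
have Hmain : c' / 2 * (alpha `^ (1 - u)) ^+ (3 * n) <= C0 ^+ 3 * alpha ^+ (3 * n) * S.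
  have := ler_wpM2r S0 HM3; lra.
have rS : r `^ e = (alpha `^ ((1 - 2 * u) * e)) ^- n.
  rewrite /r E -powRN -powRrM E -powRN; congr (_ `^ _); ring.
have a3 : 0 < alpha ^+ (3 * n) by rewrite exprn_gt0.
rewrite rS -(ler_pM2l (_ : 0 < C0 ^+ 3 * alpha ^+ (3 * n))); last first.
  by rewrite mulr_gt0// exprn_gt0.
apply: le_trans Hmain; rewrite ler_pdivrMr//.
have -> : c' / 2 * (alpha `^ (1 - u)) ^+ (3 * n) * (alpha `^ ((1 - 2 * u) * e)) ^+ n =
    c' / 2 * (alpha ^+ (3 * n) * (alpha `^ ((1 - 2 * u) * e - 3 * u)) ^+ n).
  rewrite -mulrA; congr (_ * _); rewrite !E !E1 -!powRD ?nz//; congr (_ `^ _).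
  by rewrite !natrM; ring.
have := Hnb n nbn; rewrite ler_pdivrMr// => H.
have := ler_wpM2l (ltW a3) H; lra.
Qed.

End DimensionUpperBound.

(** * Null sets and conclusion *)

Section NullSets.
Variable R : realType.
Local Notation mR := (measurableTypeR R).
Local Notation C := R[i].

Definition linform n (a : 'I_n -> R) (t : n.-tuple mR) : R :=
  \sum_i a i * (tnth t i : R).

Lemma measurable_linform n (a : 'I_n -> R) : measurable_fun setT (linform a : _ -> mR).
Proof.
apply: measurable_sum => i; apply: measurable_funM => //.
exact: measurable_tnth.
Qed.

Lemma measurable_hyperplane n (a : 'I_n -> R) (c : R) :
  measurable [set t : n.-tuple mR | linform a t = c].
Proof.
rewrite (_ : [set t | _] = setT `&` (linform a : _ -> mR) @^-1` [set c]).
  by apply: measurable_linform => //; exact: measurable_set1.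
by apply/seteqP; split => t /= => [|[]].
Qed.

(** Fubini in the first coordinate. If another coefficient is nonzero, the sections are hyperplanes
    with varying right-hand sides, null by induction; otherwise the set is a point times the whole
    space. *)
Lemma hyperplane_null n (a : 'I_n -> R) (c : R) : (exists i, a i != 0) ->
  lebesgue_tuple R n [set t | linform a t = c] = 0%E.
Proof.
elim: n a c => [|n IH] a c [i ai]; first by case: i ai.
pose a' (j : 'I_n) := a (lift ord0 j).
have lf (x : mR) (t : n.-tuple mR) :
    linform a (tcons (x, t)) = a ord0 * (x : R) + linform a' t.
  rewrite /linform big_ord_recl; congr (_ + _).
  by apply: eq_bigr => j _; rewrite /a' (tnth_nth x) (tnth_nth x).
rewrite /= /lebesgue_cons /pushforward.
set A := _ @^-1` _.
have mA : measurable A.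
  rewrite -[X in measurable X]setTI; apply: measurable_tcons => //.
  exact: measurable_hyperplane.
have [[j aj]|na] := pselect (exists j, a' j != 0).
  rewrite /product_measure1 /= integral0_eq// => x _.
  rewrite (_ : xsection A x = [set t | linform a' t = c - a ord0 * (x : R)]).
    by apply: IH; exists j.
  apply/seteqP; split => t; rewrite /xsection /= inE /A /= lf.
    by move=> <-; rewrite addrC addKr.
  by move=> ->; rewrite addrC subrK.
have a0 : a ord0 != 0.
  move: ai; case: (unliftP ord0 i) => [j ->|->//] aj.
  by exfalso; apply: na; exists j.
have lf0 t : linform a' t = 0.
  by rewrite /linform big1// => j _; have [->|H] := eqVneq (a' j) 0;
    [rewrite mul0r|case: na; exists j].
rewrite (_ : A = [set c / a ord0] `*` setT).
  rewrite product_measure1E// [X in (X * _)%E](_ : _ = 0%E) ?mul0e//.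
  exact: lebesgue_measure_set1.
apply/seteqP; split => -[x t]; rewrite /A /= lf lf0 addr0.
  by move=> <-; split=> //; rewrite mulrC mulKf.
by move=> [-> _]; rewrite mulrC divfK.
Qed.

(** The real part of the equation is one real linear equation, with coefficients [Re y] and
    [- Im y], and one of these is nonzero. *)
Lemma functional_null n (y : 'cV[C]_n) : y != 0 ->
  (lebesgue_tuple R (n + n)).-negligible [set t | cvec t *m y = 0].
Proof.
move=> y0.
pose a (i : 'I_(n + n)) : R := match fintype.split i with
  | inl j => complex.Re (y j 0) | inr j => - complex.Im (y j 0) end.
apply: (@negligibleS _ _ _ _ [set t | linform a t = 0]).
  move=> t /= /(congr1 (fun m : 'M[C]_1 => complex.Re (m 0 0))).
  rewrite !mxE /= => E; rewrite -[RHS]E Re_sum /linform big_split_ord /=.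
  rewrite -big_split /=; apply: eq_bigr => j _; rewrite /a.
  rewrite (unsplitK (inl j : 'I_n + 'I_n)%type) (unsplitK (inr j : 'I_n + 'I_n)%type).
  rewrite ReM mxE /=; ring.
apply/negligibleP; first exact: measurable_hyperplane.
apply: hyperplane_null.
have /cV0Pn[j yj] := y0.
have [yr|yr] := eqVneq (complex.Re (y j 0)) 0; last first.
  by exists (lshift n j); rewrite /a (unsplitK (inl j : 'I_n + 'I_n)%type).
exists (rshift n j); rewrite /a (unsplitK (inr j : 'I_n + 'I_n)%type) oppr_eq0.
apply: contra yj => /eqP yi; by rewrite eq_complex yr yi !eqxx.
Qed.

(** [E] is only a predicate, so it is realized first as the row space of a matrix: vectors of [E]
    are added as long as they raise the rank, which cannot exceed [n]. Then [y] is a column of the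
    cokernel matrix that does not vanish on [b1]. *)
Lemma proper_subspace_functional n (E : 'rV[C]_n -> Prop) (b0 b1 : 'rV[C]_n) :
  (forall k v1 v2, E v1 -> E v2 -> E (k *: v1 + v2)) -> E b0 -> ~ E b1 ->
  exists2 y : 'cV[C]_n, y != 0 & forall v, E v -> v *m y = 0.
Proof.
move=> Elin Eb0 nEb1.
have E0 : E 0 by rewrite -(addNr b0) -scaleN1r; exact: Elin.
have [A [AE EA]] : exists A : 'M[C]_n, (forall v : 'rV_n, (v <= A)%MS -> E v) /\
    forall v, E v -> (v <= A)%MS.
  suff H k : (exists A : 'M[C]_n, (forall v : 'rV_n, (v <= A)%MS -> E v) /\
        (k <= \rank A)%N) \/
      exists A : 'M[C]_n, (forall v : 'rV_n, (v <= A)%MS -> E v) /\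
        forall v, E v -> (v <= A)%MS.
    have [[A [_ rA]]|//] := H n.+1.
    by have := leq_trans rA (rank_leq_row A); rewrite ltnn.
  elim: k => [|k [[A [AE rA]]|]]; [left|..|by right].
    by exists 0; split => // v; rewrite submx0 => /eqP ->.
  have [H|H] := pselect (forall v, E v -> (v <= A)%MS); first by right; exists A.
  have [v [Ev nv]] : exists v, E v /\ ~ (v <= A)%MS.
    by apply: contrapT => nv; apply: H => v Ev; apply: contrapT => vA; apply: nv; exists v.
  left; exists (A + v)%MS; split.
    move=> u /sub_addsmxP[[u1 u2] /= ->]; rewrite addrC [u2]mx11_scalar mul_scalar_mx.
    by apply: Elin => //; apply: AE; exact: submxMl.
  apply: leq_ltn_trans rA _; apply: rank_ltmx; rewrite ltmxE addsmxSl /=.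
  by apply/negP => /(submx_trans (addsmxSr _ _)).
have nb1 : ~~ (b1 <= A)%MS by apply/negP => /AE.
have /rV0Pn[j bj] : b1 *m cokermx A != 0 by rewrite -submxE.
have colM (v : 'rV[C]_n) : v *m col j (cokermx A) = col j (v *m cokermx A).
  by rewrite !colE mulmxA.
exists (col j (cokermx A)).
  apply: contraNneq bj => E'; have := congr1 (fun c => (b1 *m c) 0 0) E'.
  by rewrite mulmx0 colM mxE [RHS]mxE => ->.
move=> v /EA; rewrite submxE => /eqP vA; rewrite colM vA.
by apply/matrixP => i k; rewrite !mxE.
Qed.

End NullSets.

Lemma ecircN_neq1 (R : realType) (om : R) : 0 < om < 1 -> ecirc (- om) != 1.
Proof.
move=> /andP[p0 p1]; apply/negP => /eqP /ecirc_eq1[m Hm].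
have H1 : (m%:~R : R) < 0%:~R by rewrite -Hm oppr_lt0.
have H2 : ((-1)%:~R : R) < m%:~R by rewrite -Hm rmorphN ltrN2.
by move: H1 H2; rewrite !ltr_int; lia.
Qed.

(** * Assembling frequencies, energies and null sets *)

Section Assembly.
Variables (R : realType) (d : nat) (hd : (1 < d)%N).
Variables (zeta : 'I_d -> seq 'I_d) (alpha : R) (mu : probability (full_shift hd) R).
Hypothesis zeta_ne : nonerasing zeta.
Hypothesis zeta_prim : primitive_subst zeta.
Hypothesis salem : Salem_type zeta alpha.
Hypothesis mu_inv : invariant_probability zeta mu.
Local Notation C := R[i].
Local Notation len n a := (size (subst_iter zeta n a)).

Lemma len_le : exists K : R, forall n a, (len n a)%:R <= K * alpha ^+ n.
Proof.
have [z [j0 [j2 [P [[uP EP _] [_ z0 z1 _]]]]]] := salem_spectrum hd salem.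
have a1 := alpha_gt1 salem; have a0 : 0 < alpha by apply: lt_trans a1.
have [c Hc] := len_spectral uP EP.
exists (\sum_a \sum_j nc (c a j)) => n a.
rewrite -[leLHS]nc_nat Hc; apply: le_trans (nc_sum _ _ _) _.
rewrite mulr_suml [leRHS](bigD1 a)//= -[leLHS]addr0 lerD//; last first.
  apply: sumr_ge0 => e _; apply: mulr_ge0; last by rewrite exprn_ge0// ltW.
  by apply: sumr_ge0 => j _; exact: nc_ge0.
rewrite mulr_suml ler_sum// => j _; rewrite ncM ncX ler_wpM2l ?nc_ge0//.
apply: lerXn2r; rewrite ?nnegrE ?nc_ge0 ?(ltW a0)//.
have [->|/z1 H] := eqVneq j j0; first by rewrite z0 ncC gtr0_norm.
by apply: le_trans H _; exact: ltW.
Qed.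

(** The exceptional subspace is enlarged to the kernel of one functional [y], which still
    annihilates the constants. [M] and [C0] are chosen before [u], so the same lengths serve all
    frequencies. *)
Lemma frequency_with_energy : exists (M : nat -> nat) (C0 : R), [/\ 0 < C0,
    forall n, alpha ^+ n <= (M n)%:R, forall n, (M n)%:R <= C0 * alpha ^+ n &
  forall u : R, 0 < u < 1 -> exists (om : R) (y : 'cV[C]_d),
    [/\ Z_adjoin alpha om /\ 0 < om < 1, y != 0, (const_mx 1 : 'rV[C]_d) *m y = 0 &
    forall b : 'rV[C]_d, b *m y != 0 -> exists c' n1, 0 < c' /\
      forall n, (n1 <= n)%N ->
        c' * (alpha `^ (1 - u)) ^+ (3 * n) <= energy zeta mu b om (M n)]].
Proof.
have a1 := alpha_gt1 salem; have a0 : 0 < alpha by apply: lt_trans a1.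
have [K HK] := len_le.
have [M [C0 [C00 ML MU HE]]] := energy_lower_bound zeta_ne zeta_prim mu_inv a1 HK.
exists M, C0; split=> // u /andP[u0 u1].
have [z [j0 [j2 [P [[uP EP _] [_ z0 z1 _]]]]]] := salem_spectrum hd salem.
pose rho := alpha `^ (1 - u).
have rho0 : 0 < rho by exact: powR_gt0.
have rho1 : 1 < rho < alpha.
  apply/andP; split; rewrite -ltr_ln ?posrE//.
    by rewrite ln1 ln_powR mulr_gt0 ?subr_gt0 ?ln_gt0.
  by rewrite ln_powR gtr_pMl ?ln_gt0// ltrBlDr ltrDl.
have [eta eta0 Heta] := twisted_growth uP EP z0 z1 a1 rho1.
have [om [om01 Zom Hph Hdet]] := good_frequency hd salem eta0.
have qn1 : ecirc (- om) != 1 by exact: ecircN_neq1.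
have [E [Elin E1 [b1 nEb1] Egrow]] := Heta om qn1 Hph Hdet.
have [y y0 Hy] := proper_subspace_functional Elin E1 nEb1.
exists om, y; split=> //; first by rewrite Hy.
move=> b bn0; have nEb : ~ E b by move=> /Hy /eqP; rewrite (negPf bn0).
have [c [n1 [c0 Hc]]] := Egrow b nEb.
have [c' c'0 Hc'] := HE om rho c b c0 rho0.
exists c', n1; split=> // n n1n; apply: Hc'.
by have [a] := Hc n n1n; rewrite mxE; exists a.
Qed.

(** [nu] lists the measures of the cylinders. Its value 1 on the constant vector is what splits
    every vector into a constant and a vector of mean zero. *)
Lemma cintegral_cyl_fun : exists nu : 'cV[C]_d,
  (forall b : 'rV[C]_d, cintegral mu setT (cyl_fun hd zeta b) = (b *m nu) 0 0) /\
  ((const_mx 1 : 'rV[C]_d) *m nu) 0 0 = 1.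
Proof.
pose I1 j : R := \int[mu]_x (\1_(cylinder hd zeta j) x).
have mcyl j : measurable (cylinder hd zeta j).
  rewrite /cylinder (_ : [set x | _] = (subst_space zeta : set (full_shift hd)) `&`
      [set x : full_shift hd | pred1 j (x 0)]).
    by apply: measurableI; [exact: measurable_subst_space|exact: measurable_coord].
  by apply/seteqP; split=> x /= [? /eqP ?]; split=> //; apply/eqP.
have b1 j : bdd_measurable setT (\1_(cylinder hd zeta j) : _ -> R).
  split; first exact: measurable_indic.
  by exists 1 => x; rewrite indicE; case: (_ \in _); rewrite ?normr1 ?normr0.
have H (b : 'rV[C]_d) : cintegral mu setT (cyl_fun hd zeta b) =
    (b *m (\col_j (I1 j)%:C)) 0 0.
  rewrite mxE /cintegral; apply/eqP; rewrite eq_complex /= Re_sum Im_sum.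
  apply/andP; split; apply/eqP.
    transitivity (\int[mu]_x \sum_(j < d) complex.Re (b 0 j) * \1_(cylinder hd zeta j) x : R).
      apply: eq_Rintegral => x _; rewrite /cyl_fun Re_sum; apply: eq_bigr => j _.
      by rewrite !indicE; case: (_ \in _); rewrite ?mulr0n ?mulr1n ?mulr0 ?mulr1.
    rewrite Rintegral_sum_bdd//; last by move=> j _; apply: bddZ.
    apply: eq_bigr => j _; rewrite RintegralZ_bdd// mxE ReM /= mulr0 subr0//.
  transitivity (\int[mu]_x \sum_(j < d) complex.Im (b 0 j) * \1_(cylinder hd zeta j) x : R).
    apply: eq_Rintegral => x _; rewrite /cyl_fun Im_sum; apply: eq_bigr => j _.
    by rewrite !indicE; case: (_ \in _); rewrite ?mulr0n ?mulr1n ?mulr0 ?mulr1.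
  rewrite Rintegral_sum_bdd//; last by move=> j _; apply: bddZ.
  by apply: eq_bigr => j _; rewrite RintegralZ_bdd// mxE ImM /= mulr0 add0r.
exists (\col_j (I1 j)%:C); split=> //; rewrite -H /cintegral.
have mX := @measurable_subst_space d hd zeta.
have E x : cyl_fun hd zeta (const_mx 1 : 'rV[C]_d) x =
    (\1_(subst_space zeta : set (full_shift hd)) x)%:C.
  have [Xx|Xx] := pselect (subst_space zeta x).
    by rewrite cyl_funE// mxE indicE mem_set.
  by rewrite cyl_fun_out// indicE memNset.
apply/eqP; rewrite eq_complex /=; apply/andP; split; apply/eqP.
  transitivity (\int[mu]_x (\1_(subst_space zeta : set (full_shift hd)) x) : R).
    by apply: eq_Rintegral => x _; rewrite E.
  rewrite /Rintegral integral_indic// setIT.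
  by rewrite [X in fine X](mu_inv.1).
transitivity (\int[mu]_(x in setT) (0 : R)); last by rewrite Rintegral_cst// mul0r.
by apply: eq_Rintegral => x _; rewrite E.
Qed.

Lemma ae_cvec_off_kernels m (y : nat -> 'cV[C]_m) (Q : 'rV[C]_m -> Prop) :
  (forall k, y k != 0) -> (forall b, (forall k, b *m y k != 0) -> Q b) -> ae_cvec Q.
Proof.
move=> y0 HQ; rewrite /ae_cvec /almost_everywhere.
apply: (@negligibleS _ _ _ _ (\bigcup_k [set t | cvec t *m y k = 0])).
  move=> t /= nQ; apply: contrapT => nU; apply: nQ; apply: HQ => k.
  by apply/eqP => H; apply: nU; exists k.
by apply: negligible_bigcup => k; exact: functional_null.
Qed.

End Assembly.

Theorem theorem2p7 (R : realType) (d : nat) (hd : (1 < d)%N)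
    (zeta : 'I_d -> seq 'I_d) (alpha : R)
    (mu : probability (full_shift hd) R) :
  nonerasing zeta -> primitive_subst zeta -> aperiodic_subst zeta ->
  Salem_type zeta alpha -> invariant_probability zeta mu ->
  ae_cvec (fun b : 'rV[R[i]]_d =>
    forall sigma : {finite_measure set (measurableTypeR R) -> \bar R},
      spectral_measure mu (cyl_fun hd zeta b) sigma ->
      ereal_inf [set lower_local_dim sigma w |
                 w in Z_adjoin alpha `&` `]0, 1[] = 0%E)
  /\
  ae_subspace [set b : 'rV[R[i]]_d | cintegral mu setT (cyl_fun hd zeta b) = 0]
    (fun b => forall theta C : R, 0 < theta -> 0 < C ->
      exists N : nat -> nat,
        N @ \oo --> \oo /\
        forall i : nat, (0 < N i)%N /\
          C * (N i)%:R `^ (- theta) <=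
          (N i)%:R^-1 * \sum_(0 <= k < N i)
             Normc.normc (autocorr mu (cyl_fun hd zeta b) k%:Z) ^+ 2).
Proof.
move=> zeta_ne zeta_prim _ salem mu_inv.
have a1 := alpha_gt1 salem; have a0 : 0 < alpha by apply: lt_trans a1.
have [M [C0 [C00 ML MU Hfreq]]] := frequency_with_energy zeta_ne zeta_prim salem mu_inv.
pose u (k : nat) : R := k.+2%:R^-1.
have u01 k : 0 < u k < 1 by rewrite invr_gt0 ltr0n /= invf_lt1 ?ltr0n// ltr1n.
have usmall e : 0 < e -> exists k, u k < e.
  move=> e0; exists (Num.truncn e^-1); rewrite /u invf_plt ?posrE//.
  by apply: lt_trans (truncnS_gt _) _; rewrite ltr_nat.
have /choice[om /choice[y Hy]] := fun k => Hfreq (u k) (u01 k).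
have y0 k : y k != 0 by case: (Hy k).
split.
  apply: (ae_cvec_off_kernels y0) => b Hb sigma Hsigma.
  apply/eqP; rewrite eq_le; apply/andP; split; last first.
    by apply: le_ereal_inf_tmp => _ [w _ <-]; exact: lower_local_dim_ge0.
  apply/lee_addgt0Pr => e e0; rewrite add0e.
  (* [u < e / (3 + 2 e)] is the condition [3 u < (1 - 2 u) e] solved for [u]. *)
  have e3 : 0 < 3 + 2 * e by rewrite addr_gt0// mulr_gt0.
  have [k Hk] := usmall (e / (3 + 2 * e)) (divr_gt0 e0 e3).
  have [[Zom om01] _ _ Hgrow] := Hy k.
  have [c' [n1 [c0 Hc]]] := Hgrow b (Hb k).
  apply: ge_ereal_inf; exists (lower_local_dim sigma (om k)).
    by exists (om k) => //; split => //=; rewrite in_itv.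
  have u0 : 0 < u k by case/andP: (u01 k).
  apply: (local_dim_from_energy a1 u0 _ e0 c0 C00 MU Hc).
    by move: Hk; rewrite ltr_pdivlMr//; lra.
  by move=> n r r0; exact: energy_le_ball.
have [nu [Hnu nu1]] := cintegral_cyl_fun mu_inv.
exists (\rank (kermx nu)), (row_base (kermx nu)); split.
- exact: row_base_free.
- apply/seteqP; split => v /=; rewrite eq_row_base Hnu.
    move=> vn; apply/sub_kermxP/matrixP => i j.
    by rewrite (ord1 i) (ord1 j) vn mxE.
  by move=> /sub_kermxP ->; rewrite mxE.
pose By k := row_base (kermx nu) *m y k.
apply: (@ae_cvec_off_kernels R _ By) => [k|c Hc theta C1 theta0 C10].
  apply: contra (y0 k) => /eqP B0; have [_ _ y1 _] := Hy k.
  (* If [y k] vanished on the vectors of mean zero, it would vanish everywhere, because it also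
     annihilates the constants and [v'] is [v] minus its mean. *)
  have Hv (v : 'rV_d) : v *m y k = 0.
    pose v' := v - (v *m nu) *m (const_mx 1 : 'rV_d).
    have : (v' <= row_base (kermx nu))%MS.
      rewrite eq_row_base; apply/sub_kermxP; rewrite mulmxBl -[_ *m _ *m nu]mulmxA.
      rewrite (_ : (const_mx 1 : 'rV_d) *m nu = 1%:M) ?mulmx1 ?subrr//.
      by apply/matrixP => i j; rewrite (ord1 i) (ord1 j) nu1 mxE eqxx.
    move=> /submxP[D ED]; have : v' *m y k = 0.
      by rewrite ED -mulmxA -/(By k) B0 mulmx0.
    by rewrite /v' mulmxBl -[_ *m const_mx 1 *m _]mulmxA y1 mulmx0 subr0.
  by apply/eqP/row_matrixP => i; rewrite rowE Hv row0.
have theta6 : 0 < theta / 6 by rewrite divr_gt0.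
have [k Hk] := usmall (theta / 6) theta6.
have [[Zom om01] _ _ Hgrow] := Hy k.
set b := c *m _.
have [|c' [n1 [c0 Hc']]] := Hgrow b; first by rewrite /b -mulmxA Hc.
pose Q n : R := (M n)%:R^-1 * \sum_(0 <= j < M n)
  Normc.normc (autocorr mu (cyl_fun hd zeta b) j%:Z) ^+ 2.
have M0 n : (0 < M n)%N.
  by rewrite -(ltr_nat R); apply: lt_le_trans (ML n); rewrite exprn_gt0.
have uk : 6 * u k < theta by move: Hk; rewrite ltr_pdivlMr//; lra.
have [|n2 Hn2] := @mean_corr_unbounded R alpha (u k) theta C1 C0 c' M Q n1
  a1 theta0 uk c0 C00 C10 ML MU.
  move=> n n1n; apply: (mean_corr_ge mu_inv (M0 n) _ (Hc' n n1n)).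
  by rewrite mulr_ge0 ?exprn_ge0 ?powR_ge0 ?(ltW c0).
(* Starting at [n2] makes the inequality hold for every index of the sequence. *)
exists (fun i => M (n2 + i)%N); split; last first.
  by move=> i; split=> //; apply: Hn2; exact: leq_addr.
apply/cvgnyPge => A; have [n3 Hn3] := exprn_unbounded A%:R a1.
exists n3 => // n /= n3n; rewrite -(ler_nat R); apply: le_trans (ML _).
by apply: Hn3; rewrite (leq_trans n3n)// leq_addl.
Qed.
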